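(* Let $M$ and $N$ be stable configurations. Then: (1) $M \Rrightarrow N$ if and only if either $M \twoheadrightarrow N$ or $M \twoheadrightarrow\twoheadrightarrow N$; (2) $M \Lleftarrow N$ if and only if either $M \rightsquigarrow N$ or $M \rightsquigarrow\rightsquigarrow\rightsquigarrow N$.
   Context: Setting: a reversible, asynchronous, multiparty session process calculus. Configurations contain running processes, monitors (local session type with a cursor marking the protocol state, and a tag that is either empty, or full when the participant is engaged in an ongoing decoupled backward step), and session queues with an input (consumed) part and an output (pending) part. The decoupled semantics has forward reduction $\twoheadrightarrow$ (where a send places a message in the output queue and a later, separate step by the receiver moves it to the input part; similarly for selection/branching) and backward reduction $\rightsquigarrow$ (where undoing a synchronization first sets the two involved monitors' tags to full, then separately undoes the input and the output, resetting tags to empty). The atomic semantics has forward steps $\Rrightarrow$ and backward steps $\Lleftarrow$ that perform/undo a whole synchronization at once; session initiation, $\beta$-reduction and spawn (and their undoing) are shared by both semantics. A configuration is stable if it has no ongoing step: all session output queues are empty and all monitors carry the empty tag.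
   Formalization: Intermediate configurations of the two-step (resp. three-step) decoupled sequences are required to be not stable, since two (three) independent β-steps refute the literal claim; sender and receiver of a synchronization are taken to be different participants. *)

(* Defs.v *)
From mathcomp Require Import all_boot.

Set Implicit Arguments.
Unset Strict Implicit.
Unset Printing Implicit Defensive.

(* The three disjoint sorts of symbols that processes can bind, each one
   countable: names (shared names, session names, locations and keys),
   variables, and recursion variables.  A symbol of a given kind is a number. *)
Inductive kind := KName | KVar | KRec.

Definition same_kind (k k' : kind) : bool :=
  match k, k' with
  | KName, KName | KVar, KVar | KRec, KRec => true
  | _, _ => false
  end.

Notation name := nat (only parsing).
Notation var := nat (only parsing).
Notation recvar := nat (only parsing).
Notation role := nat (only parsing).
Notation label := nat (only parsing).

Inductive usort :=
  | UBool
  | UNat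
  | UChan of gtype
  | UAbs of ltype
with ltype :=
  | TOut of role & usort & ltype
  | TIn of role & usort & ltype
  | TSel of role & seq (label * ltype)
  | TBra of role & seq (label * ltype)
  | TVar of recvar
  | TRec of recvar & ltype
  | TEnd
with gtype :=
  | GMsg of role & role & usort & gtype
  | GBra of role & role & seq (label * gtype)
  | GVar of recvar
  | GRec of recvar & gtype
  | GEnd.

(* Not capture-avoiding: it is only used to unfold closed types.  Payload types
   are closed, so they are left alone. *)
Fixpoint ltype_sub (X : recvar) (R T : ltype) : ltype :=
  match T with
  | TOut q U T' => TOut q U (ltype_sub X R T')
  | TIn q U T' => TIn q U (ltype_sub X R T')
  | TSel q Ts => TSel q [seq (b.1, ltype_sub X R b.2) | b <- Ts]
  | TBra q Ts => TBra q [seq (b.1, ltype_sub X R b.2) | b <- Ts]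
  | TVar Y => if Y == X then R else TVar Y
  | TRec Y T' => if Y == X then TRec Y T' else TRec Y (ltype_sub X R T')
  | TEnd => TEnd
  end.

Fixpoint roles (G : gtype) : seq role :=
  match G with
  | GMsg p q _ G' => p :: q :: roles G'
  | GBra p q Gs => p :: q :: flatten [seq roles b.2 | b <- Gs]
  | GVar _ | GEnd => [::]
  | GRec _ G' => roles G'
  end.

(* [proj G r T]: the projection of G onto r is defined and equal to T.  No
   projection exists for a self-communication, nor for a choice not involving r
   whose branches project differently onto r. *)
Inductive proj : gtype -> role -> ltype -> Prop :=
  | proj_snd p q U G T :
      p != q -> proj G p T -> proj (GMsg p q U G) p (TOut q U T)
  | proj_rcv p q U G T :
      p != q -> proj G q T -> proj (GMsg p q U G) q (TIn p U T)
  | proj_msg_other p q U G r T :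
      p != q -> r != p -> r != q -> proj G r T -> proj (GMsg p q U G) r T
  | proj_sel p q Gs Ts :
      p != q -> projs Gs p Ts -> proj (GBra p q Gs) p (TSel q Ts)
  | proj_bra p q Gs Ts :
      p != q -> projs Gs q Ts -> proj (GBra p q Gs) q (TBra p Ts)
  | proj_bra_other p q Gs r T :
      p != q -> r != p -> r != q -> Gs <> [::] ->
      projs Gs r [seq (b.1, T) | b <- Gs] -> proj (GBra p q Gs) r T
  | proj_rec X G r T :
      r \in roles G -> proj G r T -> proj (GRec X G) r (TRec X T)
  | proj_rec_end X G r : r \notin roles G -> proj (GRec X G) r TEnd
  | proj_var X r : proj (GVar X) r (TVar X)
  | proj_end r : proj GEnd r TEnd
with projs : seq (label * gtype) -> role -> seq (label * ltype) -> Prop :=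
  | projs_nil r : projs [::] r [::]
  | projs_cons l G Gs r T Ts :
      proj G r T -> projs Gs r Ts -> projs ((l, G) :: Gs) r ((l, T) :: Ts).

Inductive chan :=
  | CName of name
  | CEnd of name & role          (* the endpoint s[p] *)
  | CVar of var.

Inductive value :=
  | VChan of chan
  | VBool of bool
  | VNat of nat
  | VLam of var & proc
with proc :=
  | POut of chan & value & proc
  | PIn of chan & var & proc
  | PSel of chan & seq (label * proc)
  | PBra of chan & seq (label * proc)
  | PPar of proc & proc
  | PVar of recvar
  | PRec of recvar & proc
  | PApp of value & chan
  | PNew of name & proc
  | PNil.

Definition unbind (k k' : kind) (a : nat) (l : seq nat) : seq nat :=
  if same_kind k k' then filter (predC1 a) l else l.

Definition chan_fs (k : kind) (u : chan) : seq nat :=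
  match k, u with
  | KName, CName a => [:: a]
  | KName, CEnd s _ => [:: s]
  | KVar, CVar x => [:: x]
  | _, _ => [::]
  end.

Fixpoint value_fs (k : kind) (V : value) : seq nat :=
  match V with
  | VChan u => chan_fs k u
  | VBool _ | VNat _ => [::]
  | VLam x P => unbind k KVar x (proc_fs k P)
  end
with proc_fs (k : kind) (P : proc) : seq nat :=
  match P with
  | POut u V Q => chan_fs k u ++ value_fs k V ++ proc_fs k Q
  | PIn u x Q => chan_fs k u ++ unbind k KVar x (proc_fs k Q)
  | PSel u Qs | PBra u Qs =>
      chan_fs k u ++ flatten [seq proc_fs k b.2 | b <- Qs]
  | PPar Q1 Q2 => proc_fs k Q1 ++ proc_fs k Q2
  | PVar X => if same_kind k KRec then [:: X] else [::]
  | PRec X Q => unbind k KRec X (proc_fs k Q)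
  | PApp V u => value_fs k V ++ chan_fs k u
  | PNew n Q => unbind k KName n (proc_fs k Q)
  | PNil => [::]
  end.

Definition binder (k k' : kind) (a : nat) : seq nat :=
  if same_kind k k' then [:: a] else [::].

(* [value_bs k V], [proc_bs k P]: the symbols of kind k bound inside V, P. *)
Fixpoint value_bs (k : kind) (V : value) : seq nat :=
  match V with
  | VChan _ | VBool _ | VNat _ => [::]
  | VLam x P => binder k KVar x ++ proc_bs k P
  end
with proc_bs (k : kind) (P : proc) : seq nat :=
  match P with
  | POut u V Q => value_bs k V ++ proc_bs k Q
  | PIn u x Q => binder k KVar x ++ proc_bs k Q
  | PSel u Qs | PBra u Qs => flatten [seq proc_bs k b.2 | b <- Qs]
  | PPar Q1 Q2 => proc_bs k Q1 ++ proc_bs k Q2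
  | PVar X => [::]
  | PRec X Q => binder k KRec X ++ proc_bs k Q
  | PApp V u => value_bs k V
  | PNew n Q => binder k KName n ++ proc_bs k Q
  | PNil => [::]
  end.

(* Renamings act on all occurrences of a symbol, bound and binding ones
   included; they are used at transpositions only. *)
Definition renaming := kind -> nat -> nat.

Definition swap (k : kind) (a b : nat) : renaming := fun k' c =>
  if same_kind k k' then if c == a then b else if c == b then a else c else c.

Definition chan_ren (r : renaming) (u : chan) : chan :=
  match u with
  | CName a => CName (r KName a)
  | CEnd s p => CEnd (r KName s) p
  | CVar x => CVar (r KVar x)
  end.

Fixpoint value_ren (r : renaming) (V : value) : value :=
  match V with
  | VChan u => VChan (chan_ren r u)
  | VBool _ | VNat _ => V
  | VLam x P => VLam (r KVar x) (proc_ren r P)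
  end
with proc_ren (r : renaming) (P : proc) : proc :=
  match P with
  | POut u V Q => POut (chan_ren r u) (value_ren r V) (proc_ren r Q)
  | PIn u x Q => PIn (chan_ren r u) (r KVar x) (proc_ren r Q)
  | PSel u Qs => PSel (chan_ren r u) [seq (b.1, proc_ren r b.2) | b <- Qs]
  | PBra u Qs => PBra (chan_ren r u) [seq (b.1, proc_ren r b.2) | b <- Qs]
  | PPar Q1 Q2 => PPar (proc_ren r Q1) (proc_ren r Q2)
  | PVar X => PVar (r KRec X)
  | PRec X Q => PRec (r KRec X) (proc_ren r Q)
  | PApp V u => PApp (value_ren r V) (chan_ren r u)
  | PNew n Q => PNew (r KName n) (proc_ren r Q)
  | PNil => PNil
  end.

(* Substitutions of values for variables; these are also the stores kept by
   monitors.  The first binding of a variable is the one that counts. *)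
Definition store := seq (var * value).

Fixpoint lookup (sg : store) (x : var) : option value :=
  match sg with
  | [::] => None
  | (y, V) :: sg' => if x == y then Some V else lookup sg' x
  end.

Definition dom (sg : store) : seq var := [seq b.1 | b <- sg].

Definition drop_var (x : var) (sg : store) : store :=
  [seq b <- sg | b.1 != x].

Definition store_fs (k : kind) (sg : store) : seq nat :=
  flatten [seq value_fs k b.2 | b <- sg].

(* Only a channel can replace a variable in channel position. *)
Definition chan_sub (sg : store) (u : chan) : chan :=
  match u with
  | CVar x => if lookup sg x is Some (VChan c) then c else u
  | _ => u
  end.

(* [value_sub], [proc_sub] do not rename binders: they are the usual
   substitutions only under the side conditions [value_ok], [proc_ok] below,
   which can always be met by alpha-conversion. *)
Fixpoint value_sub (sg : store) (V : value) : value :=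
  match V with
  | VChan (CVar x) => if lookup sg x is Some W then W else V
  | VChan _ | VBool _ | VNat _ => V
  | VLam x P => VLam x (proc_sub (drop_var x sg) P)
  end
with proc_sub (sg : store) (P : proc) : proc :=
  match P with
  | POut u V Q => POut (chan_sub sg u) (value_sub sg V) (proc_sub sg Q)
  | PIn u x Q => PIn (chan_sub sg u) x (proc_sub (drop_var x sg) Q)
  | PSel u Qs => PSel (chan_sub sg u) [seq (b.1, proc_sub sg b.2) | b <- Qs]
  | PBra u Qs => PBra (chan_sub sg u) [seq (b.1, proc_sub sg b.2) | b <- Qs]
  | PPar Q1 Q2 => PPar (proc_sub sg Q1) (proc_sub sg Q2)
  | PVar X => PVar X
  | PRec X Q => PRec X (proc_sub sg Q)
  | PApp V u => PApp (value_sub sg V) (chan_sub sg u)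
  | PNew n Q => PNew n (proc_sub sg Q)
  | PNil => PNil
  end.

Definition apart (l1 l2 : seq nat) : bool := ~~ has [in l1] l2.

Definition value_ok (sg : store) (V : value) : Prop :=
  forall k, apart (value_bs k V) (store_fs k sg).

Definition proc_ok (sg : store) (P : proc) : Prop :=
  forall k, apart (proc_bs k P) (store_fs k sg).

Fixpoint value_unfold (X : recvar) (R : proc) (V : value) : value :=
  match V with
  | VLam x P => VLam x (proc_unfold X R P)
  | _ => V
  end
with proc_unfold (X : recvar) (R : proc) (P : proc) : proc :=
  match P with
  | POut u V Q => POut u (value_unfold X R V) (proc_unfold X R Q)
  | PIn u x Q => PIn u x (proc_unfold X R Q)
  | PSel u Qs => PSel u [seq (b.1, proc_unfold X R b.2) | b <- Qs]
  | PBra u Qs => PBra u [seq (b.1, proc_unfold X R b.2) | b <- Qs]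
  | PPar Q1 Q2 => PPar (proc_unfold X R Q1) (proc_unfold X R Q2)
  | PVar Y => if Y == X then R else PVar Y
  | PRec Y Q => if Y == X then PRec Y Q else PRec Y (proc_unfold X R Q)
  | PApp V u => PApp (value_unfold X R V) u
  | PNew n Q => PNew n (proc_unfold X R Q)
  | PNil => PNil
  end.

(* Structural congruence on values and processes.  Alpha-conversion is
   expressed by transposing the bound symbol with a fresh one. *)
Inductive vcong : value -> value -> Prop :=
  | vc_refl V : vcong V V
  | vc_sym V W : vcong V W -> vcong W V
  | vc_trans V1 V2 V3 : vcong V1 V2 -> vcong V2 V3 -> vcong V1 V3
  | vc_lam x P P' : pcong P P' -> vcong (VLam x P) (VLam x P')
  | vc_alpha x y P :
      y \notin proc_fs KVar P ->
      vcong (VLam x P) (VLam y (proc_ren (swap KVar x y) P))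
with pcong : proc -> proc -> Prop :=
  | pc_refl P : pcong P P
  | pc_sym P Q : pcong P Q -> pcong Q P
  | pc_trans P1 P2 P3 : pcong P1 P2 -> pcong P2 P3 -> pcong P1 P3
  | pc_out u V V' P P' :
      vcong V V' -> pcong P P' -> pcong (POut u V P) (POut u V' P')
  | pc_in u x P P' : pcong P P' -> pcong (PIn u x P) (PIn u x P')
  | pc_sel u Ps Ps' : bcong Ps Ps' -> pcong (PSel u Ps) (PSel u Ps')
  | pc_bra u Ps Ps' : bcong Ps Ps' -> pcong (PBra u Ps) (PBra u Ps')
  | pc_par P P' Q Q' :
      pcong P P' -> pcong Q Q' -> pcong (PPar P Q) (PPar P' Q')
  | pc_rec X P P' : pcong P P' -> pcong (PRec X P) (PRec X P')
  | pc_app V V' u : vcong V V' -> pcong (PApp V u) (PApp V' u)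
  | pc_new n P P' : pcong P P' -> pcong (PNew n P) (PNew n P')
  | pc_par0 P : pcong (PPar P PNil) P
  | pc_parC P Q : pcong (PPar P Q) (PPar Q P)
  | pc_parA P Q R : pcong (PPar P (PPar Q R)) (PPar (PPar P Q) R)
  | pc_new0 n : pcong (PNew n PNil) PNil
  | pc_newC n m P : pcong (PNew n (PNew m P)) (PNew m (PNew n P))
  | pc_new_par n P Q :
      n \notin proc_fs KName P ->
      pcong (PPar P (PNew n Q)) (PNew n (PPar P Q))
  | pc_unfold X P :
      (forall k, apart (proc_bs k P) (proc_fs k (PRec X P))) ->
      pcong (PRec X P) (proc_unfold X (PRec X P) P)
  | pc_alpha_in u x y P :
      y \notin proc_fs KVar P ->
      pcong (PIn u x P) (PIn u y (proc_ren (swap KVar x y) P))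
  | pc_alpha_rec X Y P :
      Y \notin proc_fs KRec P ->
      pcong (PRec X P) (PRec Y (proc_ren (swap KRec X Y) P))
  | pc_alpha_new n m P :
      m \notin proc_fs KName P ->
      pcong (PNew n P) (PNew m (proc_ren (swap KName n m) P))
with bcong : seq (label * proc) -> seq (label * proc) -> Prop :=
  | bc_nil : bcong [::] [::]
  | bc_cons l P P' Ps Ps' :
      pcong P P' -> bcong Ps Ps' -> bcong ((l, P) :: Ps) ((l, P') :: Ps').

(* What the cursor of a monitor has moved past.  A local type with a cursor,
   T[^S], is the list of the events of the context T, the most recent one
   first, together with S.  For choices, the alternatives that were not taken
   are kept in two lists, those before and those after the one taken. *)
Inductive event :=
  | EOut of role & usort
  | EIn of role & usort
  | ESel of role & label & seq (label * ltype) & seq (label * ltype)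
  | EBra of role & label & seq (label * ltype) & seq (label * ltype)
  | EKey of name
  | ESpawn of name & name & name.

(* Discarded process branches, again those before and those after the one
   taken. *)
Inductive frame :=
  | FSel of chan & seq (label * proc) & seq (label * proc)
  | FBra of chan & seq (label * proc) & seq (label * proc).

Inductive payload :=
  | MVal of value
  | MLab of label.

(* (sender, receiver, payload) *)
Definition message := (role * role * payload)%type.

Inductive tag := Empty | Full.

Inductive config :=
  | CNil
  | CPar of config & config
  | CNew of name & config
  | CReq of name & name & var & ltype & proc  (* l{a!<x:T>.P} *)
  | CAcc of name & name & var & ltype & proc  (* l{a?(x:T).P} *)
  | CRun of name & role & seq frame & proc    (* l[p] : <<C ; P>> *)
  | CMon of name & role & seq event & ltype & seq var & store & tag
                                              (* s_p | T[^S] . xs . sg |^tag *)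
  | CQueue of name & seq message & seq message
                        (* s : (input * output), oldest messages first *)
  | CMem of name & value & chan & name.       (* k |_ (V u), l _| *)

Definition event_fn (e : event) : seq name :=
  match e with
  | EKey k => [:: k]
  | ESpawn l l1 l2 => [:: l; l1; l2]
  | _ => [::]
  end.

Definition frame_fn (f : frame) : seq name :=
  match f with
  | FSel u Ps Qs => proc_fs KName (PSel u (Ps ++ Qs))
  | FBra u Ps Qs => proc_fs KName (PBra u (Ps ++ Qs))
  end.

Definition stack_fn (C : seq frame) : seq name := flatten (map frame_fn C).

Definition message_fn (m : message) : seq name :=
  if m.2 is MVal V then value_fs KName V else [::].

Fixpoint config_fn (M : config) : seq name :=
  match M with
  | CNil => [::]
  | CPar M1 M2 => config_fn M1 ++ config_fn M2
  | CNew n M1 => filter (predC1 n) (config_fn M1)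
  | CReq l a _ _ P | CAcc l a _ _ P => l :: a :: proc_fs KName P
  | CRun l _ C P => l :: stack_fn C ++ proc_fs KName P
  | CMon s _ h _ _ sg _ => s :: flatten (map event_fn h) ++ store_fs KName sg
  | CQueue s hi ho => s :: flatten (map message_fn (hi ++ ho))
  | CMem k V u l => k :: l :: value_fs KName V ++ chan_fs KName u
  end.

Definition event_ren (r : renaming) (e : event) : event :=
  match e with
  | EKey k => EKey (r KName k)
  | ESpawn l l1 l2 => ESpawn (r KName l) (r KName l1) (r KName l2)
  | _ => e
  end.

Definition branches_ren (r : renaming) (Ps : seq (label * proc)) :=
  [seq (b.1, proc_ren r b.2) | b <- Ps].

Definition frame_ren (r : renaming) (f : frame) : frame :=
  match f with
  | FSel u Ps Qs => FSel (chan_ren r u) (branches_ren r Ps) (branches_ren r Qs)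
  | FBra u Ps Qs => FBra (chan_ren r u) (branches_ren r Ps) (branches_ren r Qs)
  end.

Definition message_ren (r : renaming) (m : message) : message :=
  (m.1, if m.2 is MVal V then MVal (value_ren r V) else m.2).

Definition store_ren (r : renaming) (sg : store) : store :=
  [seq (r KVar b.1, value_ren r b.2) | b <- sg].

Fixpoint config_ren (r : renaming) (M : config) : config :=
  match M with
  | CNil => CNil
  | CPar M1 M2 => CPar (config_ren r M1) (config_ren r M2)
  | CNew n M1 => CNew (r KName n) (config_ren r M1)
  | CReq l a x T P =>
      CReq (r KName l) (r KName a) (r KVar x) T (proc_ren r P)
  | CAcc l a x T P =>
      CAcc (r KName l) (r KName a) (r KVar x) T (proc_ren r P)
  | CRun l p C P => CRun (r KName l) p (map (frame_ren r) C) (proc_ren r P)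
  | CMon s p h T xs sg t =>
      CMon (r KName s) p (map (event_ren r) h) T (map (r KVar) xs)
        (store_ren r sg) t
  | CQueue s hi ho =>
      CQueue (r KName s) (map (message_ren r) hi) (map (message_ren r) ho)
  | CMem k V u l =>
      CMem (r KName k) (value_ren r V) (chan_ren r u) (r KName l)
  end.

Inductive frame_cong : frame -> frame -> Prop :=
  | fc_sel u Ps Ps' Qs Qs' :
      bcong Ps Ps' -> bcong Qs Qs' -> frame_cong (FSel u Ps Qs) (FSel u Ps' Qs')
  | fc_bra u Ps Ps' Qs Qs' :
      bcong Ps Ps' -> bcong Qs Qs' -> frame_cong (FBra u Ps Qs) (FBra u Ps' Qs').

Inductive stack_cong : seq frame -> seq frame -> Prop :=
  | sc_nil : stack_cong [::] [::]
  | sc_cons f f' C C' :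
      frame_cong f f' -> stack_cong C C' -> stack_cong (f :: C) (f' :: C').

Inductive store_cong : store -> store -> Prop :=
  | stc_nil : store_cong [::] [::]
  | stc_cons x V V' sg sg' :
      vcong V V' -> store_cong sg sg' ->
      store_cong ((x, V) :: sg) ((x, V') :: sg').

(* Messages with different senders or different receivers commute. *)
Inductive queue_cong : seq message -> seq message -> Prop :=
  | qc_nil : queue_cong [::] [::]
  | qc_trans h1 h2 h3 :
      queue_cong h1 h2 -> queue_cong h2 h3 -> queue_cong h1 h3
  | qc_lab p q l h h' :
      queue_cong h h' ->
      queue_cong ((p, q, MLab l) :: h) ((p, q, MLab l) :: h')
  | qc_val p q V V' h h' :
      vcong V V' -> queue_cong h h' ->
      queue_cong ((p, q, MVal V) :: h) ((p, q, MVal V') :: h')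
  | qc_swap p1 q1 m1 p2 q2 m2 h :
      (p1 != p2) || (q1 != q2) ->
      queue_cong ((p1, q1, m1) :: (p2, q2, m2) :: h)
                 ((p2, q2, m2) :: (p1, q1, m1) :: h).

Inductive cong : config -> config -> Prop :=
  | c_refl M : cong M M
  | c_sym M N : cong M N -> cong N M
  | c_trans M1 M2 M3 : cong M1 M2 -> cong M2 M3 -> cong M1 M3
  | c_par M M' N N' : cong M M' -> cong N N' -> cong (CPar M N) (CPar M' N')
  | c_new n M M' : cong M M' -> cong (CNew n M) (CNew n M')
  | c_par0 M : cong (CPar M CNil) M
  | c_parC M N : cong (CPar M N) (CPar N M)
  | c_parA M N K : cong (CPar M (CPar N K)) (CPar (CPar M N) K)
  | c_new0 n : cong (CNew n CNil) CNil
  | c_newC n m M : cong (CNew n (CNew m M)) (CNew m (CNew n M))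
  | c_new_par n M N :
      n \notin config_fn M -> cong (CPar M (CNew n N)) (CNew n (CPar M N))
  | c_alpha n m M :
      m \notin config_fn M ->
      cong (CNew n M) (CNew m (config_ren (swap KName n m) M))
  | c_run_new l p C n P :
      n != l -> n \notin stack_fn C ->
      cong (CRun l p C (PNew n P)) (CNew n (CRun l p C P))
  | c_req l a x T P P' : pcong P P' -> cong (CReq l a x T P) (CReq l a x T P')
  | c_req_alpha l a x y T P :
      y \notin proc_fs KVar P ->
      cong (CReq l a x T P) (CReq l a y T (proc_ren (swap KVar x y) P))
  | c_acc l a x T P P' : pcong P P' -> cong (CAcc l a x T P) (CAcc l a x T P')
  | c_acc_alpha l a x y T P :
      y \notin proc_fs KVar P ->
      cong (CAcc l a x T P) (CAcc l a y T (proc_ren (swap KVar x y) P))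
  | c_run l p C C' P P' :
      stack_cong C C' -> pcong P P' -> cong (CRun l p C P) (CRun l p C' P')
  | c_mon s p h T xs sg sg' t :
      store_cong sg sg' ->
      cong (CMon s p h T xs sg t) (CMon s p h T xs sg' t)
  | c_mon_unfold s p h X T xs sg t :
      cong (CMon s p h (TRec X T) xs sg t)
           (CMon s p h (ltype_sub X (TRec X T) T) xs sg t)
  | c_queue s hi hi' ho ho' :
      queue_cong hi hi' -> queue_cong ho ho' ->
      cong (CQueue s hi ho) (CQueue s hi' ho')
  | c_mem k V V' u l : vcong V V' -> cong (CMem k V u l) (CMem k V' u l).

Fixpoint stable (M : config) : Prop :=
  match M with
  | CPar M1 M2 => stable M1 /\ stable M2
  | CNew _ M1 => stable M1
  | CMon _ _ _ _ _ _ t => t = Empty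
  | CQueue _ _ ho => ho = [::]
  | _ => True
  end.

Definition pars (Ms : seq config) : config := foldr CPar CNil Ms.

Record seat := Seat {
  seat_loc : name; seat_role : role; seat_var : var;
  seat_type : ltype; seat_body : proc }.

Definition seat_sub (s : name) (e : seat) : store :=
  [:: (seat_var e, VChan (CEnd s (seat_role e)))].

Definition request (a : name) (e : seat) : config :=
  CReq (seat_loc e) a (seat_var e) (seat_type e) (seat_body e).

Definition accept (a : name) (e : seat) : config :=
  CAcc (seat_loc e) a (seat_var e) (seat_type e) (seat_body e).

Definition seated (s a : name) (e : seat) : config :=
  CPar (CRun (seat_loc e) (seat_role e) [::]
             (proc_sub (seat_sub s e) (seat_body e)))
       (CMon s (seat_role e) [::] (seat_type e) [:: seat_var e]
             [:: (seat_var e, VChan (CName a))] Empty).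

(* A session is opened by one request and by accepts, one for each
   role of a global type G, the annotations being the projections of G. *)
Inductive init : config -> config -> Prop :=
  | Init s a e es G :
      uniq [seq seat_role d | d <- e :: es] ->
      [seq seat_role d | d <- e :: es] =i roles G ->
      (forall i, i < size (e :: es) ->
         proj G (seat_role (nth e (e :: es) i)) (seat_type (nth e (e :: es) i))) ->
      (forall i, i < size (e :: es) ->
         proc_ok (seat_sub s (nth e (e :: es) i))
                 (seat_body (nth e (e :: es) i))) ->
      s \notin config_fn (pars (request a e :: map (accept a) es)) ->
      init (pars (request a e :: map (accept a) es))
           (CNew s (CPar (pars (map (seated s a) (e :: es)))
                         (CQueue s [::] [::]))).

Inductive fwd_shared : config -> config -> Prop :=
  | FInit M N : init M N -> fwd_shared M N
  | FBeta k l p C V u s h T xs sg x P :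
      value_ok sg V -> value_sub sg V = VLam x P ->
      proc_ok [:: (x, value_sub sg (VChan u))] P ->
      k \notin config_fn (CPar (CRun l p C (PApp V u))
                               (CMon s p h T xs sg Empty)) ->
      fwd_shared
        (CPar (CRun l p C (PApp V u)) (CMon s p h T xs sg Empty))
        (CNew k (pars [:: CRun l p C
                            (proc_sub [:: (x, value_sub sg (VChan u))] P);
                          CMon s p (EKey k :: h) T xs sg Empty;
                          CMem k V u l]))
  | FSpawn l l1 l2 p C P Q s h T xs sg :
      l1 != l2 ->
      l1 \notin config_fn (CPar (CRun l p C (PPar P Q))
                                (CMon s p h T xs sg Empty)) ->
      l2 \notin config_fn (CPar (CRun l p C (PPar P Q))
                                (CMon s p h T xs sg Empty)) ->
      fwd_shared
        (CPar (CRun l p C (PPar P Q)) (CMon s p h T xs sg Empty))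
        (CNew l1 (CNew l2
          (pars [:: CRun l p C PNil; CRun l1 p [::] P; CRun l2 p [::] Q;
                    CMon s p (ESpawn l l1 l2 :: h) T xs sg Empty]))).

Inductive bwd_shared : config -> config -> Prop :=
  | BInit M N : init N M -> bwd_shared M N
  | BBeta k l p C V u s h T xs sg P :
      k \notin config_fn (CPar (CRun l p C (PApp V u))
                               (CMon s p h T xs sg Empty)) ->
      bwd_shared
        (CNew k (pars [:: CRun l p C P;
                          CMon s p (EKey k :: h) T xs sg Empty;
                          CMem k V u l]))
        (CPar (CRun l p C (PApp V u)) (CMon s p h T xs sg Empty))
  | BSpawn l l1 l2 p C P Q s h T xs sg :
      l1 != l2 ->
      l1 \notin config_fn (CPar (CRun l p C (PPar P Q))
                                (CMon s p h T xs sg Empty)) ->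
      l2 \notin config_fn (CPar (CRun l p C (PPar P Q))
                                (CMon s p h T xs sg Empty)) ->
      bwd_shared
        (CNew l1 (CNew l2
          (pars [:: CRun l p C PNil; CRun l1 p [::] P; CRun l2 p [::] Q;
                    CMon s p (ESpawn l l1 l2 :: h) T xs sg Empty])))
        (CPar (CRun l p C (PPar P Q)) (CMon s p h T xs sg Empty)).

(* In all synchronizations the two roles differ: global types contain no
   self-communication.  The payload types of the two monitors are not compared,
   as this is the business of typing. *)

Inductive fwd_half : config -> config -> Prop :=
  | FOut l p C V P s q U h T xs sg hi ho :
      p != q -> value_ok sg V ->
      fwd_half
        (pars [:: CRun l p C (POut (CEnd s p) V P);
                  CMon s p h (TOut q U T) xs sg Empty;
                  CQueue s hi ho])
        (pars [:: CRun l p C P;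
                  CMon s p (EOut q U :: h) T xs sg Empty;
                  CQueue s hi (rcons ho (p, q, MVal (value_sub sg V)))])
  | FIn l q C y Q s p U h T xs sg V hi ho :
      p != q -> y \notin xs -> y \notin dom sg ->
      fwd_half
        (pars [:: CRun l q C (PIn (CEnd s q) y Q);
                  CMon s q h (TIn p U T) xs sg Empty;
                  CQueue s hi ((p, q, MVal V) :: ho)])
        (pars [:: CRun l q C Q;
                  CMon s q (EIn p U :: h) T (y :: xs) ((y, V) :: sg) Empty;
                  CQueue s (rcons hi (p, q, MVal V)) ho])
  | FSelect l p C w Ps P Ps' s q Ts T Ts' h xs sg hi ho :
      p != q ->
      fwd_half
        (pars [:: CRun l p C (PSel (CEnd s p) (Ps ++ (w, P) :: Ps'));
                  CMon s p h (TSel q (Ts ++ (w, T) :: Ts')) xs sg Empty;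
                  CQueue s hi ho])
        (pars [:: CRun l p (FSel (CEnd s p) Ps Ps' :: C) P;
                  CMon s p (ESel q w Ts Ts' :: h) T xs sg Empty;
                  CQueue s hi (rcons ho (p, q, MLab w))])
  | FBranch l q C w Ps P Ps' s p Ts T Ts' h xs sg hi ho :
      p != q ->
      fwd_half
        (pars [:: CRun l q C (PBra (CEnd s q) (Ps ++ (w, P) :: Ps'));
                  CMon s q h (TBra p (Ts ++ (w, T) :: Ts')) xs sg Empty;
                  CQueue s hi ((p, q, MLab w) :: ho)])
        (pars [:: CRun l q (FBra (CEnd s q) Ps Ps' :: C) P;
                  CMon s q (EBra p w Ts Ts' :: h) T xs sg Empty;
                  CQueue s (rcons hi (p, q, MLab w)) ho]).

(* The first two rules start the undoing of the synchronization recorded by the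
   last consumed message; the others carry it out on one side.  An undone output
   carries the value found in the queue. *)
Inductive bwd_half : config -> config -> Prop :=
  | BRollVal s p q U1 U2 h1 T1 xs1 sg1 h2 T2 xs2 sg2 V hi ho :
      p != q ->
      bwd_half
        (pars [:: CMon s p (EOut q U1 :: h1) T1 xs1 sg1 Empty;
                  CMon s q (EIn p U2 :: h2) T2 xs2 sg2 Empty;
                  CQueue s (rcons hi (p, q, MVal V)) ho])
        (pars [:: CMon s p (EOut q U1 :: h1) T1 xs1 sg1 Full;
                  CMon s q (EIn p U2 :: h2) T2 xs2 sg2 Full;
                  CQueue s (rcons hi (p, q, MVal V)) ho])
  | BRollLab s p q w Ts1 Ts1' Ts2 Ts2' h1 T1 xs1 sg1 h2 T2 xs2 sg2 hi ho :
      p != q ->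
      bwd_half
        (pars [:: CMon s p (ESel q w Ts1 Ts1' :: h1) T1 xs1 sg1 Empty;
                  CMon s q (EBra p w Ts2 Ts2' :: h2) T2 xs2 sg2 Empty;
                  CQueue s (rcons hi (p, q, MLab w)) ho])
        (pars [:: CMon s p (ESel q w Ts1 Ts1' :: h1) T1 xs1 sg1 Full;
                  CMon s q (EBra p w Ts2 Ts2' :: h2) T2 xs2 sg2 Full;
                  CQueue s (rcons hi (p, q, MLab w)) ho])
  | BIn l q C y Q s p U h T xs sg V hi ho :
      p != q ->
      bwd_half
        (pars [:: CRun l q C Q;
                  CMon s q (EIn p U :: h) T (y :: xs) ((y, V) :: sg) Full;
                  CQueue s (rcons hi (p, q, MVal V)) ho])
        (pars [:: CRun l q C (PIn (CEnd s q) y Q);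
                  CMon s q h (TIn p U T) xs sg Empty;
                  CQueue s hi ((p, q, MVal V) :: ho)])
  | BOut l p C V P s q U h T xs sg hi ho :
      p != q ->
      bwd_half
        (pars [:: CRun l p C P;
                  CMon s p (EOut q U :: h) T xs sg Full;
                  CQueue s hi (rcons ho (p, q, MVal V))])
        (pars [:: CRun l p C (POut (CEnd s p) V P);
                  CMon s p h (TOut q U T) xs sg Empty;
                  CQueue s hi ho])
  | BBranch l q C w Ps P Ps' s p Ts T Ts' h xs sg hi ho :
      p != q ->
      bwd_half
        (pars [:: CRun l q (FBra (CEnd s q) Ps Ps' :: C) P;
                  CMon s q (EBra p w Ts Ts' :: h) T xs sg Full;
                  CQueue s (rcons hi (p, q, MLab w)) ho])
        (pars [:: CRun l q C (PBra (CEnd s q) (Ps ++ (w, P) :: Ps'));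
                  CMon s q h (TBra p (Ts ++ (w, T) :: Ts')) xs sg Empty;
                  CQueue s hi ((p, q, MLab w) :: ho)])
  | BSelect l p C w Ps P Ps' s q Ts T Ts' h xs sg hi ho :
      p != q ->
      bwd_half
        (pars [:: CRun l p (FSel (CEnd s p) Ps Ps' :: C) P;
                  CMon s p (ESel q w Ts Ts' :: h) T xs sg Full;
                  CQueue s hi (rcons ho (p, q, MLab w))])
        (pars [:: CRun l p C (PSel (CEnd s p) (Ps ++ (w, P) :: Ps'));
                  CMon s p h (TSel q (Ts ++ (w, T) :: Ts')) xs sg Empty;
                  CQueue s hi ho]).

Inductive fwd_sync : config -> config -> Prop :=
  | FComm l1 p C1 V P l2 q C2 y Q s U1 U2
          h1 T1 xs1 sg1 h2 T2 xs2 sg2 hi :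
      p != q -> value_ok sg1 V -> y \notin xs2 -> y \notin dom sg2 ->
      fwd_sync
        (pars [:: CRun l1 p C1 (POut (CEnd s p) V P);
                  CMon s p h1 (TOut q U1 T1) xs1 sg1 Empty;
                  CRun l2 q C2 (PIn (CEnd s q) y Q);
                  CMon s q h2 (TIn p U2 T2) xs2 sg2 Empty;
                  CQueue s hi [::]])
        (pars [:: CRun l1 p C1 P;
                  CMon s p (EOut q U1 :: h1) T1 xs1 sg1 Empty;
                  CRun l2 q C2 Q;
                  CMon s q (EIn p U2 :: h2) T2 (y :: xs2)
                       ((y, value_sub sg1 V) :: sg2) Empty;
                  CQueue s (rcons hi (p, q, MVal (value_sub sg1 V))) [::]])
  | FChoice l1 p C1 Ps P Ps' l2 q C2 Qs Q Qs' s w Ts1 T1 Ts1' Ts2 T2 Ts2'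
            h1 xs1 sg1 h2 xs2 sg2 hi :
      p != q ->
      fwd_sync
        (pars [:: CRun l1 p C1 (PSel (CEnd s p) (Ps ++ (w, P) :: Ps'));
                  CMon s p h1 (TSel q (Ts1 ++ (w, T1) :: Ts1')) xs1 sg1 Empty;
                  CRun l2 q C2 (PBra (CEnd s q) (Qs ++ (w, Q) :: Qs'));
                  CMon s q h2 (TBra p (Ts2 ++ (w, T2) :: Ts2')) xs2 sg2 Empty;
                  CQueue s hi [::]])
        (pars [:: CRun l1 p (FSel (CEnd s p) Ps Ps' :: C1) P;
                  CMon s p (ESel q w Ts1 Ts1' :: h1) T1 xs1 sg1 Empty;
                  CRun l2 q (FBra (CEnd s q) Qs Qs' :: C2) Q;
                  CMon s q (EBra p w Ts2 Ts2' :: h2) T2 xs2 sg2 Empty;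
                  CQueue s (rcons hi (p, q, MLab w)) [::]]).

Inductive bwd_sync : config -> config -> Prop :=
  | BComm l1 p C1 V P l2 q C2 y Q s U1 U2
          h1 T1 xs1 sg1 h2 T2 xs2 sg2 hi :
      p != q ->
      bwd_sync
        (pars [:: CRun l1 p C1 P;
                  CMon s p (EOut q U1 :: h1) T1 xs1 sg1 Empty;
                  CRun l2 q C2 Q;
                  CMon s q (EIn p U2 :: h2) T2 (y :: xs2) ((y, V) :: sg2) Empty;
                  CQueue s (rcons hi (p, q, MVal V)) [::]])
        (pars [:: CRun l1 p C1 (POut (CEnd s p) V P);
                  CMon s p h1 (TOut q U1 T1) xs1 sg1 Empty;
                  CRun l2 q C2 (PIn (CEnd s q) y Q);
                  CMon s q h2 (TIn p U2 T2) xs2 sg2 Empty;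
                  CQueue s hi [::]])
  | BChoice l1 p C1 Ps P Ps' l2 q C2 Qs Q Qs' s w Ts1 T1 Ts1' Ts2 T2 Ts2'
            h1 xs1 sg1 h2 xs2 sg2 hi :
      p != q ->
      bwd_sync
        (pars [:: CRun l1 p (FSel (CEnd s p) Ps Ps' :: C1) P;
                  CMon s p (ESel q w Ts1 Ts1' :: h1) T1 xs1 sg1 Empty;
                  CRun l2 q (FBra (CEnd s q) Qs Qs' :: C2) Q;
                  CMon s q (EBra p w Ts2 Ts2' :: h2) T2 xs2 sg2 Empty;
                  CQueue s (rcons hi (p, q, MLab w)) [::]])
        (pars [:: CRun l1 p C1 (PSel (CEnd s p) (Ps ++ (w, P) :: Ps'));
                  CMon s p h1 (TSel q (Ts1 ++ (w, T1) :: Ts1')) xs1 sg1 Empty;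
                  CRun l2 q C2 (PBra (CEnd s q) (Qs ++ (w, Q) :: Qs'));
                  CMon s q h2 (TBra p (Ts2 ++ (w, T2) :: Ts2')) xs2 sg2 Empty;
                  CQueue s hi [::]]).

Inductive reduces (rule : config -> config -> Prop) : config -> config -> Prop :=
  | red_rule M N : rule M N -> reduces rule M N
  | red_par M N K : reduces rule M N -> reduces rule (CPar M K) (CPar N K)
  | red_new n M N : reduces rule M N -> reduces rule (CNew n M) (CNew n N)
  | red_cong M M' N' N :
      cong M M' -> reduces rule M' N' -> cong N' N -> reduces rule M N.

Definition decoupled_fwd : config -> config -> Prop :=
  reduces (fun M N => fwd_shared M N \/ fwd_half M N).

Definition decoupled_bwd : config -> config -> Prop :=
  reduces (fun M N => bwd_shared M N \/ bwd_half M N).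

Definition atomic_fwd : config -> config -> Prop :=
  reduces (fun M N => fwd_shared M N \/ fwd_sync M N).

Definition atomic_bwd : config -> config -> Prop :=
  reduces (fun M N => bwd_shared M N \/ bwd_sync M N).

(* Main.v *)
(* Reducing a stable configuration to a stable one, the numbers of pending
   messages and of full tags only leave room for the shared rules, or for an
   output followed by an input (forwards), or for a start of undoing, an undone
   input and an undone output (backwards).  Resetting all tags commutes with
   structural congruence and cancels the start of undoing.  What remains are two
   half steps around a configuration K with a single pending message, one of the
   sender and one of the receiver of that message.

   Structural congruence may shuffle K arbitrarily between them.  But K has a
   normal form, invariant under congruence: a list of restrictions over a list of
   atoms.  The redexes of the two half steps are sublists of it; they share only
   the queue, as it alone has a pending message and as sender and receiver have
   different roles.  So both half steps take place in a common context, where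
   they make up one synchronization. *)
Require Import Defs.
From mathcomp Require Import all_boot.
From mathcomp Require Import zify.
From Stdlib Require Import FunctionalExtensionality.

Set Implicit Arguments.
Unset Strict Implicit.
Unset Printing Implicit Defensive.

(** A reduction may use [cong] at every level, and a congruence may pass through arbitrary
    intermediate configurations, so no redex can be located by inverting the derivation of a
    reduction. This is what the normal form is for.

    [NF] is a relation and not a function, because the name of each restriction is an arbitrary
    fresh choice. Invariance ([nf_cong]) states that congruent configurations have the same normal
    forms, so one normal form of K, chosen once, serves for both half steps.

    Much of the work is about names. Transpositions act on bound names too, so two renamings that
    agree on the free names give results that are only congruent. The normal form absorbs this
    discrepancy: [nf_alpha] allows one renaming on the configuration and another on its normal form,
    as long as they agree on the free names. *)

(** * Induction on values and processes *)

Fixpoint all_prop T (A : T -> Prop) (s : seq T) : Prop :=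
  if s is x :: s' then A x /\ all_prop A s' else True.

(** Proved by hand, since the processes nested in lists of branches need induction hypotheses as
    well. One recursion on processes suffices: a value contains at most one process, under [VLam],
    and that process is a subterm. *)
Lemma value_proc_ind (Pv : value -> Prop) (Pp : proc -> Prop) :
  (forall u, Pv (VChan u)) -> (forall b, Pv (VBool b)) ->
  (forall n, Pv (VNat n)) -> (forall x P, Pp P -> Pv (VLam x P)) ->
  (forall u V Q, Pv V -> Pp Q -> Pp (POut u V Q)) ->
  (forall u x Q, Pp Q -> Pp (PIn u x Q)) ->
  (forall u Qs, all_prop (fun b => Pp b.2) Qs -> Pp (PSel u Qs)) ->
  (forall u Qs, all_prop (fun b => Pp b.2) Qs -> Pp (PBra u Qs)) ->
  (forall P Q, Pp P -> Pp Q -> Pp (PPar P Q)) ->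
  (forall X, Pp (PVar X)) -> (forall X P, Pp P -> Pp (PRec X P)) ->
  (forall V u, Pv V -> Pp (PApp V u)) ->
  (forall n P, Pp P -> Pp (PNew n P)) -> Pp PNil ->
  (forall V, Pv V) /\ (forall P, Pp P).
Proof.
move=> H1 H2 H3 H4 H5 H6 H7 H8 H9 H10 H11 H12 H13 H14.
have fp : forall P, Pp P.
  fix fp 1 => -[u V Q|u x Q|u Qs|u Qs|P Q|X|X P|V u|n P|].
  - by apply: H5 (fp Q); case: V => [u'|b|n|x P]; [apply: H1|apply: H2|apply: H3|apply: H4].
  - exact: H6.
  - by apply: H7; elim: Qs => [|[w Q] Qs IH] //=; split.
  - by apply: H8; elim: Qs => [|[w Q] Qs IH] //=; split.
  - exact: H9.
  - exact: H10.
  - exact: H11.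
  - by apply: H12; case: V => [u'|b|m|x P]; [apply: H1|apply: H2|apply: H3|apply: H4].
  - exact: H13.
  - exact: H14.
split=> // -[u|b|n|x P]; [exact: H1|exact: H2|exact: H3|exact: H4].
Qed.

Lemma eq_map_all_prop T S (f g : T -> S) s :
  all_prop (fun x => f x = g x) s -> map f s = map g s.
Proof. by elim: s => //= x s IH [-> /IH->]. Qed.

Lemma all_prop_imp T (A B : T -> Prop) s :
  (forall x, A x -> B x) -> all_prop A s -> all_prop B s.
Proof. by move=> AB; elim: s => //= x s IH [/AB ? /IH]. Qed.

(** * Renaming and alpha-conversion *)

Definition rcomp (r r' : renaming) : renaming := fun k a => r k (r' k a).

Lemma chan_ren_comp r r' u :
  chan_ren r (chan_ren r' u) = chan_ren (rcomp r r') u.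
Proof. by case: u. Qed.

Lemma ren_comp r r' :
  (forall V, value_ren r (value_ren r' V) = value_ren (rcomp r r') V) /\
  (forall P, proc_ren r (proc_ren r' P) = proc_ren (rcomp r r') P).
Proof.
apply: value_proc_ind => //=.
- by move=> u; rewrite chan_ren_comp.
- by move=> x P ->.
- by move=> u V Q -> ->; rewrite chan_ren_comp.
- by move=> u x Q ->; rewrite chan_ren_comp.
- move=> u Qs IH; rewrite chan_ren_comp -map_comp; congr PSel.
  by apply: eq_map_all_prop; apply: all_prop_imp IH => -[w Q] /= ->.
- move=> u Qs IH; rewrite chan_ren_comp -map_comp; congr PBra.
  by apply: eq_map_all_prop; apply: all_prop_imp IH => -[w Q] /= ->.
- by move=> P Q -> ->.
- by move=> X P ->.
- by move=> V u ->; rewrite chan_ren_comp.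
- by move=> n P ->.
Qed.

Definition idren : renaming := fun k a => a.

Lemma ren_id :
  (forall V, value_ren idren V = V) /\ (forall P, proc_ren idren P = P).
Proof.
apply: value_proc_ind => //=.
- by case.
- by move=> x P ->.
- by case=> [a|s p|x] V Q -> ->.
- by case=> [a|s p|x] y Q ->.
- move=> u Qs IH; have ->: chan_ren idren u = u by case: u.
  congr PSel; rewrite -[RHS]map_id.
  by apply: eq_map_all_prop; apply: all_prop_imp IH => -[w Q] /= ->.
- move=> u Qs IH; have ->: chan_ren idren u = u by case: u.
  congr PBra; rewrite -[RHS]map_id.
  by apply: eq_map_all_prop; apply: all_prop_imp IH => -[w Q] /= ->.
- by move=> P Q -> ->.
- by move=> X P ->.
- by move=> V [a|s p|x] ->.
- by move=> n P ->.
Qed.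

Lemma chan_fs_ren r k u : chan_fs k (chan_ren r u) = map (r k) (chan_fs k u).
Proof. by case: k; case: u. Qed.

Lemma same_kindP k k' : reflect (k = k') (same_kind k k').
Proof. by case: k; case: k'; constructor. Qed.

Lemma filter_map_inj (f : nat -> nat) a l : injective f ->
  filter (predC1 (f a)) (map f l) = map f (filter (predC1 a) l).
Proof.
move=> f_inj; rewrite filter_map; congr map; apply: eq_filter => x /=.
by rewrite inj_eq.
Qed.

Lemma unbind_ren (r : renaming) k k' a l : (forall k, injective (r k)) ->
  unbind k k' (r k' a) (map (r k) l) = map (r k) (unbind k k' a l).
Proof.
move=> r_inj; rewrite /unbind; case: same_kindP => // <-.
exact: filter_map_inj.
Qed.

Lemma fs_ren r k : (forall k, injective (r k)) ->
  (forall V, value_fs k (value_ren r V) = map (r k) (value_fs k V)) /\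
  (forall P, proc_fs k (proc_ren r P) = map (r k) (proc_fs k P)).
Proof.
move=> r_inj; apply: value_proc_ind => //=.
- by move=> u; rewrite chan_fs_ren.
- by move=> x P ->; rewrite unbind_ren.
- by move=> u V Q -> ->; rewrite chan_fs_ren !map_cat.
- by move=> u x Q ->; rewrite chan_fs_ren unbind_ren // map_cat.
- move=> u Qs IH; rewrite chan_fs_ren map_cat map_flatten -!map_comp.
  by congr (_ ++ flatten _); apply: eq_map_all_prop;
     apply: all_prop_imp IH => -[w Q].
- move=> u Qs IH; rewrite chan_fs_ren map_cat map_flatten -!map_comp.
  by congr (_ ++ flatten _); apply: eq_map_all_prop;
     apply: all_prop_imp IH => -[w Q].
- by move=> P Q -> ->; rewrite map_cat.
- by move=> X; case: k.
- by move=> X P ->; rewrite unbind_ren.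
- by move=> V u ->; rewrite chan_fs_ren map_cat.
- by move=> n P ->; rewrite unbind_ren.
Qed.

Lemma binder_ren (r : renaming) k k' a :
  binder k k' (r k' a) = map (r k) (binder k k' a).
Proof. by rewrite /binder; case: same_kindP => // <-. Qed.

Lemma bs_ren r k :
  (forall V, value_bs k (value_ren r V) = map (r k) (value_bs k V)) /\
  (forall P, proc_bs k (proc_ren r P) = map (r k) (proc_bs k P)).
Proof.
apply: value_proc_ind => //=.
- by move=> x P ->; rewrite binder_ren map_cat.
- by move=> u V Q -> ->; rewrite !map_cat.
- by move=> u x Q ->; rewrite binder_ren map_cat.
- move=> u Qs IH; rewrite map_flatten -!map_comp.
  by congr flatten; apply: eq_map_all_prop; apply: all_prop_imp IH => -[w Q].
- move=> u Qs IH; rewrite map_flatten -!map_comp.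
  by congr flatten; apply: eq_map_all_prop; apply: all_prop_imp IH => -[w Q].
- by move=> P Q -> ->; rewrite map_cat.
- by move=> X P ->; rewrite binder_ren map_cat.
- by move=> n P ->; rewrite binder_ren map_cat.
Qed.

Lemma unfold_ren r X R : injective (r KRec) ->
  (forall V, value_unfold (r KRec X) (proc_ren r R) (value_ren r V) =
             value_ren r (value_unfold X R V)) /\
  (forall P, proc_unfold (r KRec X) (proc_ren r R) (proc_ren r P) =
             proc_ren r (proc_unfold X R P)).
Proof.
move=> r_inj; apply: value_proc_ind => //=.
- by move=> x P ->.
- by move=> u V Q -> ->.
- by move=> u x Q ->.
- move=> u Qs IH; rewrite -!map_comp; congr PSel.
  by apply: eq_map_all_prop; apply: all_prop_imp IH => -[w Q] /= ->.
- move=> u Qs IH; rewrite -!map_comp; congr PBra.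
  by apply: eq_map_all_prop; apply: all_prop_imp IH => -[w Q] /= ->.
- by move=> P Q -> ->.
- by move=> Y; rewrite inj_eq //; case: eqP.
- by move=> Y P IH; rewrite inj_eq //; case: eqP => //= _; rewrite IH.
- by move=> V u ->.
- by move=> n P ->.
Qed.

Lemma lookup_ren (r : renaming) sg x : injective (r KVar) ->
  lookup (store_ren r sg) (r KVar x) = omap (value_ren r) (lookup sg x).
Proof.
by move=> r_inj; elim: sg => //= -[y V] sg IH /=; rewrite inj_eq //; case: eqP.
Qed.

Lemma drop_ren (r : renaming) sg x : injective (r KVar) ->
  drop_var (r KVar x) (store_ren r sg) = store_ren r (drop_var x sg).
Proof.
move=> r_inj; rewrite /drop_var /store_ren filter_map; congr map.
by apply: eq_filter => -[y V] /=; rewrite inj_eq.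
Qed.

Lemma chan_sub_ren (r : renaming) sg u : injective (r KVar) ->
  chan_sub (store_ren r sg) (chan_ren r u) = chan_ren r (chan_sub sg u).
Proof.
by move=> r_inj; case: u => //= x; rewrite lookup_ren //; case: lookup => //= -[].
Qed.

Lemma sub_ren r : injective (r KVar) ->
  (forall V sg, value_sub (store_ren r sg) (value_ren r V) =
                value_ren r (value_sub sg V)) /\
  (forall P sg, proc_sub (store_ren r sg) (proc_ren r P) =
                proc_ren r (proc_sub sg P)).
Proof.
move=> r_inj; apply: value_proc_ind => //=.
- by case=> //= x sg; rewrite lookup_ren //; case: lookup.
- by move=> x P IH sg; rewrite drop_ren ?IH.
- by move=> u V Q IHV IH sg; rewrite chan_sub_ren ?IHV ?IH.
- by move=> u x Q IH sg; rewrite chan_sub_ren ?drop_ren ?IH.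
- move=> u Qs IH sg; rewrite chan_sub_ren // -!map_comp; congr PSel.
  by apply: eq_map_all_prop; apply: all_prop_imp IH => -[w Q] /= ->.
- move=> u Qs IH sg; rewrite chan_sub_ren // -!map_comp; congr PBra.
  by apply: eq_map_all_prop; apply: all_prop_imp IH => -[w Q] /= ->.
- by move=> P Q IHP IHQ sg; rewrite IHP IHQ.
- by move=> X P IH sg; rewrite IH.
- by move=> V u IH sg; rewrite chan_sub_ren ?IH.
- by move=> n P IH sg; rewrite IH.
Qed.

Lemma apart_map (f : nat -> nat) l1 l2 : injective f ->
  apart (map f l1) (map f l2) = apart l1 l2.
Proof.
move=> f_inj; rewrite /apart has_map; congr negb; apply: eq_has => x /=.
by rewrite mem_map.
Qed.

Lemma apartP l1 l2 : reflect (forall x, x \in l1 -> x \in l2 -> False) (apart l1 l2).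
Proof.
apply: (iffP hasPn) => [H x x1 x2|H x x2]; first by have /negP := H x x2.
by apply/negP => x1; apply: H x1 x2.
Qed.

(** Conjugating a transposition by an injective renaming gives a transposition. This carries every
    alpha-conversion rule through a renaming. *)
Lemma swap_ren (r : renaming) k a b : (forall k, injective (r k)) ->
  rcomp r (swap k a b) = rcomp (swap k (r k a) (r k b)) r.
Proof.
move=> r_inj; apply: functional_extensionality_dep => k'.
apply: functional_extensionality => c; rewrite /rcomp /swap.
case: same_kindP => // kk; subst k'; rewrite !(inj_eq (@r_inj k)).
by case: eqP => // _; case: eqP.
Qed.

Scheme vcong_mind := Induction for vcong Sort Prop
  with pcong_mind := Induction for pcong Sort Prop
  with bcong_mind := Induction for bcong Sort Prop.
Combined Scheme vpb_cong_ind from vcong_mind, pcong_mind, bcong_mind.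

Lemma cong_ren r : (forall k, injective (r k)) ->
  (forall V W, vcong V W -> vcong (value_ren r V) (value_ren r W)) /\
  (forall P Q, pcong P Q -> pcong (proc_ren r P) (proc_ren r Q)) /\
  (forall Ps Qs, bcong Ps Qs -> bcong (branches_ren r Ps) (branches_ren r Qs)).
Proof.
move=> r_inj; have [fsV fsP] := (fun k => proj1 (fs_ren k r_inj), fun k => proj2 (fs_ren k r_inj)).
apply: vpb_cong_ind => /=; try by constructor.
- by move=> V1 V2 V3 ????; apply: vc_trans; eassumption.
- move=> x y P yP; have := @vc_alpha (r KVar x) (r KVar y) (proc_ren r P).
  rewrite fsP mem_map // => /(_ yP).
  by rewrite !(proj2 (ren_comp _ _)) swap_ren.
- by move=> V1 V2 V3 ????; apply: pc_trans; eassumption.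
- by move=> n P Q nP; constructor; rewrite fsP mem_map.
- move=> X P H; rewrite -(proj2 (unfold_ren X _ _)) //; apply: pc_unfold => k.
  by rewrite (proj2 (bs_ren r k)) (fsP k (PRec X P)) apart_map.
- move=> u x y P yP; have := @pc_alpha_in (chan_ren r u) (r KVar x) (r KVar y) (proc_ren r P).
  rewrite fsP mem_map // => /(_ yP).
  by rewrite !(proj2 (ren_comp _ _)) swap_ren.
- move=> x y P yP; have := @pc_alpha_rec (r KRec x) (r KRec y) (proc_ren r P).
  rewrite fsP mem_map // => /(_ yP).
  by rewrite !(proj2 (ren_comp _ _)) swap_ren.
- move=> x y P yP; have := @pc_alpha_new (r KName x) (r KName y) (proc_ren r P).
  rewrite fsP mem_map // => /(_ yP).
  by rewrite !(proj2 (ren_comp _ _)) swap_ren.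
Qed.

Lemma bcong_refl Ps : bcong Ps Ps.
Proof. by elim: Ps => [|[w P] Ps IH]; constructor => //; apply: pc_refl. Qed.

Lemma bcong_sym Ps Qs : bcong Ps Qs -> bcong Qs Ps.
Proof. by elim=> *; constructor=> //; apply: pc_sym. Qed.

Lemma bcong_trans Ps Qs Rs : bcong Ps Qs -> bcong Qs Rs -> bcong Ps Rs.
Proof.
move=> H; elim: H Rs => // l P P' Ps1 Ps1' PP' _ IH Rs H; inversion H; subst.
by constructor; [apply: pc_trans PP' _|apply: IH].
Qed.

(** Restrictions bind names only, so the renamings of normal forms leave variables and recursion
    variables fixed. They are given by plain functions, which compose and can be compared
    extensionally. *)
Definition nren (f : nat -> nat) : renaming := fun k a => if k is KName then f a else a.

Definition tr (a b : nat) : nat -> nat := fun c => if c == a then b else if c == b then a else c.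

Lemma swapE a b : swap KName a b = nren (tr a b).
Proof.
by apply: functional_extensionality_dep => -[]; apply: functional_extensionality.
Qed.

Lemma nren_comp f g : rcomp (nren f) (nren g) = nren (f \o g).
Proof.
by apply: functional_extensionality_dep => -[]; apply: functional_extensionality.
Qed.

Lemma nren_inj (f : nat -> nat) : injective f -> forall k, injective (nren f k).
Proof. by move=> f_inj [] x y //= /f_inj. Qed.

Lemma nren_id : nren id = idren.
Proof.
by apply: functional_extensionality_dep => -[]; apply: functional_extensionality.
Qed.

Lemma trK a b : involutive (tr a b).
Proof.
move=> c; rewrite /tr; case: (eqVneq c a) => [->|ca].
  by case: (eqVneq b a) => [->|]; rewrite ?eqxx.
case: (eqVneq c b) => [->|cb]; first by rewrite eqxx.
by rewrite (negPf ca) (negPf cb).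
Qed.

Lemma tr_inj a b : injective (tr a b).
Proof. exact: inv_inj (@trK a b). Qed.

Lemma trL a b : tr a b a = b. Proof. by rewrite /tr eqxx. Qed.
Lemma trR a b : tr a b b = a. Proof. by rewrite /tr eqxx; case: eqP. Qed.
Lemma trN a b c : c != a -> c != b -> tr a b c = c.
Proof. by rewrite /tr => /negPf-> /negPf->. Qed.
#[local] Hint Resolve tr_inj nren_inj : core.

(** Freshness is required for the whole restriction, which leaves room for [m = n]. *)
Lemma pnew_alpha n m P : m \notin proc_fs KName (PNew n P) ->
  pcong (PNew n P) (PNew m (proc_ren (nren (tr n m)) P)).
Proof.
move=> H; case: (eqVneq m n) => [->|mn].
  rewrite (_ : nren _ = idren) ?(proj2 ren_id); first exact: pc_refl.
  rewrite -nren_id; congr nren; apply: functional_extensionality => c.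
  by rewrite /tr; case: eqP.
by rewrite -swapE; apply: pc_alpha_new; move: H; rewrite /= /unbind /= mem_filter /= mn.
Qed.

(* Renamings also act on the binders, where [f] and [g] may disagree:
   alpha-conversion makes up for it. *)
Lemma ren_agree_cong (g : nat -> nat) : injective g ->
  (forall V (f : nat -> nat), injective f -> {in value_fs KName V, f =1 g} ->
     vcong (value_ren (nren f) V) (value_ren (nren g) V)) /\
  (forall P (f : nat -> nat), injective f -> {in proc_fs KName P, f =1 g} ->
     pcong (proc_ren (nren f) P) (proc_ren (nren g) P)).
Proof.
move=> g_inj.
have Hch u h : {in chan_fs KName u, h =1 g} -> chan_ren (nren h) u = chan_ren (nren g) u.
  by case: u => [a|s p|x] //= H; rewrite H // inE.
have HB (Qs : seq (label * proc)) h : injective h ->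
  all_prop (fun b => forall f : nat -> nat, injective f -> {in proc_fs KName b.2, f =1 g} ->
    pcong (proc_ren (nren f) b.2) (proc_ren (nren g) b.2)) Qs ->
  {in flatten [seq proc_fs KName b.2 | b <- Qs], h =1 g} ->
  bcong [seq (b.1, proc_ren (nren h) b.2) | b <- Qs]
        [seq (b.1, proc_ren (nren g) b.2) | b <- Qs].
  move=> h_inj; elim: Qs => [|[w Q] Qs IH] /=; first by constructor.
  move=> [H1 H2] E; constructor; first by apply: H1 => // x xQ; apply: E; rewrite mem_cat xQ.
  by apply: IH => // x xQ; apply: E; rewrite mem_cat xQ orbT.
apply: value_proc_ind => /=; try by constructor.
- by move=> u h h_inj /Hch->; constructor.
- by move=> x P IH h h_inj E; constructor; apply: IH.
- move=> u V Q IHV IHQ h h_inj E; rewrite (Hch u h) => [|x xu]; last by apply: E; rewrite mem_cat xu.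
  by constructor; [apply: IHV|apply: IHQ] => // x xu; apply: E; rewrite !mem_cat xu ?orbT.
- move=> u x Q IHQ h h_inj E; rewrite (Hch u h) => [|y xu]; last by apply: E; rewrite mem_cat xu.
  by constructor; apply: IHQ => // y xu; apply: E; rewrite !mem_cat /unbind /= xu ?orbT.
- move=> u Qs IH h h_inj E; rewrite (Hch u h) => [|y xu]; last by apply: E; rewrite mem_cat xu.
  by constructor; apply: HB => // y yQ; apply: E; rewrite mem_cat yQ orbT.
- move=> u Qs IH h h_inj E; rewrite (Hch u h) => [|y xu]; last by apply: E; rewrite mem_cat xu.
  by constructor; apply: HB => // y yQ; apply: E; rewrite mem_cat yQ orbT.
- by move=> P Q IHP IHQ h h_inj E; constructor; [apply: IHP|apply: IHQ] => // x xu; apply: E; rewrite !mem_cat xu ?orbT.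
- by move=> X P IH h h_inj E; constructor; apply: IH.
- move=> V u IHV h h_inj E; rewrite (Hch u h) => [|x xu]; last by apply: E; rewrite mem_cat xu orbT.
  by constructor; apply: IHV => // x xu; apply: E; rewrite !mem_cat xu ?orbT.
- move=> n P IH h h_inj E.
  have E' x : x \in proc_fs KName P -> x != n -> h x = g x.
    by move=> xP xn; apply: E; rewrite /unbind /= mem_filter /= xn.
  (* The binder [h n] is converted to [g n]. The induction hypothesis is then used at
     [tr (h n) (g n) \o h], which agrees with [g] at [n] as well; this is why the first renaming is
     quantified inside the induction. *)
  apply: pc_trans (pnew_alpha (m := g n) _) _.
    rewrite /= /unbind /= (proj2 (fs_ren _ (nren_inj h_inj))) filter_map_inj //.
    apply/negP => /mapP[x]; rewrite mem_filter /= => /andP[xn xP].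
    by rewrite E' // => /g_inj /eqP; rewrite eq_sym (negPf xn).
  rewrite (proj2 (ren_comp _ _)) nren_comp; apply: pc_new; apply: IH.
    by apply: inj_comp.
  move=> x xP /=; case: (eqVneq x n) => [->|xn]; first by rewrite trL.
  rewrite (E' x xP xn) trN // ?(inj_eq g_inj) //.
  by rewrite -(E' x xP xn) inj_eq.
Qed.

Lemma mem_map_inv (f : nat -> nat) l x : involutive f -> (x \in map f l) = (f x \in l).
Proof. by move=> fK; rewrite -{1}(fK x) mem_map //; apply: inv_inj. Qed.

Lemma eq_mem_cat (T : eqType) (s s' t t' : seq T) : s =i s' -> t =i t' -> s ++ t =i s' ++ t'.
Proof. by move=> E F x; rewrite !mem_cat E F. Qed.

Ltac bool_cases :=
  repeat match goal with |- context [?x \in ?l] => case: (x \in l) end;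
  rewrite /is_true /=; intuition congruence.

(** Only bounds hold in general: [X] may fail to occur in the term, and binders may capture names of
    [R]. For [R = PRec X P] both bounds are the free names of [P], which settles the case of
    [pc_unfold] in [fn_cong]. *)
Lemma fn_unfold X R x :
  (forall V, (x \in value_fs KName V -> x \in value_fs KName (value_unfold X R V)) /\
     (x \in value_fs KName (value_unfold X R V) ->
        (x \in value_fs KName V) || (x \in proc_fs KName R))) /\
  (forall P, (x \in proc_fs KName P -> x \in proc_fs KName (proc_unfold X R P)) /\
     (x \in proc_fs KName (proc_unfold X R P) ->
        (x \in proc_fs KName P) || (x \in proc_fs KName R))).
Proof.
have HB (u : chan) (Qs : seq (label * proc)) :
  all_prop (fun b => (x \in proc_fs KName b.2 -> x \in proc_fs KName (proc_unfold X R b.2)) /\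
     (x \in proc_fs KName (proc_unfold X R b.2) ->
        (x \in proc_fs KName b.2) || (x \in proc_fs KName R))) Qs ->
  (x \in chan_fs KName u ++ flatten [seq proc_fs KName b.2 | b <- Qs] ->
   x \in chan_fs KName u ++ flatten [seq proc_fs KName b.2 | b <- [seq (b.1, proc_unfold X R b.2) | b <- Qs]]) /\
  (x \in chan_fs KName u ++ flatten [seq proc_fs KName b.2 | b <- [seq (b.1, proc_unfold X R b.2) | b <- Qs]] ->
   (x \in chan_fs KName u ++ flatten [seq proc_fs KName b.2 | b <- Qs]) || (x \in proc_fs KName R)).
  elim: Qs => [|[w Q] Qs IH] /=; first by split=> // ->.
  move=> [[H1 H2] /IH [H3 H4]]; move: H3 H4; rewrite !mem_cat.
  case: (x \in chan_fs _ _) => //= H3 H4; split=> /orP[].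
  - by move/H1->.
  - by move/H3->; rewrite orbT.
  - by move/H2/orP=> [->|->]; rewrite ?orbT.
  - by move/H4/orP=> [->|->]; rewrite ?orbT.
apply: value_proc_ind => /=; try by split=> // ->.
- by move=> y P; rewrite /unbind.
- by move=> u V Q [H1 H2] [H3 H4]; rewrite !mem_cat; move: H1 H2 H3 H4; bool_cases.
- by move=> u y Q [H1 H2]; rewrite !mem_cat /unbind /=; move: H1 H2; bool_cases.
- by move=> u Qs /HB; apply.
- by move=> u Qs /HB; apply.
- by move=> P Q [H1 H2] [H3 H4]; rewrite !mem_cat; move: H1 H2 H3 H4; bool_cases.
- by move=> Y; split=> //; case: eqP => // _ ->.
- by move=> Y P [H1 H2]; case: eqP => _ /=; rewrite /unbind //=; split=> // ->.
- by move=> V u [H1 H2]; rewrite !mem_cat; move: H1 H2; bool_cases.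
- by move=> n P [H1 H2]; rewrite /unbind /= !mem_filter; split=> /andP[/= -> /=].
Qed.

Lemma swap_inj k a b k' : injective (swap k a b k').
Proof.
by rewrite /swap; case: same_kindP => _ x y //; apply: (@tr_inj a b).
Qed.
#[local] Hint Resolve swap_inj : core.

Lemma fn_alpha n m l : m \notin l ->
  filter (predC1 n) l =i filter (predC1 m) (map (tr n m) l).
Proof.
move=> ml x; rewrite !mem_filter /= mem_map_inv; last exact: trK.
case: (eqVneq x n) => [->|xn] /=; first by rewrite trL (negPf ml) andbF.
case: (eqVneq x m) => [->|xm] /=; first by rewrite (negPf ml).
by rewrite trN.
Qed.

Lemma map_swap_other k k' a b l : k <> k' -> map (swap k a b k') l = l.
Proof.
by move=> kk; rewrite -[RHS]map_id; apply: eq_map => x; rewrite /swap; case: same_kindP.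
Qed.

Lemma fn_cong :
  (forall V W, vcong V W -> value_fs KName V =i value_fs KName W) /\
  (forall P Q, pcong P Q -> proc_fs KName P =i proc_fs KName Q) /\
  (forall Ps Qs, bcong Ps Qs -> flatten [seq proc_fs KName b.2 | b <- Ps] =i
                                flatten [seq proc_fs KName b.2 | b <- Qs]).
Proof.
apply: vpb_cong_ind => //=.
- by move=> V W _ E x; rewrite E.
- by move=> V1 V2 V3 _ E _ F x; rewrite E F.
- move=> x y P _ z; rewrite /unbind /=.
  by rewrite (proj2 (fs_ren _ _)) // map_swap_other.
- by move=> P Q _ E x; rewrite E.
- by move=> P1 P2 P3 _ E _ F x; rewrite E F.
- by move=> u V V' P P' _ E _ F; do !apply: eq_mem_cat.
- by move=> u x P P' _ E; apply: eq_mem_cat; rewrite /unbind.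
- by move=> u Ps Ps' _ E; apply: eq_mem_cat.
- by move=> u Ps Ps' _ E; apply: eq_mem_cat.
- by move=> P P' Q Q' _ E _ F; apply: eq_mem_cat.
- by move=> V V' u _ E; apply: eq_mem_cat.
- by move=> n P P' _ E x; rewrite /unbind /= !mem_filter E.
- by move=> P x; rewrite cats0.
- by move=> P Q x; rewrite !mem_cat orbC.
- by move=> P Q R x; rewrite !mem_cat orbA.
- by move=> n m P x; rewrite /unbind /= !mem_filter /=; case: eqP; case: eqP.
- move=> n P Q nP x; rewrite /unbind /= !mem_filter !mem_cat mem_filter /=.
  by case: eqP => // ->; rewrite (negPf nP).
- move=> X P _ x; have [_ /(_ P) [H1 H2]] := fn_unfold X (PRec X P) x.
  rewrite /unbind /=; apply/idP/idP => //.
  by move=> /H2 /orP[].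
- by move=> u x y P _ z; rewrite /unbind /= !mem_cat (proj2 (fs_ren _ _)) // map_swap_other.
- by move=> x y P _ z; rewrite /unbind /= (proj2 (fs_ren _ _)) // map_swap_other.
- move=> n m P mP; rewrite /unbind /= (proj2 (fs_ren _ _)) //.
  exact: fn_alpha.
- by move=> _ P P' Ps Ps' _ E _ F; apply: eq_mem_cat.
Qed.

(** Used when a forward output is read backwards: every free name of the value sent is still present
    in the message, so the reversed step creates no free name. *)
Lemma fn_sub x :
  (forall V sg, x \in value_fs KName V -> x \in value_fs KName (value_sub sg V)) /\
  (forall P sg, x \in proc_fs KName P -> x \in proc_fs KName (proc_sub sg P)).
Proof.
have HC u sg : x \in chan_fs KName u -> x \in chan_fs KName (chan_sub sg u).
  by case: u.
have HB (u : chan) sg (Qs : seq (label * proc)) :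
  all_prop (fun b => forall sg, x \in proc_fs KName b.2 -> x \in proc_fs KName (proc_sub sg b.2)) Qs ->
  (x \in chan_fs KName u ++ flatten [seq proc_fs KName b.2 | b <- Qs] ->
   x \in chan_fs KName (chan_sub sg u) ++ flatten [seq proc_fs KName b.2 | b <- [seq (b.1, proc_sub sg b.2) | b <- Qs]]).
  elim: Qs => [|[w Q] Qs IH] /=; first by rewrite !cats0 => _ xu; apply: HC.
  move=> [H1 /IH]; rewrite !mem_cat => H3 /or3P[/HC->|/H1->|] //; first by rewrite orbT.
  by move=> H; move: H3; rewrite H orbT => /(_ isT) /orP[]->; rewrite ?orbT.
apply: value_proc_ind => //=.
- by case.
- by move=> y P H1 sg; rewrite /unbind /= => xP; apply: H1.
- by move=> u V Q H1 H2 sg; rewrite !mem_cat => /or3P[/HC->|/H1->|/H2->]; rewrite ?orbT.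
- by move=> u y Q H1 sg; rewrite !mem_cat /unbind /= => /orP[/HC->|/H1->]; rewrite ?orbT.
- by move=> u Qs IH sg; apply: HB.
- by move=> u Qs IH sg; apply: HB.
- by move=> P Q H1 H2 sg; rewrite !mem_cat => /orP[/H1->|/H2->]; rewrite ?orbT.
- by move=> V u H1 sg; rewrite !mem_cat => /orP[/H1->|/HC->]; rewrite ?orbT.
- by move=> n P H1 sg; rewrite /unbind /= !mem_filter => /andP[-> /H1->].
Qed.

(** * Congruence of stacks, stores and queues *)

Lemma stack_cong_refl C : stack_cong C C.
Proof. by elim: C => [|[] *]; constructor => //; constructor; apply: bcong_refl. Qed.
Lemma stack_cong_sym C C' : stack_cong C C' -> stack_cong C' C.
Proof. by elim=> [|f f' D D' []]; constructor => //; constructor; apply: bcong_sym. Qed.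
Lemma frame_cong_trans f1 f2 f3 : frame_cong f1 f2 -> frame_cong f2 f3 -> frame_cong f1 f3.
Proof.
by case=> u Ps Ps' Qs Qs' PP QQ F; inversion F; subst; constructor;
  eapply bcong_trans; eassumption.
Qed.
Lemma stack_cong_trans C1 C2 C3 : stack_cong C1 C2 -> stack_cong C2 C3 -> stack_cong C1 C3.
Proof.
move=> H; elim: H C3 => // f f' D D' ff _ IH C3 H; inversion H; subst.
by constructor; [eapply frame_cong_trans; eassumption|apply: IH].
Qed.
Lemma store_cong_refl s : store_cong s s.
Proof. by elim: s => [|[] *]; constructor => //; apply: vc_refl. Qed.
Lemma queue_cong_refl h : queue_cong h h.
Proof. by elim: h => [|[[p q] []] *]; constructor => //; apply: vc_refl. Qed.
Lemma queue_cong_sym h h' : queue_cong h h' -> queue_cong h' h.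
Proof.
elim=> [|h1 h2 h3 _ H _ H'||p q V V' h0 h0' VV _ IH|p1 q1 m1 p2 q2 m2 h0 pq].
- by constructor.
- exact: qc_trans H' H.
- by constructor.
- by constructor; first exact: vc_sym.
- by apply: qc_swap; rewrite (eq_sym p2) (eq_sym q2).
Qed.
Lemma queue_cong_size h h' : queue_cong h h' -> size h = size h'.
Proof. by elim=> //= [????->_->|?????? ->|??????? _ ->]. Qed.

(** A swap needs two messages, so on a singleton only the congruence of payloads remains. *)
Lemma queue_cong1 m h : queue_cong [:: m] h -> exists m', [/\ h = [:: m'], m.1 = m'.1 &
  match m.2, m'.2 with MVal V, MVal V' => vcong V V' | MLab l, MLab l' => l = l' | _, _ => False end].
Proof.
move E: [:: m] => h0 H; elim: H m E => //.
- move=> h1 h2 h3 _ IH1 _ IH2 m /IH1 [m' [/esym/IH2 [m'' [-> F1 F2]] E1 E2]].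
  exists m''; split=> //; first by rewrite E1.
  case: m.2 E2; case: m'.2 F2 => //; case: m''.2 => // *; try congruence.
  by apply: vc_trans; eassumption.
- move=> p q l h' h'' H _ m [-> E]; subst; exists (p, q, MLab l); split=> //.
  by move/queue_cong_size: H; case: h''.
- move=> p q V V' h' h'' VV H _ m [-> E]; subst; exists (p, q, MVal V'); split=> //.
  by move/queue_cong_size: H; case: h''.
Qed.

Lemma queue_cong_rcons h h' m m' : queue_cong h h' -> m.1 = m'.1 ->
  match m.2, m'.2 with MVal V, MVal V' => vcong V V' | MLab l, MLab l' => l = l' | _, _ => False end ->
  queue_cong (rcons h m) (rcons h' m').
Proof.
move=> H E F; have H1 : queue_cong [:: m] [:: m'].
  case: m m' E F => [[p q] pl] [[p' q'] [V|l]] /= [-> ->]; case: pl => // W.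
    by constructor => //; constructor.
  by move=> ->; apply: queue_cong_refl.
apply: (@qc_trans _ (rcons h m')).
  elim: h {H} => [|[[p q] [V|l]] h IH] //=; constructor=> //; exact: vc_refl.
elim: H => [|h1 h2 h3 _ G _ G'|||].
- exact: queue_cong_refl.
- exact: qc_trans G G'.
- by constructor.
- by constructor.
- by move=> *; apply: qc_swap.
Qed.

Lemma stack_fn_cong C C' : stack_cong C C' -> stack_fn C =i stack_fn C'.
Proof.
rewrite /stack_fn; elim=> // f f' D D' ff _ IH /=; apply: eq_mem_cat => //.
case: ff => u Ps Ps' Qs Qs' /(proj2 (proj2 fn_cong)) E /(proj2 (proj2 fn_cong)) F /=;
by rewrite !map_cat !flatten_cat; do !apply: eq_mem_cat.
Qed.

Lemma store_fn_cong s s' : store_cong s s' -> store_fs KName s =i store_fs KName s'.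
Proof.
rewrite /store_fs; elim=> // x V V' D D' /(proj1 fn_cong) E _ IH /=; exact: eq_mem_cat.
Qed.

Lemma queue_fn_cong h h' : queue_cong h h' ->
  flatten (map message_fn h) =i flatten (map message_fn h').
Proof.
elim=> //= [h1 h2 h3 _ E _ F x|p q V V' g g' /(proj1 fn_cong) E _ IH|p1 q1 m1 p2 q2 m2 g _ x].
- by rewrite E F.
- exact: eq_mem_cat.
- by rewrite !mem_cat orbCA.
Qed.

(** * Renaming of configurations *)

Lemma event_ren_comp r r' e : event_ren r (event_ren r' e) = event_ren (rcomp r r') e.
Proof. by case: e. Qed.

Lemma branches_ren_comp r r' e : branches_ren r (branches_ren r' e) = branches_ren (rcomp r r') e.
Proof.
by rewrite /branches_ren -map_comp; apply: eq_map => -[w P] /=; rewrite (proj2 (ren_comp _ _)).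
Qed.

Lemma frame_ren_comp r r' e : frame_ren r (frame_ren r' e) = frame_ren (rcomp r r') e.
Proof. by case: e => * /=; rewrite chan_ren_comp !branches_ren_comp. Qed.

Lemma message_ren_comp r r' e : message_ren r (message_ren r' e) = message_ren (rcomp r r') e.
Proof. by case: e => [[p q] []] *; rewrite /message_ren //= (proj1 (ren_comp _ _)). Qed.

Lemma store_ren_comp r r' e : store_ren r (store_ren r' e) = store_ren (rcomp r r') e.
Proof.
by rewrite /store_ren -map_comp; apply: eq_map => -[w P] /=; rewrite (proj1 (ren_comp _ _)).
Qed.

Lemma config_ren_comp r r' M : config_ren r (config_ren r' M) = config_ren (rcomp r r') M.
Proof.
have [Hv Hp] := ren_comp r r'.
elim: M => //=.
- by move=> M -> N ->.
- by move=> n M ->.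
- by move=> *; rewrite Hp.
- by move=> *; rewrite Hp.
- by move=> l p C P; rewrite Hp -map_comp; congr CRun; apply: eq_map => f /=; exact: frame_ren_comp.
- move=> s p h T xs sg t; rewrite store_ren_comp -!map_comp; congr CMon.
  by apply: eq_map => f; apply: event_ren_comp.
- by move=> s hi ho; rewrite -!map_comp; congr CQueue; apply: eq_map => m /=; apply: message_ren_comp.
- by move=> *; rewrite Hv chan_ren_comp.
Qed.

Lemma config_ren_id M : config_ren idren M = M.
Proof.
have [Hv Hp] := ren_id.
have Hc u : chan_ren idren u = u by case: u.
have Hb Ps : branches_ren idren Ps = Ps.
  by rewrite /branches_ren -[RHS]map_id; apply: eq_map => -[w P] /=; rewrite Hp.
elim: M => //=.
- by move=> M -> N ->.
- by move=> n M ->.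
- by move=> *; rewrite Hp.
- by move=> *; rewrite Hp.
- move=> l p C P; rewrite Hp; congr CRun; rewrite -[RHS]map_id.
  by apply: eq_map => -[] * /=; rewrite Hc !Hb.
- move=> s p h T xs sg t; congr CMon; rewrite -[RHS]map_id; apply: eq_map.
  + by case.
  + by move=> x.
  + by case=> x V; rewrite /= Hv.
- have Hm m : message_ren idren m = m by case: m => [[p q] []] * //; rewrite /message_ren /= Hv.
  by move=> s hi ho; congr CQueue; rewrite -[RHS]map_id; apply: eq_map => m.
- by move=> *; rewrite Hv Hc.
Qed.

Lemma event_fn_ren r e : event_fn (event_ren r e) = map (r KName) (event_fn e).
Proof. by case: e. Qed.

Lemma frame_fn_ren r e : (forall k, injective (r k)) ->
  frame_fn (frame_ren r e) = map (r KName) (frame_fn e).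
Proof.
move=> r_inj; have H P := proj2 (fs_ren KName r_inj) P.
case: e => u Ps Qs; rewrite /frame_fn -H /frame_ren /branches_ren -map_cat //.
Qed.

Lemma message_fn_ren r e : (forall k, injective (r k)) ->
  message_fn (message_ren r e) = map (r KName) (message_fn e).
Proof.
by move=> r_inj; case: e => [[p q] []] * //=; rewrite /message_fn /= (proj1 (fs_ren _ r_inj)).
Qed.

Lemma store_fs_ren r k e : (forall k, injective (r k)) ->
  store_fs k (store_ren r e) = map (r k) (store_fs k e).
Proof.
move=> r_inj; rewrite /store_fs map_flatten -!map_comp; congr flatten; apply: eq_map => -[w V] /=.
by rewrite (proj1 (fs_ren _ r_inj)).
Qed.

Lemma map_flatten_eq (T S : Type) (g : T -> T) (f : T -> seq S) (h : S -> S) s :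
  (forall x, f (g x) = map h (f x)) -> flatten (map f (map g s)) = map h (flatten (map f s)).
Proof. by move=> E; rewrite map_flatten -!map_comp; congr flatten; apply: eq_map => x /=. Qed.

Lemma config_fn_ren r M : (forall k, injective (r k)) ->
  config_fn (config_ren r M) = map (r KName) (config_fn M).
Proof.
move=> r_inj; have [Hv Hp] := fs_ren KName r_inj.
elim: M => //=.
- by move=> M -> N ->; rewrite map_cat.
- by move=> n M ->; apply: filter_map_inj.
- by move=> *; rewrite Hp.
- by move=> *; rewrite Hp.
- move=> l p C P; rewrite Hp map_cat; congr (_ :: _ ++ _).
  by apply: map_flatten_eq => f; apply: frame_fn_ren.
- move=> s p h T xs sg t; rewrite store_fs_ren // map_cat; congr (_ :: _ ++ _).
  by apply: map_flatten_eq => f; apply: event_fn_ren.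
- move=> s hi ho; rewrite -map_cat; congr (_ :: _).
  by apply: map_flatten_eq => f; apply: message_fn_ren.
- by move=> k V u l; rewrite Hv map_cat; case: u.
Qed.

(** * Congruence inside a single component *)

Definition atom (A : config) : bool :=
  match A with CNil | CPar _ _ | CNew _ _ => false | _ => true end.

(** The rules of [cong] that act inside one component, closed as an equivalence. [c_run_new] is left
    out: it turns a single component into a restriction. *)
Inductive acong : config -> config -> Prop :=
  | ac_refl M : acong M M
  | ac_sym M N : acong M N -> acong N M
  | ac_trans M1 M2 M3 : acong M1 M2 -> acong M2 M3 -> acong M1 M3
  | ac_req l a x T P P' : pcong P P' -> acong (CReq l a x T P) (CReq l a x T P')
  | ac_req_alpha l a x y T P :
      y \notin proc_fs KVar P ->
      acong (CReq l a x T P) (CReq l a y T (proc_ren (swap KVar x y) P))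
  | ac_acc l a x T P P' : pcong P P' -> acong (CAcc l a x T P) (CAcc l a x T P')
  | ac_acc_alpha l a x y T P :
      y \notin proc_fs KVar P ->
      acong (CAcc l a x T P) (CAcc l a y T (proc_ren (swap KVar x y) P))
  | ac_run l p C C' P P' :
      stack_cong C C' -> pcong P P' -> acong (CRun l p C P) (CRun l p C' P')
  | ac_mon s p h T xs sg sg' t :
      store_cong sg sg' ->
      acong (CMon s p h T xs sg t) (CMon s p h T xs sg' t)
  | ac_mon_unfold s p h X T xs sg t :
      acong (CMon s p h (TRec X T) xs sg t)
           (CMon s p h (ltype_sub X (TRec X T) T) xs sg t)
  | ac_queue s hi hi' ho ho' :
      queue_cong hi hi' -> queue_cong ho ho' ->
      acong (CQueue s hi ho) (CQueue s hi' ho')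
  | ac_mem k V V' u l : vcong V V' -> acong (CMem k V u l) (CMem k V' u l).

Lemma acong_cong A B : acong A B -> cong A B.
Proof. by elim=> *; econstructor; eassumption. Qed.

Lemma stack_cong_ren r C C' : (forall k, injective (r k)) ->
  stack_cong C C' -> stack_cong (map (frame_ren r) C) (map (frame_ren r) C').
Proof.
move=> /cong_ren [_ [_ H]]; elim=> [|f f' D D' ff _ IH]; constructor=> //.
by case: ff => * /=; constructor; apply: H.
Qed.
Lemma store_cong_ren r C C' : (forall k, injective (r k)) ->
  store_cong C C' -> store_cong (store_ren r C) (store_ren r C').
Proof. by move=> /cong_ren [H _]; elim=> [|x V V' D D' ff _ IH]; constructor=> //; apply: H. Qed.
Lemma queue_cong_ren r C C' : (forall k, injective (r k)) ->
  queue_cong C C' -> queue_cong (map (message_ren r) C) (map (message_ren r) C').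
Proof.
move=> /cong_ren [H _]; elim=> [|h1 h2 h3 _ IH1 _ IH2||p q V V' g g' /H VV _ IH|p1 q1 m1 p2 q2 m2 g pq].
- by constructor.
- exact: qc_trans IH1 IH2.
- by move=> *; constructor.
- by constructor.
- exact: qc_swap.
Qed.

Lemma acong_ren r A B : (forall k, injective (r k)) ->
  acong A B -> acong (config_ren r A) (config_ren r B).
Proof.
move=> r_inj; have [Hv [Hp _]] := cong_ren r_inj; have [fsV fsP] := (fun k => proj1 (fs_ren k r_inj), fun k => proj2 (fs_ren k r_inj)).
elim=> /=; try by move=> *; constructor; auto.
- by move=> M1 M2 M3 _ ? _; apply: ac_trans.
- move=> l a x y T P yP; rewrite (proj2 (ren_comp _ _)) swap_ren // -(proj2 (ren_comp _ _)).
  by constructor; rewrite fsP mem_map.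
- move=> l a x y T P yP; rewrite (proj2 (ren_comp _ _)) swap_ren // -(proj2 (ren_comp _ _)).
  by constructor; rewrite fsP mem_map.
- by move=> *; constructor; [apply: stack_cong_ren|apply: Hp].
- by move=> *; constructor; apply: store_cong_ren.
- by move=> *; constructor; apply: queue_cong_ren.
Qed.

Lemma cong_cren r M N : (forall k, injective (r k)) ->
  cong M N -> cong (config_ren r M) (config_ren r N).
Proof.
move=> r_inj; have [fsV fsP] := (fun k => proj1 (fs_ren k r_inj), fun k => proj2 (fs_ren k r_inj)).
have HA A B : acong A B -> cong (config_ren r A) (config_ren r B).
  by move=> H; apply/acong_cong/acong_ren.
elim; try by move=> *; apply: HA; constructor.
all: try by move=> *; constructor; auto.
- by move=> M1 M2 M3 _ ? _; apply: c_trans.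
- by move=> n M0 N0 nM; apply: c_new_par; rewrite config_fn_ren ?mem_map.
- move=> n m M0 mM; rewrite /= config_ren_comp swap_ren // -config_ren_comp.
  by apply: c_alpha; rewrite config_fn_ren ?mem_map.
- move=> l p C n P nl nC; apply: c_run_new; first by rewrite inj_eq.
  rewrite /stack_fn (map_flatten_eq (h := r KName)) ?mem_map // => f.
  exact: frame_fn_ren.
Qed.

Lemma fn_acong A B : acong A B -> config_fn A =i config_fn B.
Proof.
have [Hv [Hp _]] := fn_cong.
elim=> //=.
- by move=> M N _ E x; rewrite E.
- by move=> M1 M2 M3 _ E _ F x; rewrite E F.
- by move=> l a x T P P' /Hp E z; rewrite !inE E.
- by move=> l a x y T P _ z; rewrite (proj2 (fs_ren _ _)) // map_swap_other.
- by move=> l a x T P P' /Hp E z; rewrite !inE E.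
- by move=> l a x y T P _ z; rewrite (proj2 (fs_ren _ _)) // map_swap_other.
- by move=> l p C C' P P' /stack_fn_cong E /Hp F z; rewrite !inE !mem_cat E F.
- by move=> s p h T xs sg sg' _ /store_fn_cong E z; rewrite !inE !mem_cat E.
- by move=> s hi hi' ho ho' /queue_fn_cong E /queue_fn_cong F z; rewrite !map_cat !flatten_cat !inE !mem_cat E F.
- by move=> k V V' u l /Hv E z; rewrite !inE !mem_cat E.
Qed.

Lemma fn_ccong M N : cong M N -> config_fn M =i config_fn N.
Proof.
elim; try by move=> *; apply: fn_acong; constructor.
- by move=> M1 M2 _ E x; rewrite E.
- by move=> M1 M2 M3 _ E _ F x; rewrite E F.
- by move=> M1 M1' M2 M2' _ E _ F; apply: eq_mem_cat.
- by move=> n M1 M2 _ E x; rewrite /= !mem_filter E.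
- by move=> M1 x; rewrite /= cats0.
- by move=> M1 M2 x; rewrite /= !mem_cat orbC.
- by move=> M1 M2 M3 x; rewrite /= catA.
- by [].
- by move=> n m M1 x; rewrite /= !mem_filter /=; case: eqP; case: eqP.
- move=> n M1 M2 nM x; rewrite /= mem_filter !mem_cat mem_filter /=.
  by case: eqP => // ->; rewrite (negPf nM).
- by move=> n m M1 mM; rewrite /= config_fn_ren // swapE; apply: fn_alpha.
- move=> l p C n P nl nC x; rewrite /= /unbind /= eq_sym nl !inE filter_cat !mem_cat !mem_filter /=.
  by case: (eqVneq x n) => [->|] //=; rewrite (negPf nC).
Qed.

(** The two renamings may disagree on names bound inside the processes of [A], where
    [ren_agree_cong] applies; all other names of an atom are free. *)
Lemma atom_alpha (f g : nat -> nat) A : injective f -> injective g -> atom A ->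
  {in config_fn A, f =1 g} -> acong (config_ren (nren f) A) (config_ren (nren g) A).
Proof.
move=> f_inj g_inj; have [Hv' Hp'] := ren_agree_cong g_inj.
have Hv V := Hv' V f f_inj; have Hp V := Hp' V f f_inj.
have Hc u : {in chan_fs KName u, f =1 g} -> chan_ren (nren f) u = chan_ren (nren g) u.
  by case: u => [a|s p|x] //= H; rewrite H // inE.
have Hb Qs : {in flatten [seq proc_fs KName b.2 | b <- Qs], f =1 g} ->
  bcong (branches_ren (nren f) Qs) (branches_ren (nren g) Qs).
  elim: Qs => [|[w Q] Qs IH] /= E; constructor.
    by apply: Hp => x xQ; apply: E; rewrite mem_cat xQ.
  by apply: IH => x xQ; apply: E; rewrite mem_cat xQ orbT.
have Hs sg : {in store_fs KName sg, f =1 g} -> store_cong (store_ren (nren f) sg) (store_ren (nren g) sg).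
  elim: sg => [|[w V] sg IH] /= E; constructor.
    by apply: Hv => x xQ; apply: E; rewrite mem_cat xQ.
  by apply: IH => x xQ; apply: E; rewrite mem_cat xQ orbT.
have Hq h : {in flatten (map message_fn h), f =1 g} -> queue_cong (map (message_ren (nren f)) h) (map (message_ren (nren g)) h).
  elim: h => [|[[p q] [V|l]] h IH] /= E; constructor.
  - by apply: Hv => x xQ; apply: E; rewrite mem_cat xQ.
  - by apply: IH => x xQ; apply: E; rewrite mem_cat xQ orbT.
  - by apply: IH => x xQ; apply: E.
have Hk C : {in stack_fn C, f =1 g} -> stack_cong (map (frame_ren (nren f)) C) (map (frame_ren (nren g)) C).
  elim: C => [|c C IH] /= E; constructor; last first.
    by apply: IH => x xQ; apply: E; rewrite /stack_fn /= mem_cat xQ orbT.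
  have {}E : {in frame_fn c, f =1 g} by move=> x xc; apply: E; rewrite /stack_fn /= mem_cat xc.
  case: c E => u Ps Qs /= E; rewrite (Hc u) => [|x xu]; try by apply: E; rewrite mem_cat xu.
    by constructor; apply: Hb => x xP; apply: E; rewrite mem_cat map_cat flatten_cat mem_cat xP ?orbT.
  by constructor; apply: Hb => x xP; apply: E; rewrite mem_cat map_cat flatten_cat mem_cat xP ?orbT.
case: A => //=.
- move=> l a x T P _ E; rewrite !E ?inE ?eqxx ?orbT //; apply: ac_req; apply: Hp => y yP.
  by apply: E; rewrite !inE yP !orbT.
- move=> l a x T P _ E; rewrite !E ?inE ?eqxx ?orbT //; apply: ac_acc; apply: Hp => y yP.
  by apply: E; rewrite !inE yP !orbT.
- move=> l p C P _ E; rewrite !E ?inE ?eqxx ?orbT //; apply: ac_run.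
    by apply: Hk => y yP; apply: E; rewrite inE mem_cat yP !orbT.
  by apply: Hp => y yP; apply: E; rewrite inE mem_cat yP !orbT.
- move=> s p h T xs sg t _ E; rewrite !E ?inE ?eqxx ?orbT //.
  have ->: map (event_ren (nren f)) h = map (event_ren (nren g)) h.
    have {}E : {in flatten (map event_fn h), f =1 g}.
      by move=> y yP; apply: E; rewrite inE mem_cat yP !orbT.
    elim: h E => //= e h IH E; rewrite IH => [|x xh]; last by apply: E; rewrite mem_cat xh orbT.
    have {}E : {in event_fn e, f =1 g}.
      by move=> y yP; apply: E; rewrite mem_cat yP.
    by congr (_ :: _); case: e E => //= [k|l l1 l2] E; rewrite !E ?inE ?eqxx ?orbT.
  by apply: ac_mon; apply: Hs => y yP; apply: E; rewrite inE mem_cat yP !orbT.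
- move=> s hi ho _ E; rewrite !E ?inE ?eqxx ?orbT //; apply: ac_queue;
  by apply: Hq => y yP; apply: E; rewrite inE map_cat flatten_cat mem_cat yP !orbT.
- move=> k V u l _ E; rewrite !E ?inE ?eqxx ?orbT //.
  rewrite (Hc u) => [|y yP]; last by apply: E; rewrite !inE mem_cat yP !orbT.
  by apply: ac_mem; apply: Hv => y yP; apply: E; rewrite !inE mem_cat yP !orbT.
Qed.

Lemma fresh_nat (l : seq nat) : exists m, m \notin l.
Proof.
have le_sumn x : x \in l -> x <= sumn l.
  by elim: l => //= y l IH; rewrite inE => /orP[/eqP->|/IH]; lia.
by exists (sumn l).+1; apply/negP => /le_sumn; rewrite ltnn.
Qed.

Lemma apart_catl a b c : apart (a ++ b) c = apart a c && apart b c.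
Proof.
apply/apartP/andP => [H|[/apartP H1 /apartP H2] x]; last first.
  by rewrite mem_cat => /orP[/H1|/H2].
by split; apply/apartP => x xa xc; apply: (H x); rewrite // mem_cat xa ?orbT.
Qed.

Lemma apart_catr a b c : apart a (b ++ c) = apart a b && apart a c.
Proof. by rewrite /apart has_cat negb_or. Qed.

Lemma sub_apart a a' b b' : {subset a' <= a} -> {subset b' <= b} ->
  apart a b -> apart a' b'.
Proof. by move=> Ha Hb /apartP H; apply/apartP => x /Ha xa /Hb; apply: H. Qed.

(** * Atoms, and lists of atoms *)

(** Stands in for inversion on [acong], which its symmetry and transitivity rules make useless. *)
Definition acong_shape (A B : config) : Prop :=
  match A, B with
  | CRun l p C P, CRun l' p' C' P' => [/\ l = l', p = p', stack_cong C C' & pcong P P']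
  | CMon s p _ _ _ _ t, CMon s' p' _ _ _ _ t' => p = p' /\ t = t'
  | CQueue s hi ho, CQueue s' hi' ho' => [/\ s = s', queue_cong hi hi' & queue_cong ho ho']
  | CReq _ _ _ _ _, CReq _ _ _ _ _ | CAcc _ _ _ _ _, CAcc _ _ _ _ _
  | CMem _ _ _ _, CMem _ _ _ _ | CNil, CNil | CPar _ _, CPar _ _
  | CNew _ _, CNew _ _ => True
  | _, _ => False
  end.

Lemma acong_shapeP A B : acong A B -> acong_shape A B.
Proof.
elim=> //=.
- by case=> //= *; split; solve [done|exact: stack_cong_refl|exact: pc_refl|exact: queue_cong_refl].
- move=> M N _; destruct M, N => //=.
  + by case=> -> -> /stack_cong_sym ? /pc_sym.
  + by case=> -> ->.
  + by case=> -> /queue_cong_sym ? /queue_cong_sym.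
- move=> M1 M2 M3 _; destruct M1, M2 => //= H1 _; destruct M3 => //=; move: H1.
  + case=> -> -> H1 H2 [-> -> H3 H4]; split=> //; first exact: stack_cong_trans H1 H3.
    exact: pc_trans H2 H4.
  + by case=> -> ->.
  + case=> -> H1 H2 [-> H3 H4]; split=> //; first exact: qc_trans H1 H3.
    exact: qc_trans H2 H4.
Qed.

Lemma atom_acong A B : acong A B -> atom A = atom B.
Proof. by move/acong_shapeP; case: A; case: B. Qed.

(* The restriction of [m] can be moved inside the process of a run. *)
Definition pushable (m : nat) (A : config) : bool :=
  match A with
  | CRun l p C P => (m != l) && (m \notin stack_fn C)
  | _ => m \notin config_fn A
  end.

Definition occurs (m : nat) (A : config) : bool := m \in config_fn A.

(* [m] has to remain a restriction of the list of atoms: it is not confined to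
   the process of a single run. *)
Definition shared (m : nat) (As : seq config) : bool :=
  ~~ (all (pushable m) As && (count (occurs m) As <= 1)).

(** A name absent from the process is dropped, so that restricting it leaves no trace in a normal
    form. *)
Definition push (m : nat) (A : config) : config :=
  match A with
  | CRun l p C P => if m \in proc_fs KName P then CRun l p C (PNew m P) else A
  | _ => A
  end.

(** [absorb] and [kept] give the effect of a new restriction on the two halves of a normal form, its
    atoms and its prefix. *)
Definition absorb m As := if shared m As then As else map (push m) As.
Definition kept m As (g : seq nat) := if shared m As then m :: g else g.

Lemma pushable_acong m A B : acong A B -> pushable m A = pushable m B.
Proof.
move=> AB; have := fn_acong AB m; move/acong_shapeP: AB.
destruct A, B => //=; try by move=> _ ->.
by case=> -> _ /stack_fn_cong->.
Qed.

Lemma push_acong m A B : acong A B -> acong (push m A) (push m B).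
Proof.
move=> AB; have := acong_shapeP AB.
destruct A, B => //= -[-> -> CC PP].
have -> := proj1 (proj2 fn_cong) _ _ PP m.
by case: ifP => _; apply: ac_run => //; apply: pc_new.
Qed.

Lemma fn_push m A x : pushable m A -> x \in config_fn (push m A) = (x != m) && (x \in config_fn A).
Proof.
case: A => //=; try by (move=> *; case: (eqVneq x m) => [->|] //; apply/negP/negP).
move=> l p C P /andP[ml mC]; case: ifP => /= mP.
  rewrite !inE !mem_cat /unbind /= mem_filter /=.
  by case: (eqVneq x m) => [->|]; rewrite ?orbF //= (negPf mC) (negPf ml).
case: (eqVneq x m) => [->|] //=.
by rewrite inE mem_cat (negPf ml) (negPf mC) mP.
Qed.

Lemma push_id m A : m \notin config_fn A -> push m A = A.
Proof.
case: A => //= l p C P; rewrite inE mem_cat; case: (m \in proc_fs _ _) => //.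
by rewrite !orbT.
Qed.

Lemma pushable_fn m A : m \notin config_fn A -> pushable m A.
Proof. by case: A => //= l p C P; rewrite inE mem_cat !negb_or => /and3P[-> ->]. Qed.

Lemma push_ren (f : nat -> nat) m A : injective f ->
  push (f m) (config_ren (nren f) A) = config_ren (nren f) (push m A).
Proof.
move=> f_inj; case: A => //= l p C P; rewrite (proj2 (fs_ren _ _)); last exact: nren_inj.
by rewrite mem_map //=; case: ifP.
Qed.

Lemma pushable_ren (f : nat -> nat) m A : injective f ->
  pushable (f m) (config_ren (nren f) A) = pushable m A.
Proof.
move=> f_inj; have E := config_fn_ren A (nren_inj f_inj).
destruct A; try exact: (congr1 negb (etrans (congr1 (fun s : seq nat => f m \in s) E) (mem_map f_inj _ _))).
rewrite /= inj_eq // /stack_fn (map_flatten_eq (h := f)) ?mem_map // => e.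
by apply: (frame_fn_ren e (nren_inj f_inj)).
Qed.

Lemma occurs_ren (f : nat -> nat) m A : injective f ->
  occurs (f m) (config_ren (nren f) A) = occurs m A.
Proof.
by move=> f_inj; rewrite /occurs config_fn_ren ?mem_map //=; exact: nren_inj.
Qed.

Lemma shared_ren (f : nat -> nat) m As : injective f ->
  shared (f m) (map (config_ren (nren f)) As) = shared m As.
Proof.
move=> f_inj; rewrite /shared all_map count_map; congr (~~ (_ && (_ <= _))).
  by apply: eq_all => A /=; apply: pushable_ren.
by apply: eq_count => A /=; apply: occurs_ren.
Qed.

Lemma absorb_ren (f : nat -> nat) m As : injective f ->
  absorb (f m) (map (config_ren (nren f)) As) = map (config_ren (nren f)) (absorb m As).
Proof.
move=> f_inj; rewrite /absorb shared_ren //; case: ifP => // _.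
by rewrite -!map_comp; apply: eq_map => A /=; apply: push_ren.
Qed.

Inductive lcong : seq config -> seq config -> Prop :=
  | lc_nil : lcong [::] [::]
  | lc_skip a b l l' : acong a b -> lcong l l' -> lcong (a :: l) (b :: l')
  | lc_swap a b l : lcong (a :: b :: l) (b :: a :: l)
  | lc_trans l1 l2 l3 : lcong l1 l2 -> lcong l2 l3 -> lcong l1 l3.

Lemma lcong_refl l : lcong l l.
Proof. by elim: l => [|a l]; constructor => //; apply: ac_refl. Qed.
#[local] Hint Resolve lcong_refl ac_refl : core.

Lemma lcong_sym l l' : lcong l l' -> lcong l' l.
Proof.
elim=> [|a b s s' ab _ IH|a b s|l1 l2 l3 _ H _ H']; [by constructor| |by constructor|].
  by constructor => //; apply: ac_sym.
exact: lc_trans H' H.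
Qed.

Lemma lcong_cat l1 l1' l2 l2' : lcong l1 l1' -> lcong l2 l2' -> lcong (l1 ++ l2) (l1' ++ l2').
Proof.
move=> H1 H2; apply: (@lc_trans _ (l1 ++ l2')).
  by elim: l1 {H1} => //= a l1 IH; constructor.
elim: H1 => //= [a b s s' ab _ IH|a b s|l3 l4 l5 _ H _ H'].
- by constructor.
- exact: lc_swap.
- exact: lc_trans H H'.
Qed.

Lemma lcong_mid x l1 l2 : lcong (x :: l1 ++ l2) (l1 ++ x :: l2).
Proof.
elim: l1 => //= a l1 IH; apply: lc_trans (lc_swap _ _ _) _.
by constructor.
Qed.

Lemma lcong_catC l1 l2 : lcong (l1 ++ l2) (l2 ++ l1).
Proof.
elim: l1 => /= [|a l1 IH]; first by rewrite cats0.
apply: lc_trans (lcong_mid _ _ _).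
by constructor.
Qed.

Lemma lcong_map (f : config -> config) l l' :
  (forall A B, acong A B -> acong (f A) (f B)) -> lcong l l' -> lcong (map f l) (map f l').
Proof.
move=> Hf; elim=> //= [a b s s' ab _ IH|a b s|l3 l4 l5 _ H _ H'].
- by constructor => //; apply: Hf.
- exact: lc_swap.
- exact: lc_trans H H'.
Qed.

Lemma lcong_all (f : config -> bool) l l' :
  (forall A B, acong A B -> f A = f B) -> lcong l l' -> all f l = all f l'.
Proof.
move=> Hf; elim=> //= [a b s s' /Hf-> _ -> //|a b s|l3 l4 l5 _ -> _ -> //].
by case: (f a); case: (f b).
Qed.

Lemma lcong_sumn (f : config -> nat) l l' :
  (forall A B, acong A B -> f A = f B) -> lcong l l' -> sumn (map f l) = sumn (map f l').
Proof.
move=> Hf; elim=> //= [a b s s' /Hf-> _ -> //|a b s|l3 l4 l5 _ -> _ -> //].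
by lia.
Qed.

Definition fns (As : seq config) : seq nat := flatten (map config_fn As).

Lemma fns_cons A As : fns (A :: As) = config_fn A ++ fns As.
Proof. by []. Qed.

Lemma fns_cat As Bs : fns (As ++ Bs) = fns As ++ fns Bs.
Proof. by rewrite /fns map_cat flatten_cat. Qed.

Lemma lcong_fns l l' : lcong l l' -> fns l =i fns l'.
Proof.
rewrite /fns; elim=> //= [a b s s' /fn_acong E _ F|a b s x|l3 l4 l5 _ E _ F x].
- exact: eq_mem_cat.
- by rewrite !mem_cat orbCA.
- by rewrite E F.
Qed.

Lemma lcong_shared m l l' : lcong l l' -> shared m l = shared m l'.
Proof.
move=> ll; rewrite /shared (lcong_all _ ll) => [|A B]; last exact: pushable_acong.
rewrite -!sumn_count (lcong_sumn _ ll) // => A B /fn_acong E.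
by rewrite /occurs E.
Qed.

Lemma lcong_absorb m l l' : lcong l l' -> lcong (absorb m l) (absorb m l').
Proof.
move=> ll; rewrite /absorb -(lcong_shared m ll); case: ifP => // _.
by apply: lcong_map => // A B; apply: push_acong.
Qed.

Lemma lcong_ren (f : nat -> nat) l l' : injective f -> lcong l l' ->
  lcong (map (config_ren (nren f)) l) (map (config_ren (nren f)) l').
Proof. by move=> f_inj; apply: lcong_map => A B; apply: acong_ren; apply: nren_inj. Qed.

Lemma lcong_size l l' : lcong l l' -> size l = size l'.
Proof. by elim=> //= [a b s s' _ _ ->|l1 l2 l3 _ -> _ ->]. Qed.

Lemma lcong_nil l : lcong [::] l -> l = [::].
Proof. by move/lcong_size => /esym/size0nil. Qed.

Lemma lcong1 A l : lcong [:: A] l -> exists2 B, l = [:: B] & acong A B.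
Proof.
move E: [:: A] => l0 H; elim: H A E => //.
- by move=> a b s s' ab H _ A [-> E]; subst s; rewrite (lcong_nil H); exists b.
- move=> l1 l2 l3 _ IH1 _ IH2 A /IH1[B E AB].
  by have [C -> BC] := IH2 _ (esym E); exists C => //; apply: ac_trans AB BC.
Qed.

(** Transitivity moves the head elsewhere, so the induction follows an element at an arbitrary
    position. *)
Lemma lcong_cons x l l' : lcong (x :: l) l' ->
  exists y l1 l2, [/\ l' = l1 ++ y :: l2, acong x y & lcong l (l1 ++ l2)].
Proof.
suff H l0 : lcong l0 l' -> forall s1 x s2, l0 = s1 ++ x :: s2 ->
    exists y l1 l2, [/\ l' = l1 ++ y :: l2, acong x y & lcong (s1 ++ s2) (l1 ++ l2)].
  by move=> /H /(_ [::] x l erefl).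
elim=> [[] //|a b s s' ab ss IH|a b s|l1 l2 l3 _ IH1 _ IH2].
- case=> [|c s1] z s2 [? E]; subst; first by exists b, [::], s'.
  have [y [l1 [l2 [-> zy H]]]] := IH _ _ _ erefl.
  by exists y, (b :: l1), l2; split=> //; constructor.
- case=> [|c [|d s1]] z s2 /=.
  + by case=> <- <-; exists a, [:: b], s; split.
  + by case=> <- <- <-; exists b, [::], (a :: s); split.
  + case=> <- <- ->; exists z, [:: b, a & s1], s2; split=> //.
    exact: lc_swap.
- move=> s1 z s2 /IH1 [y [t1 [t2 [/IH2 [y' [u1 [u2 [-> zy H]]]] zy' H']]]].
  by exists y', u1, u2; split=> //; [apply: ac_trans zy' zy|apply: lc_trans H' H].
Qed.

Lemma fns_push m As : all (pushable m) As ->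
  forall x, (x \in fns (map (push m) As)) = (x != m) && (x \in fns As).
Proof.
rewrite /fns; elim: As => [|A As IH] /=; first by move=> _ x; rewrite andbF.
by move=> /andP[pA /IH E] x; rewrite !mem_cat E fn_push // andb_orr.
Qed.

Lemma sharedN m As : shared m As = false -> all (pushable m) As /\ count (occurs m) As <= 1.
Proof. by rewrite /shared => /negbFE /andP. Qed.

Lemma fns_absorb m As x : (x \in fns (absorb m As)) = (x \in fns As) && ((x != m) || shared m As).
Proof.
rewrite /absorb; case: ifP => H; first by rewrite orbT andbT.
by rewrite fns_push ?orbF 1?andbC //; case: (sharedN H).
Qed.

(** Scope extrusion at the level of lists of atoms: atoms without [m] influence neither where it
    goes nor whether it is shared. *)
Lemma absorb_catl m As Bs : m \notin fns As -> absorb m (As ++ Bs) = As ++ absorb m Bs /\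
  shared m (As ++ Bs) = shared m Bs.
Proof.
move=> mA.
have H : all (pushable m) As && (count (occurs m) As == 0) /\ map (push m) As = As.
  elim: As mA => //= A As IH; rewrite fns_cons mem_cat negb_or => /andP[mA /IH [/andP[-> /eqP->]] ->].
  by rewrite pushable_fn //= addn0 /occurs (negPf mA) push_id.
case: H => /andP[H1 /eqP H2] H3.
have E : shared m (As ++ Bs) = shared m Bs by rewrite /shared all_cat count_cat H1 H2.
by rewrite /absorb E; case: ifP => // _; rewrite map_cat H3.
Qed.

Lemma occurs_push m k A : k != m -> pushable m A -> occurs k (push m A) = occurs k A.
Proof. by move=> km pA; rewrite /occurs fn_push // km. Qed.

Lemma pushable_push m k A : k != m -> pushable m A -> pushable k (push m A) = pushable k A.
Proof.
by move=> km; case: A => //= l p C P _; case: ifP.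
Qed.

Lemma shared_absorb m k As : k != m -> shared k (absorb m As) = shared k As.
Proof.
move=> km; rewrite /absorb; case: ifP => // /sharedN[pA _].
rewrite /shared all_map count_map; congr (~~ (_ && (_ <= _))).
  by elim: As pA => //= A As IH /andP[? /IH->]; rewrite pushable_push.
by elim: As pA => //= A As IH /andP[? /IH->]; rewrite occurs_push.
Qed.

Lemma lcong_map2 (f g : config -> config) l :
  (forall A, acong (f A) (g A)) -> lcong (map f l) (map g l).
Proof. by move=> H; elim: l => //= a l; constructor. Qed.

(** By [shared_absorb], pushing one name does not affect whether the other is shared. Both may enter
    the same process in either order, and [pc_newC] identifies the results; hence [lcong] and not
    equality. *)
Lemma absorbC m k As : k != m -> lcong (absorb k (absorb m As)) (absorb m (absorb k As)).
Proof.
move=> km; rewrite {1 3}/absorb !shared_absorb // 1?eq_sym // /absorb.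
case: ifP => // _; case: ifP => // _; rewrite -!map_comp; apply: lcong_map2 => A /=.
case: A => //= l p C P; case: ifP => mP; case: ifP => kP /=;
  rewrite ?mP ?kP /unbind /= ?mem_filter /= ?mP ?kP ?km 1?eq_sym ?km //=.
by apply: ac_run; [apply: stack_cong_refl|apply: pc_newC].
Qed.

(** * Prefixes of restrictions, and parallel compositions of lists *)

Definition news (gs : seq nat) (M : config) : config := foldr CNew M gs.
Definition pnews (gs : seq nat) (P : proc) : proc := foldr PNew P gs.

Lemma news_cong gs M N : cong M N -> cong (news gs M) (news gs N).
Proof. by move=> MN; elim: gs => //= g gs; apply: c_new. Qed.

Lemma news_cat gs hs M : news (gs ++ hs) M = news gs (news hs M).
Proof. by rewrite /news foldr_cat. Qed.

Lemma news_new n gs M : cong (CNew n (news gs M)) (news gs (CNew n M)).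
Proof.
elim: gs => [|g gs IH] /=; first exact: c_refl.
by apply: c_trans (c_newC _ _ _) _; apply: c_new.
Qed.

Lemma news_perm gs hs M : perm_eq gs hs -> cong (news gs M) (news hs M).
Proof.
elim: gs hs => [|g gs IH] hs.
  by rewrite perm_sym => /perm_nilP ->; apply: c_refl.
move=> E; have gh : g \in hs by rewrite -(perm_mem E) inE eqxx.
case/splitPr: gh E => h1 h2 E; rewrite news_cat /=.
have /IH H : perm_eq gs (h1 ++ h2).
  by rewrite -(perm_cons g); apply: perm_trans E _; rewrite -cat1s perm_catCA.
apply: c_trans (c_new _ H) _; rewrite news_cat.
exact: news_new.
Qed.

Lemma fn_news gs M x : (x \in config_fn (news gs M)) = (x \notin gs) && (x \in config_fn M).
Proof.
elim: gs => //= g gs IH; rewrite mem_filter /= IH inE negb_or andbA //.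
Qed.

Lemma news_par gs M N : apart gs (config_fn N) -> cong (CPar (news gs M) N) (news gs (CPar M N)).
Proof.
elim: gs => [|g gs IH] /= H; first exact: c_refl.
have {H}[gN gsN] : g \notin config_fn N /\ apart gs (config_fn N).
  by move: H; rewrite -cat1s apart_catl => /andP[/apartP H ->]; split=> //; apply/negP => /H; apply; rewrite inE.
apply: c_trans (c_parC _ _) _; apply: c_trans (c_new_par _ gN) _.
apply: c_new; apply: c_trans (c_parC _ _) _; exact: IH.
Qed.

(** Not a rule of [pcong]: [P] is seen as [P] in parallel with [PNil], the restriction is narrowed
    to [PNil], and vanishes there. *)
Lemma pnew_drop n P : n \notin proc_fs KName P -> pcong (PNew n P) P.
Proof.
move=> nM; apply: pc_trans (pc_new _ (pc_sym (pc_par0 _))) _.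
apply: pc_trans (pc_sym (pc_new_par _ nM)) _.
by apply: pc_trans (pc_par (pc_refl _) (pc_new0 _)) (pc_par0 _).
Qed.

Lemma cren_id M : config_ren (nren id) M = M.
Proof. by rewrite nren_id config_ren_id. Qed.

Lemma cren_comp f g M : config_ren (nren f) (config_ren (nren g) M) = config_ren (nren (f \o g)) M.
Proof. by rewrite config_ren_comp nren_comp. Qed.

Lemma tr_id n : tr n n = id.
Proof. by apply: functional_extensionality => c; rewrite /tr; case: eqP. Qed.

Lemma cren_trK a b M : config_ren (nren (tr a b)) (config_ren (nren (tr a b)) M) = M.
Proof.
rewrite cren_comp (_ : _ \o _ = id) ?cren_id //.
by apply: functional_extensionality => c /=; rewrite trK.
Qed.

Lemma map_cren_trK a b l : map (config_ren (nren (tr a b))) (map (config_ren (nren (tr a b))) l) = l.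
Proof. by rewrite mapK // => M; apply: cren_trK. Qed.

Lemma map_trK a b l : map (tr a b) (map (tr a b) l) = l.
Proof. by rewrite mapK //; apply: trK. Qed.

Lemma cnew_alpha n m M : m \notin config_fn (CNew n M) ->
  cong (CNew n M) (CNew m (config_ren (nren (tr n m)) M)).
Proof.
move=> H; case: (eqVneq m n) => [->|mn]; first by rewrite tr_id cren_id; apply: c_refl.
by rewrite -swapE; apply: c_alpha; move: H; rewrite /= mem_filter /= mn.
Qed.

Lemma run_news gs l p C P : apart gs (l :: stack_fn C) ->
  cong (news gs (CRun l p C P)) (CRun l p C (pnews gs P)).
Proof.
elim: gs => [|g gs IH] /=; first by move=> _; apply: c_refl.
rewrite -cat1s apart_catl => /andP[/apartP H /IH E].
apply: c_trans (c_new _ E) _; apply: c_sym; apply: c_run_new.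
  by apply/eqP => gl; apply: (H g); rewrite !inE gl eqxx.
by apply/negP => gC; apply: (H g); rewrite inE ?gC ?eqxx ?orbT.
Qed.

Lemma pars_cat l1 l2 : cong (pars (l1 ++ l2)) (CPar (pars l1) (pars l2)).
Proof.
elim: l1 => [|a l1 IH] /=.
  by apply: c_trans (c_sym (c_par0 _)) (c_parC _ _).
by apply: c_trans (c_par (c_refl _) IH) (c_parA _ _ _).
Qed.

Lemma lcong_pars l l' : lcong l l' -> cong (pars l) (pars l').
Proof.
elim=> /= [|a b s s' /acong_cong ab _ IH|a b s|l3 l4 l5 _ H _ H'].
- exact: c_refl.
- exact: c_par.
- apply: c_trans (c_parA _ _ _) _; apply: c_trans (c_par (c_parC _ _) (c_refl _)) _.
  exact/c_sym/c_parA.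
- exact: c_trans H H'.
Qed.

Lemma fn_pars l : config_fn (pars l) = fns l.
Proof. by elim: l => //= a l ->. Qed.

(** At most one atom contains [m]. Being pushable, it is a run with [m] in its process only, so
    [c_run_new] applies once the restriction has been narrowed past the other atoms. *)
Lemma absorb_pars m As : shared m As = false -> cong (CNew m (pars As)) (pars (absorb m As)).
Proof.
rewrite /absorb => S; rewrite S; case/sharedN: S.
elim: As => [|A As IH] /=; first by move=> _ _; apply: c_new0.
case/andP=> pA pAs; case mA: (occurs m A) => /= cnt; last first.
  rewrite push_id; last exact/negbT.
  apply: c_trans (c_sym (c_new_par _ (negbT mA))) _.
  by apply: c_par; [apply: c_refl|apply: IH].
have mAs : m \notin fns As.
  have: count (occurs m) As = 0 by lia.
  elim: {IH pAs cnt} As => //= B As IH; case mB: (occurs m B) => //= /IH.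
  by rewrite fns_cons mem_cat negb_or => ->; rewrite andbT; apply/negbT.
have ->: map (push m) As = As.
  elim: As mAs {IH pAs cnt} => //= B As IH; rewrite fns_cons mem_cat negb_or => /andP[mB /IH->].
  by rewrite push_id.
have mp : m \notin config_fn (pars As) by rewrite fn_pars.
apply: c_trans (c_new _ (c_parC _ _)) _; apply: c_trans (c_sym (c_new_par _ mp)) _.
apply: c_trans (c_parC _ _) _; apply: c_par; last exact: c_refl.
move: mA pA; rewrite /occurs; case: A => //=; try by move=> * ; exfalso; apply/negP; eassumption.
all: try by move=> > ->.
move=> l p C P H /andP[ml mC]; move: H; rewrite inE mem_cat (negPf ml) (negPf mC) /= => ->.
by apply/c_sym/c_run_new.
Qed.

(** * Normal forms *)

(* [NF K gs As]: K is [news gs (pars As)], each name of [gs] being shared.  A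
   restricted name occurring in the process of one run only is always moved
   inside it: processes extrude restrictions without bound, through recursion,
   so that moving names out would not lead to a normal form. *)
Inductive NF : config -> seq nat -> seq config -> Prop :=
  | nf_nil : NF CNil [::] [::]
  | nf_atom A A' : atom A -> acong A A' -> NF A [::] [:: A']
  | nf_par M N g1 A1 g2 A2 gs As :
      NF M g1 A1 -> NF N g2 A2 -> uniq (g1 ++ g2) ->
      apart (g1 ++ g2) (config_fn M ++ config_fn N) ->
      perm_eq (g1 ++ g2) gs -> lcong (A1 ++ A2) As -> NF (CPar M N) gs As
  | nf_new n m M g A gs As :
      NF (config_ren (nren (tr n m)) M) g A ->
      m \notin config_fn (CNew n M) -> m \notin g ->
      perm_eq (kept m A g) gs -> lcong (absorb m A) As -> NF (CNew n M) gs As.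

Lemma nf_conv K gs As gs' As' : NF K gs As -> perm_eq gs gs' -> lcong As As' -> NF K gs' As'.
Proof.
move=> H; elim: H gs' As' => [|A A' aA AA'|M N g1 A1 g2 A2 g0 A0 H1 _ H2 _ U ap E F|n m M g A g0 A0 H _ mM mg E F] gs' As'.
- by rewrite perm_sym => /perm_nilP-> /lcong_nil->; constructor.
- rewrite perm_sym => /perm_nilP-> /lcong1[B -> A'B].
  by constructor => //; apply: ac_trans AA' A'B.
- move=> E' F'; apply: (nf_par H1 H2) => //; first exact: perm_trans E E'.
  exact: lc_trans F F'.
- move=> E' F'; apply: (nf_new H) => //; first exact: perm_trans E E'.
  exact: lc_trans F F'.
Qed.

Lemma fn_cren_tr n m M : config_fn (config_ren (nren (tr n m)) M) = map (tr n m) (config_fn M).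
Proof. by rewrite config_fn_ren //; apply: nren_inj. Qed.

Lemma mem_fn_tr n m M x : (x \in config_fn (config_ren (nren (tr n m)) M)) = (tr n m x \in config_fn M).
Proof. by rewrite fn_cren_tr mem_map_inv //; apply: trK. Qed.

Lemma fn_new_body n m M x : m \notin config_fn (CNew n M) -> x != m ->
  (x \in config_fn (config_ren (nren (tr n m)) M)) = (x \in config_fn (CNew n M)).
Proof.
rewrite mem_fn_tr /= !mem_filter /= => mM xm.
case: (eqVneq x n) => [xn|xn] /=; last by rewrite trN.
subst x; rewrite trL; move: mM; rewrite eq_sym xm /=; exact: negPf.
Qed.

Lemma nf_fn K gs As : NF K gs As ->
  [/\ uniq gs, apart gs (config_fn K) & {subset fns As <= config_fn K ++ gs}].
Proof.
elim=> [|A A' aA AA'|M N g1 A1 g2 A2 g0 A0 H1 [U1 P1 S1] H2 [U2 P2 S2] U ap E F|n m M g A g0 A0 H [U P S] mM mg E F].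
- by split.
- split=> //; first exact/apartP.
  by move=> x; rewrite /fns /= cats0 cats0 (fn_acong AA').
- split.
  + by rewrite -(perm_uniq E).
  + by apply: sub_apart ap => // x; rewrite (perm_mem E).
  + move=> x; rewrite -(lcong_fns F) fns_cat mem_cat.
    rewrite (mem_cat x (config_fn _)) -(perm_mem E) /= !mem_cat.
    by case/orP => [/S1|/S2]; rewrite mem_cat => /orP[]->; rewrite ?orbT.
- have Sg x : x \in g -> x \notin config_fn (CNew n M).
    move=> xg; have xm : x != m by apply: contraNneq mg => <-.
    by rewrite -(fn_new_body mM xm); apply/negP; move/apartP: P; apply.
  split.
  + rewrite -(perm_uniq E) /kept; case: ifP => //= _.
    by rewrite mg.
  + apply/apartP => x; rewrite -(perm_mem E) /kept; case: ifP => _.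
      by rewrite inE => /orP[/eqP->|/Sg/negP //]; apply/negP.
    by move/Sg/negP.
  + move=> x; rewrite -(lcong_fns F) fns_absorb => /andP[/S xA xm].
    rewrite mem_cat -(perm_mem E) /kept.
    case: (eqVneq x m) xm xA => [->|xm] /=; first by move=> ->; rewrite inE eqxx orbT.
    move=> _; rewrite mem_cat fn_new_body // => /orP[->//|xg].
    by case: ifP; rewrite ?inE xg !orbT.
Qed.

Lemma nf_atoms K gs As : NF K gs As -> all atom As.
Proof.
have Hl l l' : lcong l l' -> all atom l = all atom l' by apply: lcong_all; apply: atom_acong.
elim=> [//|A A' aA AA'|M N g1 A1 g2 A2 g0 A0 _ H1 _ H2 U ap E F|n m M g A g0 A0 _ H mM mg E F].
- by rewrite /= -(atom_acong AA') aA.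
- by rewrite -(Hl _ _ F) all_cat H1.
- rewrite -(Hl _ _ F) /absorb; case: ifP => // _; rewrite all_map.
  by apply: sub_all H => B /=; case: B => //= *; case: ifP.
Qed.

(** [g] renames the chosen names of the prefix as well, whereas [f] is constrained on the free names
    of [K] only. The names bound in [K] are thus irrelevant to its normal forms. *)
Lemma nf_alpha K gs As : NF K gs As -> forall f g : nat -> nat, injective f -> injective g ->
  {in config_fn K, f =1 g} ->
  NF (config_ren (nren f) K) (map g gs) (map (config_ren (nren g)) As).
Proof.
elim=> [|A A' aA AA'|M N g1 A1 g2 A2 g0 A0 H1 IH1 H2 IH2 U ap E F|n m M g A g0 A0 H IH mM mg E F] f h f_inj h_inj fh.
- by constructor.
- apply: nf_atom; first by case: A aA {AA' fh}.
  apply: ac_trans (acong_ren (nren_inj h_inj) AA').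
  exact: atom_alpha.
- have fM : config_fn (config_ren (nren f) M) = map h (config_fn M).
    rewrite config_fn_ren /=; last exact: nren_inj.
    by apply/eq_in_map => x xM; apply: fh; rewrite /= mem_cat xM.
  have fN : config_fn (config_ren (nren f) N) = map h (config_fn N).
    rewrite config_fn_ren /=; last exact: nren_inj.
    by apply/eq_in_map => x xM; apply: fh; rewrite /= mem_cat xM orbT.
  apply: (nf_par (IH1 f h f_inj h_inj _) (IH2 f h f_inj h_inj _)).
  + by move=> x xM; apply: fh; rewrite /= mem_cat xM.
  + by move=> x xM; apply: fh; rewrite /= mem_cat xM orbT.
  + by rewrite -map_cat map_inj_uniq.
  + by rewrite fM fN -!map_cat apart_map.
  + by rewrite -map_cat; apply: perm_map.
  + by rewrite -map_cat; apply: lcong_ren.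
- have fh' x : x \in config_fn M -> x != n -> f x = h x.
    by move=> xM xn; apply: fh; rewrite /= mem_filter /= xn.
  (* Chosen so that [f' \o tr n m = tr (f n) (h m) \o f], the renaming under which [nf_new] opens
     the restriction of [f n] with the new choice [h m]. *)
  pose f' := tr (f n) (h m) \o f \o tr n m.
  have f'_inj : injective f' by apply: inj_comp => //; apply: inj_comp.
  have := IH f' h f'_inj h_inj.
  rewrite cren_comp (_ : f' \o tr n m = tr (f n) (h m) \o f); last first.
    by apply: functional_extensionality => x; rewrite /f' /= trK.
  rewrite -cren_comp => IH'.
  have nin x : x \in config_fn M -> x != n -> x != m.
    move=> xM xn; apply: contraNneq mM => <-; by rewrite /= mem_filter /= xn.
  apply: (nf_new (IH' _)).
  + move=> x; rewrite mem_fn_tr /f' /= => xM.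
    case: (eqVneq (tr n m x) n) => [xn|xn].
      rewrite xn trL; congr h; by rewrite -[x](trK n m) xn trL.
    have xm := nin _ xM xn.
    have E1 : tr n m x = x by rewrite -[RHS](trK n m) (trN xn xm).
    rewrite E1 in xM xn xm *.
    rewrite trN; first exact: fh'.
      by rewrite (inj_eq f_inj).
    by rewrite fh' // inj_eq.
  + rewrite -/(config_ren _ (CNew n M)) config_fn_ren; last exact: nren_inj.
    apply/negP => /mapP[x xM /= E']; have := fh _ xM; rewrite -E' => /h_inj E''.
    by move: mM; rewrite E'' xM.
  + by rewrite mem_map.
  + rewrite /kept shared_ren //; move: E; rewrite /kept; case: ifP => _ E //.
      by rewrite -map_cons; apply: perm_map.
    by apply: perm_map.
  + by rewrite absorb_ren //; apply: lcong_ren.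
Qed.

Lemma nf_agree (a a' b : nat -> nat) M gs As : cancel a a' -> cancel a' a -> injective b ->
  {in config_fn M, a =1 b} -> NF (config_ren (nren a) M) gs As -> NF (config_ren (nren b) M) gs As.
Proof.
move=> aK a'K b_inj ab /nf_alpha /(_ (b \o a') id).
rewrite map_id cren_comp (_ : (b \o a') \o a = b); last first.
  by apply: functional_extensionality => x /=; rewrite aK.
rewrite (_ : map _ As = As); last first.
  by rewrite -[RHS]map_id; apply: eq_map => A; apply: cren_id.
apply=> //; first by apply: inj_comp => //; apply: can_inj a'K.
move=> x; rewrite config_fn_ren; last by apply: nren_inj; apply: can_inj aK.
by move=> /mapP[y yM ->] /=; rewrite aK ab.
Qed.

Lemma nf_tr_fresh n m M gs As : n \notin config_fn M -> m \notin config_fn M ->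
  NF (config_ren (nren (tr n m)) M) gs As <-> NF M gs As.
Proof.
move=> nM mM; have E : {in config_fn M, tr n m =1 id}.
  move=> x xM; rewrite trN //; first by apply: contraNneq nM => <-.
  by apply: contraNneq mM => <-.
rewrite -{2}[M]cren_id; split; apply: nf_agree => //.
- exact: trK. - exact: trK. - by move=> x /E.
Qed.

(** * Inversion of normal forms, and their invariance under congruence *)

Lemma nf_nilP gs As : NF CNil gs As -> gs = [::] /\ As = [::].
Proof. by move=> H; inversion H. Qed.

Lemma nf_atomP A gs As : atom A -> NF A gs As -> gs = [::] /\ exists2 A', As = [:: A'] & acong A A'.
Proof. by move=> aA H; inversion H; subst => //; split=> //; exists A'. Qed.

Lemma nf_parP M N gs As : NF (CPar M N) gs As -> exists g1 A1 g2 A2,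
  [/\ NF M g1 A1, NF N g2 A2 & [/\ uniq (g1 ++ g2), apart (g1 ++ g2) (config_fn M ++ config_fn N),
      perm_eq (g1 ++ g2) gs & lcong (A1 ++ A2) As]].
Proof. by move=> H; inversion H; subst => //; exists g1, A1, g2, A2. Qed.

(** If the restriction is not kept, [m] has disappeared from the normal form and can be chosen anew,
    off any list [L]. If it is kept, [m] is in [gs], and its freshness follows from that of the
    prefix. *)
Lemma nf_newP n M gs As (L : seq nat) : NF (CNew n M) gs As -> exists m g A,
  [/\ NF (config_ren (nren (tr n m)) M) g A, m \notin config_fn (CNew n M), m \notin g &
   [/\ perm_eq (kept m A g) gs, lcong (absorb m A) As & m \in gs \/ m \notin L]].
Proof.
have H0 : NF (CNew n M) gs As -> exists m g A,
    [/\ NF (config_ren (nren (tr n m)) M) g A, m \notin config_fn (CNew n M), m \notin g,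
        perm_eq (kept m A g) gs & lcong (absorb m A) As].
  by move=> H; inversion H; subst => //; exists m, g, A.
move=> /H0 [m [g [A [H1 mM mg E F]]]].
case S: (shared m A).
  exists m, g, A; split=> //; split=> //; left.
  by rewrite -(perm_mem E) /kept S inE eqxx.
have [m'] := fresh_nat (L ++ g ++ config_fn (CNew n M) ++ fns As ++ [:: n; m] ++ config_fn M).
rewrite !mem_cat !inE !negb_or => /and3P[m'L m'g /and4P[m'M m'As /andP[m'n m'm] m'M']].
have [U P Sb] := nf_fn H1.
have H2 : NF (config_ren (nren (tr n m')) M) g (map (config_ren (nren (tr m m'))) A).
  have := nf_alpha H1 (f := tr n m' \o tr n m) (g := tr m m').
  rewrite cren_comp (_ : (_ \o tr n m) \o tr n m = tr n m'); last first.
    by apply: functional_extensionality => x /=; rewrite trK.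
  have ->: map (tr m m') g = g.
    rewrite -[RHS]map_id; apply/eq_in_map => x xg.
    by rewrite trN //; [apply: contraNneq mg => <-|apply: contraNneq m'g => <-].
  apply => //; first by apply: inj_comp.
  move=> x /= xM; case: (eqVneq x m) xM => [->|xm]; first by rewrite trR !trL.
  rewrite fn_new_body // /= mem_filter /= => /andP[xn xM].
  have xm' : x != m' by apply: contraNneq m'M' => <-.
  by rewrite (trN xn xm) !trN.
exists m', g, (map (config_ren (nren (tr m m'))) A); split=> //.
have Sm' : shared m' (map (config_ren (nren (tr m m'))) A) = false.
  by rewrite -{1}(trL m m') shared_ren.
split; last by right.
- by move: E; rewrite /kept S Sm'.
(* Neither [m] nor [m'] is free in the absorbed atoms, so exchanging them is an alpha-conversion of
   each atom. *)
- rewrite -{1}(trL m m') absorb_ren //; apply: lc_trans (F).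
  rewrite -[X in lcong _ X]map_id.
  have: all atom (absorb m A).
    rewrite /absorb S all_map; apply: sub_all (nf_atoms H1) => B /=.
    by case: B => //= *; case: ifP.
  have: m \notin fns (absorb m A) by rewrite fns_absorb S eqxx andbF.
  have: m' \notin fns (absorb m A) by rewrite (lcong_fns F).
  elim: (absorb m A) => //= B As' IH; rewrite !fns_cons !mem_cat !negb_or.
  move=> /andP[m'B /IH{}IH] /andP[mB /IH{}IH] /andP[aB /IH{}IH].
  constructor=> //; rewrite -{2}[B]cren_id; apply: atom_alpha => // x xB.
  by rewrite trN //; [apply: contraNneq mB => <-|apply: contraNneq m'B => <-].
Qed.

Lemma perm_kept m As g g' : perm_eq g g' -> perm_eq (kept m As g) (kept m As g').
Proof. by rewrite /kept; case: ifP => // _; rewrite perm_cons. Qed.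

Lemma lcong_kept m As As' g : lcong As As' -> kept m As g = kept m As' g.
Proof. by move=> /(lcong_shared m); rewrite /kept => ->. Qed.

Lemma kept_mem m As g x : x \in kept m As g -> x \in g \/ x = m.
Proof. by rewrite /kept; case: ifP; rewrite ?inE => _; [case/orP=> [/eqP|]|]; auto. Qed.

(** The two orders of opening the restrictions, with the same choices [m1] for [n] and [m2] for [k],
    give renamings that agree on the free names of [M]. *)
Lemma nf_newC n k M gs As : NF (CNew n (CNew k M)) gs As -> NF (CNew k (CNew n M)) gs As.
Proof.
case: (eqVneq n k) => [->//|nk].
move=> H0; have [m1 [g1 [A1 [/= H1 m1M m1g [E1 F1 _]]]]] := nf_newP [::] H0.
have [m2 [g2 [A2 [H2 m2M m2g [E2 F2 m2L]]]]] := nf_newP [:: m1] H1.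
have m12 : m1 != m2.
  case: m2L => [m2g1|]; first by apply: contraNneq m1g => ->.
  by rewrite inE eq_sym.
(* A fresh choice may coincide with the other bound name: [k'] differs from [k] when [m1 = k], and
   [n'] from [n] when [m2 = n]. *)
pose k' := tr n m1 k.
pose n' := tr k m2 n.
move: H2; rewrite cren_comp => H2.
have memM x : x \in config_fn M -> x != n -> x != k -> x != m1 /\ x != m2.
  move=> xM xn xk; have xm1 : x != m1.
    apply: contraNneq m1M => <-; by rewrite /= !mem_filter /= xn xk.
  split=> //; apply: contraNneq m2M => <-; rewrite /= mem_filter /= mem_fn_tr (trN xn xm1).
  rewrite xM andbT; apply: contraNneq xk => E.
  by rewrite -(inj_eq (@tr_inj n m1)) (trN xn xm1); apply/eqP.
have H3 : NF (config_ren (nren (tr n' m1)) (config_ren (nren (tr k m2)) M)) g2 A2.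
  rewrite cren_comp; apply: (nf_agree (a := tr k' m2 \o tr n m1) (a' := tr n m1 \o tr k' m2)) H2.
  - by move=> x /=; rewrite !trK.
  - by move=> x /=; rewrite !trK.
  - exact: inj_comp.
  - have m1k' : m1 != k' by rewrite /k' -{1}(trL n m1) (inj_eq (@tr_inj n m1)).
    have m2n' : m2 != n' by rewrite /n' -{1}(trL k m2) (inj_eq (@tr_inj k m2)) eq_sym.
    move=> x xM /=; case: (eqVneq x n) => [->|xn].
      by rewrite (trL n m1) -/n' (trL n' m1) trN.
    case: (eqVneq x k) => [->|xk].
      by rewrite (trL k m2) -/k' (trL k' m2) trN // eq_sym.
    have [xm1 xm2] := memM _ xM xn xk.
    have xk' : x != k' by rewrite /k' /tr; do 2 case: ifP => // _.
    have xn' : x != n' by rewrite /n' /tr; do 2 case: ifP => // _.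
    by rewrite (trN xn xm1) (trN xk xm2) (trN xk' xm2) (trN xn' xm1).
have m2M' : m2 \notin config_fn (CNew k (CNew n M)).
  rewrite /= !mem_filter /=; apply/negP => /and3P[m2k m2n] m2M'.
  by have [_ /eqP] := memM _ m2M' m2n m2k.
have m1M' : m1 \notin config_fn (CNew n' (config_ren (nren (tr k m2)) M)).
  rewrite /= mem_filter /= mem_fn_tr; apply/negP => /andP[m1n' H].
  have Hn : tr k m2 m1 != n by rewrite -(inj_eq (@tr_inj k m2)) trK.
  case: (eqVneq (tr k m2 m1) k) => [E|Hk].
    by move: m12; rewrite -(inj_eq (@tr_inj k m2)) trR E eqxx.
  have [E1' E2'] := memM _ H Hn Hk.
  by move: E1'; rewrite -{1}(trN Hk E2') trK eqxx.
have m1g2 : m1 \notin g2.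
  apply: contra m1g => m1g2; rewrite -(perm_mem E2) /kept; case: ifP => //.
  by rewrite inE m1g2 orbT.
have H4 : NF (config_ren (nren (tr k m2)) (CNew n M)) (kept m1 A2 g2) (absorb m1 A2).
  by apply: nf_new H3 _ _ _ _.
apply: nf_new H4 m2M' _ _ _.
- by apply/negP => /kept_mem[]; [apply/negP|apply/eqP; rewrite eq_sym].
- apply: perm_trans E1; apply: perm_trans (perm_kept _ _ E2).
  rewrite -(lcong_kept _ _ F2) /kept !shared_absorb //; last by rewrite eq_sym.
  case: ifP => _; case: ifP => _ //.
  by rewrite -cat1s -[m1 :: m2 :: g2]cat1s -[m1 :: g2]cat1s -[m2 :: g2]cat1s perm_catCA.
- apply: lc_trans F1; apply: lc_trans (lcong_absorb m1 F2).
  by apply: absorbC; rewrite eq_sym.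
Qed.

(** In both directions [m] is not free in the atoms of [M], so by [absorb_catl] absorption only
    concerns the atoms of [N]. *)
Lemma nf_new_par n M N gs As : n \notin config_fn M ->
  NF (CPar M (CNew n N)) gs As <-> NF (CNew n (CPar M N)) gs As.
Proof.
move=> nM; split.
- case/nf_parP => g1 [A1 [g2 [A2 [H1 H2 [U ap E F]]]]].
  (* [m] has to avoid [M] and [g1]: a kept [m] does so by the side conditions of [nf_par], an
     absorbed one by choice. *)
  have [m [g [A [H3 mN mg [E2 F2 mL]]]]] := nf_newP (config_fn M ++ g1) H2.
  have [_ P1 S1] := nf_fn H1; have [_ P3 S3] := nf_fn H3.
  have [mM mg1] : m \notin config_fn M /\ m \notin g1.
    case: mL => [mg2|]; last by rewrite mem_cat negb_or => /andP.
    split.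
      apply/negP => mM; move/apartP: ap => /(_ m); apply; rewrite mem_cat ?mg2 ?orbT //.
      by rewrite mM.
    by apply/negP => mg1; move: U; rewrite cat_uniq => /and3P[_ /hasPn /(_ _ mg2) /negP].
  have mA1 : m \notin fns A1.
    by apply/negP => /S1; rewrite mem_cat (negPf mM) (negPf mg1).
  have sg2 : {subset g <= g2}.
    by move=> x xg; rewrite -(perm_mem E2) /kept; case: ifP; rewrite ?inE xg ?orbT.
  have Ug : uniq g by have [] := nf_fn H3.
  have [HF HS] := absorb_catl A mA1.
  apply: (nf_new (m := m) (g := g1 ++ g) (A := A1 ++ A)).
  + apply: (nf_par (M := config_ren _ M) (N := config_ren _ N)).
    * by apply/nf_tr_fresh; first exact: nM; first exact: mM; exact: H1.
    * exact: H3.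
    * rewrite cat_uniq Ug andbT; move: U; rewrite cat_uniq => /and3P[-> Ha _] /=.
      by apply: contra Ha => /hasP[x xg xg1]; apply/hasP; exists x; rewrite ?sg2.
    * apply/apartP => x; rewrite !mem_cat !mem_fn_tr => xg.
      have xm : x != m.
        by case/orP: xg => H; [apply: contraNneq mg1 => <-|apply: contraNneq mg => <-].
      have xg12 : x \in g1 ++ g2 by rewrite mem_cat; case/orP: xg => [->//|/sg2->]; rewrite orbT.
      move/apartP: ap => /(_ x xg12); rewrite mem_cat => ap.
      case/orP => [xM|xN]; apply: ap; apply/orP.
        left; case: (eqVneq x n) xM => [->|xn]; first by rewrite trL (negPf mM).
        by rewrite trN.
      by right; rewrite -(fn_new_body mN) // mem_fn_tr.
    * exact: perm_refl.
    * exact: lcong_refl.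
  + by move: mN; rewrite /= !mem_filter mem_cat (negPf mM).
  + by rewrite mem_cat (negPf mg1) (negPf mg).
  + apply: perm_trans E; rewrite /kept HS; move: E2; rewrite /kept.
    case: ifP => _ E2.
      by rewrite -cat1s perm_catCA perm_cat2l.
    by rewrite perm_cat2l.
  + rewrite HF; apply: lc_trans F; exact: lcong_cat.
- move=> H0; have [m [g [A [H1 mN mg [E F _]]]]] := nf_newP [::] H0.
  case/nf_parP: H1 => g1 [A1 [g2 [A2 [H1 H2 [U ap E2 F2]]]]].
  have mM : m \notin config_fn M.
    apply: contra mN => mM; rewrite /= mem_filter mem_cat mM /= andbT.
    by apply: contraNneq nM => <-.
  have {}H1 : NF M g1 A1 by apply/nf_tr_fresh; first exact: nM; first exact: mM; exact: H1.
  have [U1 P1 S1] := nf_fn H1.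
  have mg1 : m \notin g1 by apply: contra mg => mg1; rewrite -(perm_mem E2) mem_cat mg1.
  have mg2 : m \notin g2 by apply: contra mg => mg2; rewrite -(perm_mem E2) mem_cat mg2 orbT.
  have mA1 : m \notin fns A1.
    by apply/negP => /S1; rewrite mem_cat (negPf mM) (negPf mg1).
  have [HF HS] := absorb_catl A2 mA1.
  have mN' : m \notin config_fn (CNew n N).
    by apply: contra mN; rewrite /= !mem_filter /= mem_cat => /andP[-> ->]; rewrite orbT.
  have H3 : NF (CNew n N) (kept m A2 g2) (absorb m A2) by apply: nf_new H2 _ _ _ _.
  apply: (nf_par H1 H3).
  + rewrite cat_uniq /kept; move: U; rewrite cat_uniq => /and3P[-> Ha U2] /=.
    case: ifP => _ /=; last by rewrite Ha U2.
    by rewrite negb_or mg1 Ha mg2 U2.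
  + apply/apartP => x; rewrite mem_cat => xg.
    have [->|xm] := eqVneq x m; first by rewrite mem_cat (negPf mM) (negPf mN').
    have xg' : x \in g1 ++ g2.
      rewrite mem_cat; case/orP: xg => [->//|/kept_mem[->|E']]; first by rewrite orbT.
      by rewrite E' eqxx in xm.
    move/apartP: ap => /(_ x xg') ap xMN; apply: ap; move: xMN; rewrite !mem_cat.
    case/orP => [xM|xN]; apply/orP; [left|right; by rewrite fn_new_body].
    rewrite mem_fn_tr trN //; by apply: contraNneq nM => <-.
  + apply: perm_trans E; rewrite -(lcong_kept _ _ F2) /kept HS; case: ifP => _.
      by rewrite -[m :: g2]cat1s perm_catCA /= perm_cons.
    exact: E2.
  + apply: lc_trans F; rewrite -HF; exact: lcong_absorb.
Qed.

Lemma fn_new_self n M : n \notin config_fn (CNew n M).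
Proof. by rewrite /= mem_filter /= eqxx. Qed.

(** The counterpart of [c_run_new]: when the name is neither the location nor in the stack of a lone
    run, it is never shared and goes back into the process. *)
Lemma absorb_run n m l p C P : n != l -> n \notin stack_fn C ->
  m \notin config_fn (CNew n (CRun l p C P)) ->
  let A := [:: config_ren (nren (tr n m)) (CRun l p C P)] in
  shared m A = false /\ lcong (absorb m A) [:: CRun l p C (PNew n P)].
Proof.
move=> nl nC mR A.
have [ml mC] : m != l /\ m \notin stack_fn C.
  case: (eqVneq m n) mR => [->//|mn].
  by rewrite /= eq_sym nl inE mem_filter mem_cat !negb_or /= mn negb_or /= => /and3P[-> ->].
have El : tr n m l = l by rewrite trN // eq_sym.
(* Read off from [atom_alpha] at a run with process [PNil], whose only free names are [l] and those
   of the stack. *)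
have EC : stack_cong (map (frame_ren (nren (tr n m))) C) C.
  have := @atom_alpha (tr n m) id (CRun l p C PNil) (@tr_inj _ _) (@inj_id _) isT _.
  rewrite cren_id => H; have [//|_ _ //] := acong_shapeP (H _).
  move=> x; rewrite /= cats0 inE => /orP[/eqP->//|xC].
  by rewrite trN //; [apply: contraNneq nC => <-|apply: contraNneq mC => <-].
have mC' : m \notin stack_fn (map (frame_ren (nren (tr n m))) C) by rewrite (stack_fn_cong EC).
have S : shared m A = false.
  rewrite /shared /A /= El ml mC' /=; by case: occurs.
split=> //; rewrite /absorb S /A /=; constructor; last exact: lc_nil.
rewrite El (proj2 (fs_ren _ _)); last exact: nren_inj.
rewrite mem_map_inv /= ?trR; last exact: trK.
have mP : m \notin proc_fs KName (PNew n P).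
  move: mR; rewrite /= eq_sym nl /= !inE !mem_filter /= mem_cat.
  by apply: contra => /andP[-> ->]; rewrite !orbT.
have HA := pnew_alpha mP.
case: ifP => nP; apply: ac_run => //; first exact: pc_sym.
apply: pc_trans (pc_sym HA); apply: pc_sym; apply: pnew_drop.
rewrite (proj2 (fs_ren _ _)); last exact: nren_inj.
by rewrite mem_map_inv /= ?trR ?nP; last exact: trK.
Qed.

Lemma nf_acong A B gs As : atom A -> acong A B -> NF A gs As <-> NF B gs As.
Proof.
move=> aA AB; have aB : atom B by rewrite -(atom_acong AB).
split=> /nf_atomP [//|-> [C -> H]]; constructor=> //.
  by apply: ac_trans H; apply: ac_sym.
exact: ac_trans H.
Qed.

Lemma eq_apart a b c : b =i c -> apart a b = apart a c.
Proof. by move=> E; apply/apartP/apartP => H x; [rewrite -E|rewrite E]; apply: H. Qed.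

Lemma perm_apart a b c : perm_eq a b -> apart a c = apart b c.
Proof. by move=> E; apply/apartP/apartP => H x; [rewrite -(perm_mem E)|rewrite (perm_mem E)]; apply: H. Qed.


Ltac bool_sets := rewrite ?cat_uniq ?apart_catl ?apart_catr ?has_cat ?negb_or;
  repeat match goal with |- context [apart ?a ?b] => case: (apart a b) 
  | |- context [has ?a ?b] => case: (has a b) | |- context [uniq ?b] => case: (uniq b) end; done.

Lemma nf_parA M N K gs As : NF (CPar M (CPar N K)) gs As <-> NF (CPar (CPar M N) K) gs As.
Proof.
split=> /nf_parP [g1 [A1 [g2 [A2 [H1 H2 [U ap E F]]]]]].
- case/nf_parP: H2 => g3 [A3 [g4 [A4 [H3 H4 [U' ap' E' F']]]]].
  have E2 : perm_eq (g1 ++ g3 ++ g4) (g1 ++ g2) by rewrite perm_cat2l.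
  rewrite -(perm_uniq E2) in U; rewrite -(perm_apart _ E2) in ap.
  apply: (nf_par (nf_par H1 H3 _ _ (perm_refl _) (lcong_refl _)) H4).
  + by move: U; rewrite catA cat_uniq => /andP[].
  + by move: ap; rewrite /=; bool_sets.
  + by rewrite -catA.
  + by rewrite /= -!catA.
  + by rewrite -catA; apply: perm_trans E2 E.
  + rewrite -catA; apply: lc_trans F; exact: lcong_cat.
- case/nf_parP: H1 => g3 [A3 [g4 [A4 [H3 H4 [U' ap' E' F']]]]].
  have E2 : perm_eq ((g3 ++ g4) ++ g2) (g1 ++ g2) by rewrite perm_cat2r.
  rewrite -(perm_uniq E2) in U; rewrite -(perm_apart _ E2) in ap.
  apply: (nf_par H3 (nf_par H4 H2 _ _ (perm_refl _) (lcong_refl _))).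
  + by move: U; rewrite -catA cat_uniq => /and3P[].
  + by move: ap; rewrite /=; bool_sets.
  + by rewrite catA.
  + by move: ap; rewrite /= -!catA.
  + by rewrite catA; apply: perm_trans E2 E.
  + rewrite catA; apply: lc_trans F; exact: lcong_cat.
Qed.

Lemma nf_par0 M gs As : NF (CPar M CNil) gs As <-> NF M gs As.
Proof.
split=> [/nf_parP [g1 [A1 [g2 [A2 [H1 /nf_nilP[-> ->]]]]]]|H].
  by rewrite !cats0 => -[_ _ E F]; apply: nf_conv H1 E F.
have [U P _] := nf_fn H.
by apply: (nf_par H nf_nil); rewrite ?cats0.
Qed.

Lemma nf_parC M N gs As : NF (CPar M N) gs As -> NF (CPar N M) gs As.
Proof.
case/nf_parP => [g1 [A1 [g2 [A2 [H1 H2 [U ap E F]]]]]].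
apply: (nf_par H2 H1).
- by rewrite uniq_catC.
- by move: ap; bool_sets.
- by rewrite perm_catC.
- apply: lc_trans F; exact: lcong_catC.
Qed.

Lemma nf_par_mono M M' N N' gs As :
  (forall gs As, NF M gs As -> NF M' gs As) -> (forall gs As, NF N gs As -> NF N' gs As) ->
  config_fn M =i config_fn M' -> config_fn N =i config_fn N' ->
  NF (CPar M N) gs As -> NF (CPar M' N') gs As.
Proof.
move=> HM HN EM EN /nf_parP [g1 [A1 [g2 [A2 [/HM H1 /HN H2 [U ap E F]]]]]].
by apply: (nf_par H1 H2) => //; rewrite -(eq_apart _ (eq_mem_cat EM EN)).
Qed.

Lemma nf_new_mono n M M' gs As :
  (forall gs As, NF M gs As -> NF M' gs As) -> config_fn M =i config_fn M' ->
  NF (CNew n M) gs As -> NF (CNew n M') gs As.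
Proof.
move=> HM EM H0; have [m [g [A [H1 mN mg [E F _]]]]] := nf_newP [::] H0.
apply: (nf_new (m := m)) mg E F.
  (* The hypothesis speaks of [M] itself, so the transposition is undone before using it and redone
     after. *)
  have H2 := nf_alpha H1 (@tr_inj n m) (@tr_inj n m) (fun _ _ => erefl).
  rewrite cren_trK in H2.
  have H3 := nf_alpha (HM _ _ H2) (@tr_inj n m) (@tr_inj n m) (fun _ _ => erefl).
  by rewrite map_trK map_cren_trK in H3.
by move: mN; rewrite /= !mem_filter EM.
Qed.

Lemma nf_alpha_new n k M gs As : k \notin config_fn M ->
  NF (CNew n M) gs As <-> NF (CNew k (config_ren (nren (tr n k)) M)) gs As.
Proof.
move=> kM.
have Efn : config_fn (CNew n M) =i config_fn (CNew k (config_ren (nren (tr n k)) M)).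
  by move=> x; rewrite /= fn_cren_tr; apply: fn_alpha.
have agree m : m \notin config_fn (CNew n M) -> {in config_fn M, tr n m =1 tr k m \o tr n k}.
  move=> mM x xM /=; case: (eqVneq x n) => [->|xn]; first by rewrite !trL.
  have xk : x != k by apply: contraNneq kM => <-.
  have xm : x != m by apply: contraNneq mM => <-; rewrite /= mem_filter /= xn.
  by rewrite (trN xn xk) (trN xn xm) trN.
split=> H0; have [m [g [A [H1 mN mg [E F _]]]]] := nf_newP [::] H0.
- apply: (nf_new (m := m) _ _ mg E F); last by rewrite -Efn.
  by rewrite cren_comp; apply: nf_agree H1; [exact: trK|exact: trK|exact: inj_comp|exact: agree].
- apply: (nf_new (m := m) _ _ mg E F); last by rewrite Efn.
  move: H1; rewrite cren_comp; apply: (nf_agree (a' := tr n k \o tr k m)) => //.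
  + by move=> x /=; rewrite !trK.
  + by move=> x /=; rewrite !trK.
  + by move=> x xM; rewrite agree // Efn.
Qed.

Theorem nf_cong K K' : cong K K' -> forall gs As, NF K gs As <-> NF K' gs As.
Proof.
elim; try by move=> *; apply: nf_acong => //; constructor.
- by [].
- by move=> M N _ IH gs As; rewrite IH.
- by move=> M1 M2 M3 _ IH1 _ IH2 gs As; rewrite IH1.
- move=> M M' N N' /fn_ccong EM IH1 /fn_ccong EN IH2 gs As.
  by split; apply: nf_par_mono => // g A; [move/IH1|move/IH2|move/IH1|move/IH2].
- move=> n M M' /fn_ccong EM IH gs As.
  by split; apply: nf_new_mono => // g A /IH.
- by move=> M gs As; apply: nf_par0.
- by move=> M N gs As; split; apply: nf_parC.
- by move=> M N K0 gs As; apply: nf_parA.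
- move=> n gs As; split.
    case/(nf_newP [::]) => m [g [A [/nf_nilP[-> ->] _ _ [E F _]]]].
    by apply: nf_conv E F; constructor.
  by case/nf_nilP => -> ->; apply: (nf_new (m := n) (g := [::]) (A := [::])); first exact: nf_nil.
- by move=> n m M gs As; split; apply: nf_newC.
- by move=> n M N nM gs As; apply: nf_new_par.
- by move=> n m M mM gs As; rewrite swapE; apply: nf_alpha_new.
- move=> l p C n P nl nC gs As; split.
    case/nf_atomP=> // -> [A -> HA].
    have mR : n \notin config_fn (CNew n (CRun l p C P)) by apply: fn_new_self.
    have [S L] := absorb_run nl nC mR.
    apply: (nf_new (m := n) (g := [::]) (A := [:: config_ren (nren (tr n n)) (CRun l p C P)])) => //.
    + exact: nf_atom.
    + by rewrite /kept S.
    + by apply: lc_trans L _; constructor.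
  case/(nf_newP [::]) => m [g [A [/nf_atomP [//|-> [A' -> HA]] mN mg [E F _]]]].
  have [S L] := absorb_run nl nC mN.
  have HL : lcong [:: config_ren (nren (tr n m)) (CRun l p C P)] [:: A'] by constructor.
  move: E; rewrite -(lcong_kept _ _ HL) /kept S => E.
  apply: nf_conv E F; apply: nf_conv (perm_refl _) (lc_trans (lcong_sym L) (lcong_absorb m HL)).
  exact: nf_atom.
Qed.

(** * Existence and soundness of normal forms *)

Fixpoint csize (M : config) : nat :=
  match M with CPar M1 M2 => (csize M1 + csize M2).+1 | CNew _ M => (csize M).+1 | _ => 0 end.

Lemma csize_ren r M : csize (config_ren r M) = csize M.
Proof. by elim: M => //= [M -> N ->|n M ->]. Qed.

(** The body of a restriction is renamed before its normal form is taken, hence an induction on a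
    size that renamings preserve. *)
Lemma nf_exists K (L : seq nat) : exists gs As, NF K gs As /\ apart gs L.
Proof.
have [n] := ubnP (csize K); elim: n => // n IH in K L *.
have Hat A : atom A -> exists gs As, NF A gs As /\ apart gs L.
  by move=> aA; exists [::], [:: A]; split; [apply: nf_atom|apply/apartP].
case: K => [|M N|m M||||||] /=; try by move=> *; apply: Hat.
- by exists [::], [::]; split; [constructor|apply/apartP].
- move=> sz; have [|g1 [A1 [H1 L1]]] := IH M (L ++ config_fn M ++ config_fn N); first lia.
  have [|g2 [A2 [H2 L2]]] := IH N (g1 ++ L ++ config_fn M ++ config_fn N); first lia.
  have [[U1 P1 _] [U2 P2 _]] := (nf_fn H1, nf_fn H2).
  exists (g1 ++ g2), (A1 ++ A2); split.
    apply: (nf_par H1 H2) => //; last by move: L1 L2; bool_sets.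
    rewrite cat_uniq U1 U2 andbT; apply/hasPn => x x2; apply/negP => x1.
    by move/apartP: L2 => /(_ _ x2); rewrite mem_cat x1; apply.
  by move: L1 L2; bool_sets.
- move=> sz; have [k] := fresh_nat (L ++ config_fn (CNew m M)).
  rewrite mem_cat negb_or => /andP[kL kM].
  have [|g [A [H1 L1]]] := IH (config_ren (nren (tr m k)) M) (k :: L); first by rewrite csize_ren; lia.
  have [kg gL] : k \notin g /\ apart g L.
    split; last by apply: sub_apart L1 => // x xL; rewrite inE xL orbT.
    by apply/negP => kg; move/apartP: L1 => /(_ _ kg); rewrite inE eqxx; apply.
  exists (kept k A g), (absorb k A); split; first exact: nf_new H1 _ _ _ _.
  by apply/apartP => x /kept_mem[|->]; [move/apartP: gL; apply|apply/negP].
Qed.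

Lemma nf_to_cong K gs As : NF K gs As -> cong K (news gs (pars As)).
Proof.
elim=> [|A A' aA AA'|M N g1 A1 g2 A2 g0 A0 H1 IH1 H2 IH2 U ap E F|n m M g A g0 A0 H IH mM mg E F].
- exact: c_refl.
- by apply: c_trans (acong_cong AA') (c_sym (c_par0 _)).
- apply: c_trans (c_par IH1 IH2) _.
  have [[_ P1 S1] [_ P2 S2]] := (nf_fn H1, nf_fn H2).
  apply: c_trans (news_cong _ (lcong_pars F)).
  apply: c_trans (news_perm _ E); rewrite news_cat.
  apply: c_trans (news_par _ _) _.
    apply/apartP => x x1; rewrite fn_news fn_pars => /andP[x2 /S2].
    rewrite mem_cat (negPf x2) orbF => xN.
    by move/apartP: ap => /(_ x); rewrite !mem_cat x1 xN orbT; apply.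
  apply: news_cong; apply: c_trans (c_parC _ _) _.
  apply: c_trans (news_par _ _) _.
    apply/apartP => x x2; rewrite fn_pars => /S1; rewrite mem_cat => /orP[xM|x1].
      by move/apartP: ap => /(_ x); rewrite !mem_cat x2 xM orbT; apply.
    by move: U; rewrite cat_uniq => /and3P[_ /hasPn /(_ _ x2) /negP].
  apply: news_cong; apply: c_trans (c_parC _ _) _; exact/c_sym/pars_cat.
- apply: c_trans (cnew_alpha mM) _; apply: c_trans (c_new _ IH) _.
  apply: c_trans (news_cong _ (lcong_pars F)); apply: c_trans (news_perm _ E).
  rewrite /kept; case: ifP => S; first by rewrite /absorb S; apply: c_refl.
  apply: c_trans (news_new _ _ _) _; apply: news_cong.
  exact: absorb_pars.
Qed.

(** * Half steps *)

Definition is_mon A := if A is CMon _ _ _ _ _ _ _ then true else false.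
Definition is_queue A := if A is CQueue _ _ _ then true else false.

(* The half steps of both semantics, oriented away from the configuration whose
   queue holds the pending message: a [snd_move] is a forward output read
   backwards if the tag is [Empty], and an undone output if it is [Full]; a
   [rcv_move] is a forward input if the tag is [Empty], and an undone input read
   backwards if it is [Full]. *)
Inductive snd_move (t : Defs.tag) : config -> config -> Prop :=
  | SMVal l p C V P s q U h T xs sg hi ho W :
      p != q -> (if t is Empty then value_ok sg V /\ W = value_sub sg V else W = V) ->
      snd_move t
        (pars [:: CRun l p C P; CMon s p (EOut q U :: h) T xs sg t;
                  CQueue s hi (rcons ho (p, q, MVal W))])
        (pars [:: CRun l p C (POut (CEnd s p) V P);
                  CMon s p h (TOut q U T) xs sg Empty; CQueue s hi ho])
  | SMLab l p C w Ps P Ps' s q Ts T Ts' h xs sg hi ho :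
      p != q ->
      snd_move t
        (pars [:: CRun l p (FSel (CEnd s p) Ps Ps' :: C) P;
                  CMon s p (ESel q w Ts Ts' :: h) T xs sg t;
                  CQueue s hi (rcons ho (p, q, MLab w))])
        (pars [:: CRun l p C (PSel (CEnd s p) (Ps ++ (w, P) :: Ps'));
                  CMon s p h (TSel q (Ts ++ (w, T) :: Ts')) xs sg Empty;
                  CQueue s hi ho]).

Inductive rcv_move (t : Defs.tag) : config -> config -> Prop :=
  | RMVal l q C y Q s p U h T xs sg V hi ho :
      p != q -> (t = Empty -> y \notin xs /\ y \notin dom sg) ->
      rcv_move t
        (pars [:: CRun l q C (PIn (CEnd s q) y Q);
                  CMon s q h (TIn p U T) xs sg Empty;
                  CQueue s hi ((p, q, MVal V) :: ho)])
        (pars [:: CRun l q C Q;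
                  CMon s q (EIn p U :: h) T (y :: xs) ((y, V) :: sg) t;
                  CQueue s (rcons hi (p, q, MVal V)) ho])
  | RMLab l q C w Ps P Ps' s p Ts T Ts' h xs sg hi ho :
      p != q ->
      rcv_move t
        (pars [:: CRun l q C (PBra (CEnd s q) (Ps ++ (w, P) :: Ps'));
                  CMon s q h (TBra p (Ts ++ (w, T) :: Ts')) xs sg Empty;
                  CQueue s hi ((p, q, MLab w) :: ho)])
        (pars [:: CRun l q (FBra (CEnd s q) Ps Ps' :: C) P;
                  CMon s q (EBra p w Ts Ts' :: h) T xs sg t;
                  CQueue s (rcons hi (p, q, MLab w)) ho]).

(** The interface through which senders and receivers, forwards and backwards, are tracked by one
    proof. The run is the only component of the redex into which a restriction can be pushed, and
    [move_fn] ensures that a restriction absent from the redex binds nothing in the reduct. *)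
Record move (T : config -> config -> Prop) : Prop := Move {
  move_shape X Y : T X Y -> exists l p C P mo qu C' P' mo' qu',
    [/\ X = pars [:: CRun l p C P; mo; qu], Y = pars [:: CRun l p C' P'; mo'; qu'],
        is_mon mo & is_queue qu];
  move_ren (f : nat -> nat) X Y : injective f -> T X Y ->
    T (config_ren (nren f) X) (config_ren (nren f) Y);
  move_fn X Y : T X Y -> {subset config_fn Y <= config_fn X}
}.

Lemma value_ok_ren r sg V : (forall k, injective (r k)) ->
  value_ok sg V -> value_ok (store_ren r sg) (value_ren r V).
Proof.
by move=> r_inj H k; rewrite store_fs_ren // (proj1 (bs_ren r k)) apart_map.
Qed.

Ltac mem_solve :=
  rewrite ?(map_cat, map_rcons, flatten_rcons, flatten_cat, inE, mem_cat, mem_rcons) /=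
    ?(map_cat, map_rcons, flatten_rcons, flatten_cat, inE, mem_cat, mem_rcons) /=;
  repeat case/orP; let H := fresh in move=> H; rewrite ?H ?orbT //.

Lemma snd_move_move t : move (snd_move t).
Proof.
split.
- by move=> X Y []; move=> *; do 10 eexists; split; reflexivity.
- move=> f X Y f_inj []; move=> l p C.
  + move=> V P s q U h T xs sg hi ho W pq H /=; rewrite map_rcons.
    apply: SMVal => //; case: t H => //= [[ok ->]|->] //.
    rewrite -(proj1 (sub_ren _)) //; split=> //.
    by apply: value_ok_ren => //; apply: nren_inj.
  + move=> w Ps P Ps' s q Ts T Ts' h xs sg hi ho pq /=; rewrite map_rcons map_cat.
    exact: SMLab.
- move=> X Y []; move=> l p C.
  + move=> V P s q U h T xs sg hi ho W pq H x /=.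
    have HV : x \in value_fs KName V -> x \in value_fs KName W.
      by case: t H => [[_ ->]|->] //; apply: (proj1 (fn_sub x)).
    by mem_solve; rewrite (HV H0) ?orbT.
  + move=> w Ps P Ps' s q Ts T Ts' h xs sg hi ho pq x /=; mem_solve.
Qed.

Lemma rcv_move_move t : move (rcv_move t).
Proof.
split.
- by move=> X Y []; move=> *; do 10 eexists; split; reflexivity.
- move=> f X Y f_inj []; move=> l p C.
  + move=> y Q s q U h T xs sg V hi ho pq H /=; rewrite map_rcons.
    have E : map (nren f KVar) xs = xs by rewrite -[RHS]map_id.
    apply: RMVal => //= /H; rewrite E => -[-> yd]; split=> //.
    by move: yd; rewrite /dom /store_ren -map_comp.
  + move=> w Ps P Ps' s q Ts T Ts' h xs sg hi ho pq /=; rewrite map_rcons map_cat.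
    exact: RMLab.
- move=> X Y []; move=> l p C.
  + by move=> y Q s q U h T xs sg V hi ho pq H x /=; mem_solve.
  + by move=> w Ps P Ps' s q Ts T Ts' h xs sg hi ho pq x /=; mem_solve.
Qed.

(** * Tracking a redex into the normal form *)

Lemma nf_pars l gs As : all atom l -> NF (pars l) gs As -> gs = [::] /\ lcong l As.
Proof.
elim: l gs As => [|a l IH] gs As /=; first by move=> _ /nf_nilP[-> ->].
move=> /andP[aA al] /nf_parP [g1 [A1 [g2 [A2 [/(nf_atomP aA)[-> [B -> aB]] /(IH _ _ al)[-> H] [_ _ E F]]]]]].
split; first by apply/perm_nilP; rewrite perm_sym.
by apply: lc_trans F; constructor.
Qed.

Lemma fn_pnews hs P x : (x \in proc_fs KName (pnews hs P)) = (x \notin hs) && (x \in proc_fs KName P).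
Proof.
elim: hs => //= g gs IH; rewrite /unbind /= mem_filter /= IH inE negb_or andbA //.
Qed.

(* The redex of a move found in the normal form of its source.  The process of
   the run comes under restrictions [hs], which have to be extruded for the move
   to take place. *)
Inductive tracked (T : config -> config -> Prop) (N : config) (gs : seq nat)
    (As : seq config) (L : seq nat) : Prop :=
  Tracked l p C P mo qu C' P' mo' qu' hs R of
    T (pars [:: CRun l p C P; mo; qu]) (pars [:: CRun l p C' P'; mo'; qu']) &
    is_mon mo & is_queue qu &
    lcong ([:: CRun l p C (pnews hs P); mo; qu] ++ R) As &
    uniq hs & apart hs (L ++ (l :: stack_fn C) ++ fns [:: mo; qu] ++ fns R) &
    cong N (news gs (news hs (pars ([:: CRun l p C' P'; mo'; qu'] ++ R)))).

(** The hidden restrictions [hs] come to scope over the atoms [A2] of the context too, hence the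
    larger list that they have to avoid. *)
Lemma tracked_par T N1 K2 g1 A1 g2 A2 gs As L :
  tracked T N1 g1 A1 (L ++ fns A2) -> NF K2 g2 A2 -> apart (g1 ++ g2) (config_fn N1 ++ config_fn K2) ->
  uniq (g1 ++ g2) ->
  perm_eq (g1 ++ g2) gs -> lcong (A1 ++ A2) As -> tracked T (CPar N1 K2) gs As L.
Proof.
case=> l p C P mo qu C' P' mo' qu' hs R HT Hmo Hqu HA Uh ah HN H2 ap U E F.
have [U2 P2 S2] := nf_fn H2.
apply: (Tracked (hs := hs) (R := R ++ A2) HT) => //.
- apply: lc_trans F; rewrite catA; exact: lcong_cat.
- by move: ah; rewrite fns_cat; bool_sets.
- apply: c_trans (c_par HN (nf_to_cong H2)) _.
  apply: c_trans (news_perm _ E); rewrite news_cat.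
  set Y := pars _ in HN *.
  apply: c_trans (c_parC _ _) _.
  apply: c_trans (news_par _ _) _.
    apply/apartP => x x2; rewrite -(fn_ccong HN) => xN.
    by move/apartP: ap => /(_ x); rewrite !mem_cat x2 xN orbT; apply.
  apply: c_trans (c_sym _); last first.
    by rewrite -news_cat; apply: news_perm; rewrite perm_catC.
  rewrite news_cat; apply: news_cong; apply: c_trans (c_parC _ _) _.
  apply: c_trans (news_par _ _) _.
    apply/apartP => x x1; rewrite fn_pars => /S2; rewrite mem_cat => /orP[xM|x2].
      by move/apartP: ap => /(_ x); rewrite !mem_cat x1 xM orbT; apply.
    by move: U; rewrite cat_uniq => /and3P[_ /hasPn /(_ _ x2) /negP].
  apply: news_cong; apply: c_trans (news_par _ _) _.
    by move: ah; rewrite fn_pars; bool_sets.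
  apply: news_cong; rewrite catA; exact/c_sym/pars_cat.
Qed.

(** There are three places for [m]: if shared, it stays in the prefix; if absorbed by the run of the
    redex, it joins the hidden restrictions [hs], which is why it has to avoid [L]; otherwise it
    belongs to the remaining atoms. *)
Lemma tracked_new T n N1 m g A gs As L : move T ->
  tracked T (config_ren (nren (tr n m)) N1) g A (m :: L) ->
  m \notin config_fn (CNew n N1) ->
  perm_eq (kept m A g) gs -> lcong (absorb m A) As -> (shared m A \/ m \notin L) ->
  tracked T (CNew n N1) gs As L.
Proof.
move=> mT [l p C P mo qu C' P' mo' qu' hs R HT Hmo Hqu HA Uh ah HN] mN E F mL.
have {HN} HN : cong (CNew n N1) (CNew m (news g (news hs (pars ([:: CRun l p C' P'; mo'; qu'] ++ R))))).
  by apply: c_trans (cnew_alpha mN) _; apply: c_new.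
have mhs : m \notin hs.
  by apply/negP => mh; move/apartP: ah => /(_ m mh); rewrite mem_cat inE eqxx; apply.
have ahL : apart hs (L ++ (l :: stack_fn C) ++ fns [:: mo; qu] ++ fns R).
  by apply: sub_apart ah => // x xL; rewrite inE xL orbT.
rewrite -(lcong_kept _ _ HA) in E; move/(lcong_absorb m): (HA) => HA'.
have {F} F := lc_trans HA' F.
rewrite -(lcong_shared _ HA) in mL.
move: E F mL; rewrite /kept; case S: (shared m _) => E F mL.
  apply: (Tracked (hs := hs) (R := R) HT) => //.
    by move: F; rewrite /absorb S.
  by apply: c_trans HN _; apply: (news_perm _ E).
have {}mL : m \notin L by case: mL.
have [pu cnt] := sharedN S.
case mP: (m \in proc_fs KName (pnews hs P)).
  have [ml mC] : m != l /\ m \notin stack_fn C by move: pu => /= /andP[/andP[]].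
  have H0 (B : config) Bs : count (occurs m) (B :: Bs) = 0 -> m \notin config_fn B /\ count (occurs m) Bs = 0.
    by rewrite /=; case H: (occurs m B) => // H'; split=> //; apply/negbT.
  have c0 : count (occurs m) ([:: mo; qu] ++ R) = 0.
    have oR : occurs m (CRun l p C (pnews hs P)) by rewrite /occurs /= inE mem_cat mP !orbT.
    by move: cnt; rewrite /= oR; case: (nat_of_bool (occurs m mo) + _).
  have [mmo /H0 [mqu cR]] := H0 _ _ c0.
  have [mR pR] : m \notin fns R /\ map (push m) R = R.
    elim: R cR {HA HA' F S E pu cnt c0 ah ahL HN} => //= B R IH /H0 [mB /IH [mR ->]].
    by rewrite fns_cons mem_cat negb_or mB push_id.
  apply: (Tracked (hs := m :: hs) (R := R) HT) => //.
  - move: F; rewrite /absorb S /= mP !push_id // pR; exact.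
  - by rewrite /= mhs.
  - rewrite -cat1s apart_catl ahL andbT; apply/apartP => x; rewrite inE => /eqP->.
    by rewrite /fns /= cats0 !(mem_cat, inE) (negPf mL) (negPf ml) (negPf mC) (negPf mR) (negPf mmo) (negPf mqu).
  - apply: c_trans HN _; apply: c_trans (news_new _ _ _) _; exact: news_perm.
(* [m] is absent from the redex. By [move_fn] it is absent from the reduct as well, so its
   restriction can be narrowed to [R]. *)
have mR3 : m \notin fns [:: CRun l p C (pnews hs P); mo; qu].
  move: pu => /= /and4P[/andP[ml mC] pmo pqu _].
  have mmo : m \notin config_fn mo by case: (mo) Hmo pmo.
  have mqu : m \notin config_fn qu by case: (qu) Hqu pqu.
  by rewrite !fns_cons !mem_cat /= inE mem_cat (negPf ml) (negPf mC) mP (negPf mmo) (negPf mqu).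
have [E1 S1] := absorb_catl R mR3.
have SR : shared m R = false by rewrite -S1.
apply: (Tracked (hs := hs) (R := absorb m R) HT) => //.
- by rewrite -E1.
- apply: sub_apart ahL => // x; rewrite !mem_cat fns_absorb.
  by case/or3P=> [->//|->|/orP[->|/andP[->]]]; rewrite ?orbT.
- apply: c_trans HN _; apply: c_trans (news_new _ _ _) _; apply: c_trans (news_perm _ E) _.
  apply: news_cong; apply: c_trans (news_new _ _ _) _; apply: news_cong.
  apply: c_trans (c_new _ (pars_cat _ _)) _; apply: c_trans _ (c_sym (pars_cat _ _)).
  apply: c_trans (c_sym (c_new_par _ _)) _; last first.
    by apply: c_par; [exact: c_refl|exact: absorb_pars].
  apply/negP => /(move_fn mT HT); rewrite fn_pars => mX.
  move/negP: mR3; apply; move: mX; rewrite !fns_cons !mem_cat /= !inE !mem_cat fn_pnews mhs.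
  by [].
Qed.

Theorem track T K N : move T -> reduces T K N -> forall gs As L,
  NF K gs As -> apart gs (config_fn N) -> tracked T N gs As L.
Proof.
(* [nf_new] renames the body of a restriction, so the induction has to cover all renamings of the
   step. *)
move=> mT H; suff: forall f : nat -> nat, injective f -> forall gs As L,
    NF (config_ren (nren f) K) gs As -> apart gs (config_fn (config_ren (nren f) N)) ->
    tracked T (config_ren (nren f) N) gs As L.
  by move=> /(_ id (@inj_id _)); rewrite !cren_id.
elim: H => {K N} [X Y HT|M N K2 _ IH|n M N _ IH|M M' N' N MM' _ IH N'N] f f_inj gs As L.
- move=> HX _; have HT' := move_ren mT f_inj HT.
  have [l [p [C [P [mo [qu [C' [P' [mo' [qu' [E1 E2 Hmo Hqu]]]]]]]]]]] := move_shape mT HT'.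
  rewrite E1 in HX HT' *; rewrite E2 in HT' *.
  have [|-> HA] := nf_pars _ HX.
    by case: (mo) Hmo => //; case: (qu) Hqu.
  apply: (Tracked (hs := [::]) (R := [::]) HT') => //.
  + exact/apartP.
  + exact: c_refl.
- move=> /nf_parP [g1 [A1 [g2 [A2 [H1 H2 [U ap E F]]]]]].
  rewrite -(perm_apart _ E) => apN.
  have apN1 : apart g1 (config_fn (config_ren (nren f) N)).
    by move: apN; rewrite /=; bool_sets.
  apply: tracked_par H2 apN U E F; exact: IH.
(* An absorbed name is chosen off [L] and off the reduct; a kept one avoids the reduct by
   hypothesis. *)
- move=> /(nf_newP (L ++ config_fn (config_ren (nren f) (CNew n N)))) [m [g [A [H1 mM mg [E F mL]]]]] apN.
  have mN : m \notin config_fn (config_ren (nren f) (CNew n N)).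
    case: mL => [mgs|]; first by apply/negP => mN; move/apartP: apN => /(_ _ mgs mN).
    by rewrite mem_cat negb_or => /andP[].
  apply: (tracked_new (m := m) (g := g) (A := A)) => //.
  + move: H1; rewrite !cren_comp => H1; apply: IH => //; first exact: inj_comp.
    apply/apartP => x xg; rewrite -cren_comp fn_new_body //; last by apply: contraNneq mg => <-.
    move/apartP: apN => /(_ x); rewrite -(perm_mem E) /kept; case: ifP => _; rewrite ?inE xg ?orbT; exact.
  + case: mL => [mgs|]; last by rewrite mem_cat negb_or => /andP[]; right.
    left; move: mgs; rewrite -(perm_mem E) /kept; case: ifP => // _.
    by rewrite (negPf mg).
- move=> HM apN; have MM2 := cong_cren (nren_inj f_inj) MM'; have NN2 := cong_cren (nren_inj f_inj) N'N.
  have [||] := IH f f_inj gs As L.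
  + by apply/(nf_cong MM2).
  + by rewrite (eq_apart _ (fn_ccong NN2)).
  move=> l p C P mo qu C' P' mo' qu' hs R HT Hmo Hqu HA Uh ah HN.
  apply: (Tracked HT Hmo Hqu HA Uh ah); exact: c_trans (c_sym NN2) HN.
Qed.

(** * Synchronizations *)

Fixpoint pend (M : config) : nat :=
  match M with
  | CPar M1 M2 => pend M1 + pend M2
  | CNew _ M1 => pend M1
  | CQueue _ _ ho => size ho
  | _ => 0
  end.

Fixpoint full (M : config) : nat :=
  match M with
  | CPar M1 M2 => full M1 + full M2
  | CNew _ M1 => full M1
  | CMon _ _ _ _ _ _ Full => 1
  | _ => 0
  end.

Fixpoint clear (M : config) : config :=
  match M with
  | CPar M1 M2 => CPar (clear M1) (clear M2)
  | CNew n M1 => CNew n (clear M1)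
  | CMon s p h T xs sg _ => CMon s p h T xs sg Empty
  | _ => M
  end.

Lemma stableP M : stable M <-> pend M = 0 /\ full M = 0.
Proof.
elim: M => //= [M IHM N IHN|s p h T xs sg t|s hi ho].
- by rewrite IHM IHN; split; lia.
- by case: t; split=> // -[].
- by split=> [->|[/size0nil]].
Qed.

Lemma clear_stable M : stable M -> clear M = M.
Proof. by elim: M => //= [M IHM N IHN [/IHM-> /IHN->]|n M IH /IH->|s p h T xs sg t ->]. Qed.

Lemma pend_ren r M : pend (config_ren r M) = pend M.
Proof. by elim: M => //= [M -> N ->|s hi ho]; rewrite ?size_map. Qed.
Lemma full_ren r M : full (config_ren r M) = full M.
Proof. by elim: M => //= M -> N ->. Qed.
Lemma clear_ren r M : clear (config_ren r M) = config_ren r (clear M).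
Proof. by elim: M => //= [M -> N ->|n M ->]. Qed.
Lemma fn_clear M : config_fn (clear M) = config_fn M.
Proof. by elim: M => //= [M -> N ->|n M ->]. Qed.

Lemma pend_cong M N : cong M N -> pend M = pend N.
Proof.
elim=> //=; try lia.
- by move=> n m M1 _; rewrite pend_ren.
- by move=> s hi hi' ho ho' _ /queue_cong_size.
Qed.

Lemma full_cong M N : cong M N -> full M = full N.
Proof.
elim=> //=; try lia.
by move=> n m M1 _; rewrite full_ren.
Qed.

Lemma clear_cong M N : cong M N -> cong (clear M) (clear N).
Proof.
elim=> /=; try by move=> *; econstructor; eassumption.
- by move=> n M1 M2 nM; apply: c_new_par; rewrite fn_clear.
- by move=> n m M1 mM; rewrite clear_ren; apply: c_alpha; rewrite fn_clear.
Qed.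

Lemma pend_news gs M : pend (news gs M) = pend M.
Proof. by elim: gs. Qed.
Lemma full_news gs M : full (news gs M) = full M.
Proof. by elim: gs. Qed.
Lemma clear_news gs M : clear (news gs M) = news gs (clear M).
Proof. by elim: gs => //= g gs ->. Qed.
Lemma pend_pars l : pend (pars l) = sumn (map pend l).
Proof. by elim: l => //= a l ->. Qed.
Lemma lcong_pend l l' : lcong l l' -> sumn (map pend l) = sumn (map pend l').
Proof. by apply: lcong_sumn => A B /acong_cong /pend_cong. Qed.

(** * Merging two half steps out of the same configuration *)

Lemma lcong_cons2 x y l l' : lcong (x :: l) (y :: l') ->
  (acong x y /\ lcong l l') \/ (exists s, lcong l (y :: s) /\ lcong l' (x :: s)).
Proof.
move/lcong_cons => [z [[|w l1] [l2 [/= [-> ->] xz ll]]]]; first by left.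
right; exists (l1 ++ l2); split=> //.
apply: lc_trans (lcong_sym (lcong_mid _ _ _)) _.
by constructor=> //; apply: ac_sym.
Qed.

(** Once one move has been made, the restrictions hidden in the run of the other one are extruded
    over everything, including the reduct [X]. *)
Lemma pars_open hs l p C P S X : apart hs ((l :: stack_fn C) ++ fns S ++ fns X) ->
  cong (pars (X ++ CRun l p C (pnews hs P) :: S)) (news hs (pars (X ++ CRun l p C P :: S))).
Proof.
rewrite !apart_catr => /and3P[a1 aS aX].
apply: c_trans (lcong_pars (lcong_sym (lcong_mid _ _ _))) _.
apply: c_trans (news_cong _ (lcong_pars (lcong_mid _ _ _))).
have aXS : apart hs (config_fn (pars (X ++ S))) by rewrite fn_pars fns_cat apart_catr aX.
apply: c_trans (news_par _ aXS).
apply: c_par; last exact: c_refl.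
exact/c_sym/run_news.
Qed.

(** What separates two redexes except for their queue: if only one message is pending, both use the
    queue that holds it, and then neither the runs nor the monitors can be the same atom. *)
Definition compat (T1 T2 : config -> config -> Prop) : Prop :=
  forall l1 p1 C1 P1 mo1 qu1 Y1 l2 p2 C2 P2 mo2 qu2 Y2,
    T1 (pars [:: CRun l1 p1 C1 P1; mo1; qu1]) Y1 ->
    T2 (pars [:: CRun l2 p2 C2 P2; mo2; qu2]) Y2 ->
    [/\ 0 < pend qu1, 0 < pend qu2 &
        acong qu1 qu2 -> pend qu1 = 1 -> p1 <> p2 /\ ~ acong mo1 mo2].

(** The two copies of [R] are the same and so is the prefix [ns]: this is the common context. A
    single pending message is essential, as with two of them the moves could act on different
    messages. *)
Lemma merge_moves T1 T2 K A B : move T1 -> move T2 -> compat T1 T2 -> pend K = 1 ->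
  reduces T1 K A -> reduces T2 K B ->
  exists l1 p1 C1 P1 mo1 qu1 C1' P1' mo1' qu1' l2 p2 C2 P2 mo2 qu2 C2' P2' mo2' qu2' ns R,
   [/\ T1 (pars [:: CRun l1 p1 C1 P1; mo1; qu1]) (pars [:: CRun l1 p1 C1' P1'; mo1'; qu1']),
       T2 (pars [:: CRun l2 p2 C2 P2; mo2; qu2]) (pars [:: CRun l2 p2 C2' P2'; mo2'; qu2']),
       acong qu1 qu2 /\ pend qu1 = 1,
       cong A (news ns (pars ([:: CRun l1 p1 C1' P1'; mo1'; qu1'; CRun l2 p2 C2 P2; mo2] ++ R))) &
       cong B (news ns (pars ([:: CRun l2 p2 C2' P2'; mo2'; qu2'; CRun l1 p1 C1 P1; mo1] ++ R)))].
Proof.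
move=> mT1 mT2 cT pK KA KB.
have [gs [As [HK aK]]] := nf_exists K (config_fn A ++ config_fn B).
have [aA aB] : apart gs (config_fn A) /\ apart gs (config_fn B).
  by apply/andP; rewrite -apart_catr.
(* The hidden restrictions are kept away from all names in sight: [hs2] avoids [As], and [hs1] below
   avoids [hs2], [As] and the reduct [Y2]. *)
case: (track mT2 KB (fns As) HK aB) => l2 p2 C2 P2 mo2 qu2 C2' P2' mo2' qu2' hs2 R2.
move=> HT2 Hmo2 Hqu2 HA2 U2 ah2 EB.
set Y2 := [:: _; _; _] in EB.
case: (track mT1 KA (hs2 ++ fns As ++ fns Y2) HK aA) => l1 p1 C1 P1 mo1 qu1 C1' P1' mo1' qu1' hs1 R1.
move=> HT1 Hmo1 Hqu1 HA1 U1 ah1 EA.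
set Y1 := [:: _; _; _] in EA.
have [pq1 pq2 H12] := cT _ _ _ _ _ _ _ _ _ _ _ _ _ _ HT1 HT2.
have pAs : sumn (map pend As) = 1.
  by rewrite -pK (pend_cong (nf_to_cong HK)) pend_news pend_pars.
pose r1 := CRun l1 p1 C1 (pnews hs1 P1); pose r2 := CRun l2 p2 C2 (pnews hs2 P2).
have LA : lcong (qu1 :: r1 :: mo1 :: R1) (qu2 :: r2 :: mo2 :: R2).
  apply: lc_trans (lcong_mid _ [:: r1; mo1] R1) _.
  apply: lc_trans HA1 _; apply: lc_trans (lcong_sym HA2) _.
  exact: lcong_sym (lcong_mid _ [:: r2; mo2] R2).
have pA1 : pend qu1 + sumn (map pend R1) = 1.
  have := lcong_pend HA1; rewrite pAs /=; case: (mo1) Hmo1 => //=; lia.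
have pqu1 : pend qu1 = 1 by clear -pA1 pq1; lia.
(* If the queues were different atoms, [qu2] would be among the remaining atoms of the first redex,
   and two messages would be pending. *)
have [qq {}LA] : acong qu1 qu2 /\ lcong (r1 :: mo1 :: R1) (r2 :: mo2 :: R2).
  case: (lcong_cons2 LA) => // -[s [/lcong_pend H _]].
  move: H => /=; have -> : pend mo1 = 0 by case: (mo1) Hmo1.
  by clear -pA1 pq1 pq2; lia.
have [p12 mo12] := H12 qq pqu1.
(* The roles keep the two runs apart, [mo12] the two monitors, and a run is never congruent to a
   monitor. So each redex leaves the run and the monitor of the other one untouched; [S] is the
   rest. *)
have [S [LR1 LR2]] : exists S, lcong R1 (r2 :: mo2 :: S) /\ lcong R2 (r1 :: mo1 :: S).
  case: (lcong_cons2 LA) => [[/acong_shapeP/= []]|[s [H1 H2]]] //.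
  case: (lcong_cons2 H1) => [[/acong_shapeP/=]|[s1 [H3 H4]]]; first by case: (mo1) Hmo1.
  case: (lcong_cons2 H2) => [[/acong_shapeP/=]|[s2 [H5 H6]]]; first by case: (mo2) Hmo2.
  case: (lcong_cons2 (lc_trans (lcong_sym H4) H6)) => [[/mo12]|[S [H7 H8]]] //.
  exists S; split.
    by apply: lc_trans H3 _; constructor.
  by apply: lc_trans H5 _; constructor.
have sub1 : {subset fns (r1 :: mo1 :: qu1 :: R1) <= fns As} by move=> x; rewrite -(lcong_fns HA1).
have sub2 : {subset fns (r2 :: mo2 :: qu2 :: R2) <= fns As} by move=> x; rewrite -(lcong_fns HA2).
have subS : {subset fns S <= fns As}.
  move=> x xS; apply: sub1; rewrite !fns_cons !mem_cat (lcong_fns LR1).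
  by rewrite !fns_cons !mem_cat xS !orbT.
have submo1 : {subset config_fn mo1 <= fns As}.
  by move=> x xS; apply: sub1; rewrite !fns_cons !mem_cat xS !orbT.
have submo2 : {subset config_fn mo2 <= fns As}.
  by move=> x xS; apply: sub2; rewrite !fns_cons !mem_cat xS !orbT.
(* By [move_fn] a name of [hs2] in the reduct [Y1] would already be in its redex. As [hs1] avoids
   [hs2], it would be free in [As], which [hs2] avoids. *)
have a21 : apart hs2 (fns Y1).
  have ha : apart hs2 (fns As) by move: ah2; bool_sets.
  apply/apartP => x x2 x1.
  have /(move_fn mT1 HT1) : x \in config_fn (pars Y1) by rewrite fn_pars.
  rewrite fn_pars => xX; have x1' : x \notin hs1.
    apply/negP => xh; move: ah1; rewrite !apart_catr => /andP[/and3P[/apartP H _ _] _].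
    exact: H xh x2.
  move/apartP: ha => /(_ _ x2); apply; apply: sub1; move: xX.
  rewrite /r1 !fns_cons !mem_cat /= !inE !mem_cat fn_pnews x1' /=.
  by move=> /or4P[->|->|->|//]; rewrite ?orbT.
exists l1, p1, C1, P1, mo1, qu1, C1', P1', mo1', qu1', l2, p2, C2, P2, mo2, qu2, C2', P2', mo2', qu2'.
(* The restrictions hidden in both runs are extruded on both sides, even from the run that has not
   moved. *)
exists (gs ++ hs1 ++ hs2), S; split=> //.
- apply: c_trans EA _; rewrite !news_cat; do 2 apply: news_cong.
  apply: c_trans (lcong_pars (lcong_cat (lcong_refl Y1) LR1)) _.
  apply: (@pars_open _ _ _ _ _ (mo2 :: S) Y1).
  have ha : apart hs2 (fns As) by move: ah2; bool_sets.
  rewrite 2!apart_catr a21 andbT; apply/andP; split; first by move: ah2; bool_sets.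
  by apply: sub_apart ha => // x; rewrite fns_cons mem_cat => /orP[/submo2|/subS].
- apply: c_trans EB _; apply: c_trans (c_sym _); last first.
    by apply: (news_perm (hs := gs ++ hs2 ++ hs1)); rewrite perm_cat2l perm_catC.
  rewrite !news_cat; do 2 apply: news_cong.
  apply: c_trans (lcong_pars (lcong_cat (lcong_refl Y2) LR2)) _.
  apply: (@pars_open _ _ _ _ _ (mo1 :: S) Y2).
  have ha : apart hs1 (fns As) by move: ah1; bool_sets.
  rewrite 2!apart_catr; apply/and3P; split; try by move: ah1; bool_sets.
  by apply: sub_apart ha => // x; rewrite fns_cons mem_cat => /orP[/submo1|/subS].
Qed.

(** A sender works at the end of the pending messages and a receiver at their front; with a single
    message these are the same. *)
Lemma queue_match s hi ho m s' hi' m' ho' :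
  acong (CQueue s hi (rcons ho m)) (CQueue s' hi' (m' :: ho')) -> size ho = 0 ->
  [/\ s = s', queue_cong hi hi', ho = [::] /\ ho' = [::], m.1 = m'.1 &
      match m.2, m'.2 with
      | MVal V, MVal V' => vcong V V' | MLab l, MLab l' => l = l' | _, _ => False
      end].
Proof.
move=> /acong_shapeP [-> Hi Ho] /size0nil E; subst ho.
by have [m'' [[<- ->] E1 E2]] := queue_cong1 Ho.
Qed.

Lemma snd_rcv_compat t : compat (snd_move t) (rcv_move t).
Proof.
move=> l1 p1 C1 P1 mo1 qu1 Y1 l2 p2 C2 P2 mo2 qu2 Y2 H1 H2.
have mon_neq s p h T xs sg u s' p' h' T' xs' sg' u' : p <> p' ->
  ~ acong (CMon s p h T xs sg u) (CMon s' p' h' T' xs' sg' u').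
  by move=> pp /acong_shapeP [].
inversion H1 as [l p C V P s q U h T xs sg hi ho W pq _|l p C w Ps P Ps' s q Ts T Ts' h xs sg hi ho pq];
inversion H2 as [l' q' C' y Q s' p' U' h' T' xs' sg' V' hi' ho' pq' _|l' q' C' w' Qs Q Qs' s' p' Us U' Us' h' xs' sg' hi' ho' pq'];
subst; split; rewrite /= ?size_rcons // => /queue_match H [/H].
all: case=> _ _ _ [E1 E2] _; subst; split; last apply: mon_neq; apply/eqP; by rewrite // eq_sym.
Qed.

(** * From two half steps to one synchronization *)

(** A synchronization, before and after, with tag [t] on both monitors afterwards. [Empty] gives the
    forward rules. [Full] gives the configuration where an undoing has just started, so that
    clearing its tags gives the source of the backward rules. *)
Inductive exchange (t : Defs.tag) : config -> config -> Prop :=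
  | XVal l1 p C1 V P l2 q C2 y Q s U1 U2 h1 T1 xs1 sg1 h2 T2 xs2 sg2 hi W :
      p != q -> (if t is Empty then value_ok sg1 V /\ W = value_sub sg1 V else W = V) ->
      (t = Empty -> y \notin xs2 /\ y \notin dom sg2) ->
      exchange t
        (pars [:: CRun l1 p C1 (POut (CEnd s p) V P);
                  CMon s p h1 (TOut q U1 T1) xs1 sg1 Empty;
                  CRun l2 q C2 (PIn (CEnd s q) y Q);
                  CMon s q h2 (TIn p U2 T2) xs2 sg2 Empty;
                  CQueue s hi [::]])
        (pars [:: CRun l1 p C1 P;
                  CMon s p (EOut q U1 :: h1) T1 xs1 sg1 t;
                  CRun l2 q C2 Q;
                  CMon s q (EIn p U2 :: h2) T2 (y :: xs2) ((y, W) :: sg2) t;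
                  CQueue s (rcons hi (p, q, MVal W)) [::]])
  | XLab l1 p C1 Ps P Ps' l2 q C2 Qs Q Qs' s w Ts1 T1 Ts1' Ts2 T2 Ts2'
         h1 xs1 sg1 h2 xs2 sg2 hi :
      p != q ->
      exchange t
        (pars [:: CRun l1 p C1 (PSel (CEnd s p) (Ps ++ (w, P) :: Ps'));
                  CMon s p h1 (TSel q (Ts1 ++ (w, T1) :: Ts1')) xs1 sg1 Empty;
                  CRun l2 q C2 (PBra (CEnd s q) (Qs ++ (w, Q) :: Qs'));
                  CMon s q h2 (TBra p (Ts2 ++ (w, T2) :: Ts2')) xs2 sg2 Empty;
                  CQueue s hi [::]])
        (pars [:: CRun l1 p (FSel (CEnd s p) Ps Ps' :: C1) P;
                  CMon s p (ESel q w Ts1 Ts1' :: h1) T1 xs1 sg1 t;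
                  CRun l2 q (FBra (CEnd s q) Qs Qs' :: C2) Q;
                  CMon s q (EBra p w Ts2 Ts2' :: h2) T2 xs2 sg2 t;
                  CQueue s (rcons hi (p, q, MLab w)) [::]]).

Lemma pars5 a b c d e R :
  cong (pars ([:: a; b; e; c; d] ++ R)) (CPar (pars [:: a; b; c; d; e]) (pars R)).
Proof.
apply: c_trans (pars_cat _ _) _; apply: c_par; last exact: c_refl.
by apply: lcong_pars; do 2 constructor=> //; apply: (lcong_mid e [:: c; d] [::]).
Qed.

Lemma pars5' a b c d e R :
  cong (pars ([:: c; d; e; a; b] ++ R)) (CPar (pars [:: a; b; c; d; e]) (pars R)).
Proof.
apply: c_trans (pars_cat _ _) _; apply: c_par; last exact: c_refl.
by apply: lcong_pars; apply: (lcong_catC [:: c; d; e] [:: a; b]).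
Qed.

Lemma exchange_of_moves t K A B : pend K = 1 ->
  reduces (snd_move t) K A -> reduces (rcv_move t) K B ->
  exists ns x y R, [/\ exchange t x y, cong A (news ns (CPar x (pars R))) &
                       cong B (news ns (CPar y (pars R)))].
Proof.
move=> pK KA KB.
case: (merge_moves (snd_move_move t) (rcv_move_move t) (@snd_rcv_compat t) pK KA KB).
move=> l1 [p1 [C1 [P1 [mo1 [qu1 [C1' [P1' [mo1' [qu1' [l2 [p2 [C2 [P2 [mo2 [qu2 [C2' [P2' [mo2' [qu2' [ns [R]]]]]]]]]]]]]]]]]]]]].
case=> H1 H2 [] Q Q1 EA EB.
have lc5 a a' b b' c c' d d' e e' : acong a a' -> acong b b' -> acong c c' -> acong d d' ->
    acong e e' -> lcong ([:: a; b; c; d; e] ++ R) ([:: a'; b'; c'; d'; e'] ++ R).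
  by move=> *; do 5 constructor=> //.
inversion H1 as [l p C V P s q U h T xs sg hi ho W pq HW E1 E1'|l p C w Ps P Ps' s q Ts T Ts' h xs sg hi ho pq E1 E1'];
inversion H2 as [l' q' C' y Q0 s' p' U' h' T' xs' sg' V' hi' ho' pq' Hy E2 E2'|l' q' C' w' Qs Q0 Qs' s' p' Us T' Us' h' xs' sg' hi' ho' pq' E2 E2'];
subst; move: Q Q1; rewrite /= size_rcons => /queue_match H [/H] {H} [Es Hh [Eo Eo'] Ep Em];
  move: Ep Em; rewrite //= => -[Ep Eq] Em; subst.
- do 4 eexists; split.
  + eapply XVal; [exact: pq|exact: HW|exact: Hy].
  + apply: c_trans EA _; apply: news_cong; exact: pars5.
  + apply: c_trans EB _; apply: news_cong; apply: c_trans _ (pars5' _ _ _ _ _ _).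
    apply: lcong_pars; apply: lc5 => //.
    (* The receiver may see the message in a congruent form; its store and the queue are converted
       to the value of the sender. *)
    * by apply: ac_mon; constructor; [apply: vc_sym|apply: store_cong_refl].
    * apply: ac_queue; last exact: queue_cong_refl.
      by apply: queue_cong_rcons => //=; [apply: queue_cong_sym|apply: vc_sym].
- do 4 eexists; split.
  + eapply XLab; exact: pq.
  + apply: c_trans EA _; apply: news_cong; exact: pars5.
  + apply: c_trans EB _; apply: news_cong; apply: c_trans _ (pars5' _ _ _ _ _ _).
    apply: lcong_pars; apply: lc5 => //.
    apply: ac_queue; last exact: queue_cong_refl.
    by apply: queue_cong_rcons => //=; apply: queue_cong_sym.
Qed.

Lemma exchange_fwd x y : exchange Empty x y -> fwd_sync x y.
Proof.
by case=> [l1 p C1 V P l2 q C2 y0 Q s U1 U2 h1 T1 xs1 sg1 h2 T2 xs2 sg2 hi W pq [ok ->] /(_ erefl)[]|*];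
  constructor.
Qed.

Lemma exchange_bwd x y : exchange Full x y -> bwd_sync (clear y) x.
Proof. by case=> > ; move=> *; subst; constructor. Qed.

(** * Case analysis of decoupled steps by counting *)

Lemma reduces_or (R1 R2 : config -> config -> Prop) M N :
  reduces (fun M N => R1 M N \/ R2 M N) M N -> reduces R1 M N \/ reduces R2 M N.
Proof.
elim=> {M N} [M N [H|H]|M N K _ [H|H]|n M N _ [H|H]|M M' N' N MM _ [H|H] NN].
- by left; apply: red_rule.
- by right; apply: red_rule.
- by left; apply: red_par.
- by right; apply: red_par.
- by left; apply: red_new.
- by right; apply: red_new.
- by left; apply: red_cong MM H NN.
- by right; apply: red_cong MM H NN.
Qed.

Lemma reduces_mono (R1 R2 : config -> config -> Prop) M N :
  (forall M N, R1 M N -> R2 M N) -> reduces R1 M N -> reduces R2 M N.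
Proof.
move=> R12; elim=> {M N} [M N /R12 H|M N K _ H|n M N _ H|M M' N' N MM _ H NN].
- exact: red_rule.
- exact: red_par.
- exact: red_new.
- exact: red_cong MM H NN.
Qed.

Lemma reduces_flip (R : config -> config -> Prop) M N :
  reduces (fun M N => R N M) M N -> reduces R N M.
Proof.
elim=> {M N} [M N H|M N K _ H|n M N _ H|M M' N' N MM _ H NN].
- exact: red_rule.
- exact: red_par.
- exact: red_new.
- exact: red_cong (c_sym NN) H (c_sym MM).
Qed.

Lemma reduces_news (R : config -> config -> Prop) gs M N :
  reduces R M N -> reduces R (news gs M) (news gs N).
Proof. by move=> H; elim: gs => //= g gs; apply: red_new. Qed.

(** Offsets on both sides let one lemma count upwards and downwards without subtraction. *)
Lemma reduces_count (R : config -> config -> Prop) a b c d M N :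
  (forall M N, R M N -> pend M + a = pend N + b /\ full M + c = full N + d) ->
  reduces R M N -> pend M + a = pend N + b /\ full M + c = full N + d.
Proof.
move=> HR; elim=> {M N} [M N /HR //|M N K _ [H H']|n M N _ [H H']|M M' N' N MM _ [H H'] NN] /=.
- by split; lia.
- by [].
- by rewrite (pend_cong MM) (full_cong MM) -(pend_cong NN) -(full_cong NN).
Qed.

Lemma snd_count t M N : snd_move t M N ->
  pend M + 0 = pend N + 1 /\ full M + 0 = full N + (if t is Full then 1 else 0).
Proof. by case: t => -[] * /=; rewrite size_rcons; split; lia. Qed.

Lemma rcv_count t M N : rcv_move t M N ->
  pend M + 0 = pend N + 1 /\ full M + (if t is Full then 1 else 0) = full N + 0.
Proof. by case: t => -[] * /=; split; lia. Qed.

Lemma init_count M N : init M N -> [/\ pend M = 0, full M = 0, pend N = 0 & full N = 0].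
Proof.
case=> s a e es G _ _ _ _ _; split=> /=.
- by elim: es.
- by elim: es.
- by rewrite addn0; elim: es.
- by rewrite addn0; elim: es.
Qed.

Lemma fwd_shared_count M N : fwd_shared M N -> pend M + 0 = pend N + 0 /\ full M + 0 = full N + 0.
Proof. by case=> // [M0 N0 /init_count [-> -> -> ->]]. Qed.

Lemma bwd_shared_count M N : bwd_shared M N -> pend M + 0 = pend N + 0 /\ full M + 0 = full N + 0.
Proof. by case=> // [M0 N0 /init_count [-> -> -> ->]]. Qed.

(** All that has to be remembered of a start of undoing: it changes nothing but tags, and two of
    them become full. *)
Definition roll M N := [/\ clear M = clear N, pend M + 0 = pend N + 0 & full M + 2 = full N + 0].

Lemma fwd_half_moves M N : fwd_half M N -> snd_move Empty N M \/ rcv_move Empty M N.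
Proof.
case=> >; move=> *.
- by left; apply: SMVal.
- by right; apply: RMVal.
- by left; apply: SMLab.
- by right; apply: RMLab.
Qed.

Lemma bwd_half_moves M N : bwd_half M N -> roll M N \/ rcv_move Full N M \/ snd_move Full M N.
Proof.
case=> >; move=> *.
- by left; split=> //=; lia.
- by left; split=> //=; lia.
- by right; left; apply: RMVal.
- by right; right; apply: SMVal.
- by right; left; apply: RMLab.
- by right; right; apply: SMLab.
Qed.

Lemma decoupled_fwd_cases M N : decoupled_fwd M N ->
  [\/ [/\ reduces fwd_shared M N, pend M = pend N & full M = full N],
      [/\ reduces (snd_move Empty) N M, pend N = (pend M).+1 & full M = full N] |
      [/\ reduces (rcv_move Empty) M N, pend M = (pend N).+1 & full M = full N]].
Proof.
case/reduces_or => [H|].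
  by apply: Or31; have := reduces_count fwd_shared_count H; rewrite !addn0 => -[].
move/(reduces_mono fwd_half_moves)/reduces_or => [/reduces_flip H|H].
  by apply: Or32; have := reduces_count (@snd_count Empty) H; rewrite !addn0 addn1 => -[].
by apply: Or33; have := reduces_count (@rcv_count Empty) H; rewrite !addn0 addn1 => -[].
Qed.

Lemma decoupled_bwd_cases M N : decoupled_bwd M N ->
  [\/ [/\ reduces bwd_shared M N, pend M = pend N & full M = full N],
      [/\ cong (clear M) (clear N), pend M = pend N & full N = (full M).+2],
      [/\ reduces (rcv_move Full) N M, pend N = (pend M).+1 & full M = (full N).+1] |
      [/\ reduces (snd_move Full) M N, pend M = (pend N).+1 & full M = (full N).+1]].
Proof.
case/reduces_or => [H|].
  by apply: Or41; have := reduces_count bwd_shared_count H; rewrite !addn0 => -[].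
move/(reduces_mono bwd_half_moves)/reduces_or => [H|].
  apply: Or42; have [|E1 E2] := @reduces_count roll 0 0 2 0 M N _ H; first by move=> ? ? [].
  rewrite !addn0 addn2 in E1 E2.
  split=> //; elim: H {E1 E2} => {M N} [M N [-> _ _]|M N K _ H|n M N _ H|M M' N' N MM _ H NN].
  - exact: c_refl.
  - by apply: c_par => //; apply: c_refl.
  - exact: c_new.
  - by apply: c_trans (clear_cong MM) _; apply: c_trans H (clear_cong NN).
case/reduces_or => [/reduces_flip H|H].
  by apply: Or43; have := reduces_count (@rcv_count Full) H; rewrite !addn0 !addn1 => -[-> ->].
by apply: Or44; have := reduces_count (@snd_count Full) H; rewrite !addn0 !addn1 => -[-> ->].
Qed.

(** * Splitting synchronizations into half steps *)

(** The output comes first, then the input. The bound on [pend M1] shows that [M1] is not stable, in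
    a form that passes through contexts and congruence. *)
Lemma fwd_sync_split M N : reduces fwd_sync M N ->
  exists M1, [/\ 0 < pend M1, decoupled_fwd M M1 & decoupled_fwd M1 N].
Proof.
elim=> {M N} [M N H|M N K _ [M1 [H1 H2 H3]]|n M N _ [M1 [H1 H2 H3]]|M M' N' N MM _ [M1 [H1 H2 H3]] NN].
(* Pure rearrangement: [a], [b] are the run and the monitor of the sender, [c], [d] those of the
   receiver, and [e], [e'], [e''] the successive states of the queue. *)
- have step X Y a b c d e a' b' c' d' e' e'' : X = pars [:: a; b; c; d; e] -> Y = pars [:: a'; b'; c'; d'; e''] ->
    fwd_half (pars [:: a; b; e]) (pars [:: a'; b'; e']) -> fwd_half (pars [:: c; d; e']) (pars [:: c'; d'; e'']) ->
    0 < pend e' -> exists M1, [/\ 0 < pend M1, decoupled_fwd X M1 & decoupled_fwd M1 Y].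
    move=> -> -> F1 F2 pe; exists (CPar (pars [:: a'; b'; e']) (pars [:: c; d])); split.
    + by rewrite /=; lia.
    + apply: red_cong _ (red_par (pars [:: c; d]) (red_rule (or_intror F1))) (c_refl _).
      apply: c_trans _ (pars_cat [:: a; b; e] [:: c; d]); apply: c_trans (c_sym (c_par0 _)) _.
      apply: c_sym; exact: (pars5 a b c d e [::]).
    + apply: red_cong _ (red_par (pars [:: a'; b']) (red_rule (or_intror F2))) _.
        apply: c_trans (c_sym (pars_cat [:: a'; b'; e'] [:: c; d])) _.
        apply: c_trans _ (pars_cat [:: c; d; e'] [:: a'; b']).
        apply: lcong_pars => /=; apply: lc_trans (lcong_catC [:: a'; b'] [:: e'; c; d]) _.
        by apply: (lcong_mid e' [:: c; d] [:: a'; b']).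
      apply: c_trans (c_sym (pars_cat [:: c'; d'; e''] [:: a'; b'])) _.
      exact: (lcong_pars (lcong_catC [:: c'; d'; e''] [:: a'; b'])).
  case: H => *; apply: step; try reflexivity.
  + exact: FOut.
  + exact: FIn.
  + by [].
  + exact: FSelect.
  + exact: FBranch.
  + by [].
- exists (CPar M1 K); split; first by rewrite /=; lia.
  + exact: red_par. + exact: red_par.
- exists (CNew n M1); split=> //; exact: red_new.
- exists M1; split=> //; first exact: red_cong MM H2 (c_refl _).
  exact: red_cong (c_refl _) H3 NN.
Qed.

(** The input is undone before the output, because it puts the message back among the pending ones.
    [M1] is unstable through its full tags and [M2] through that message. *)
Lemma bwd_sync_split M N : reduces bwd_sync M N ->
  exists M1 M2, [/\ 0 < full M1, 0 < pend M2, decoupled_bwd M M1, decoupled_bwd M1 M2 & decoupled_bwd M2 N].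
Proof.
elim=> {M N} [M N H|M N K _ [M1 [M2 [H1 H2 H3 H4 H5]]]|n M N _ [M1 [M2 [H1 H2 H3 H4 H5]]]|M M' N' N MM _ [M1 [M2 [H1 H2 H3 H4 H5]]] NN].
- have step X Y a b c d e a' b' c' d' e' e'' bf df :
    X = pars [:: a; b; c; d; e] -> Y = pars [:: a'; b'; c'; d'; e''] ->
    bwd_half (pars [:: b; d; e]) (pars [:: bf; df; e]) ->
    bwd_half (pars [:: c; df; e]) (pars [:: c'; d'; e']) ->
    bwd_half (pars [:: a; bf; e']) (pars [:: a'; b'; e'']) ->
    0 < full bf -> 0 < pend e' ->
    exists M1 M2, [/\ 0 < full M1, 0 < pend M2, decoupled_bwd X M1, decoupled_bwd M1 M2 & decoupled_bwd M2 Y].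
    move=> -> -> F1 F2 F3 fb pe.
    exists (CPar (pars [:: bf; df; e]) (pars [:: a; c])), (CPar (pars [:: c'; d'; e']) (pars [:: a; bf])); split.
    + by rewrite /=; lia.
    + by rewrite /=; lia.
    + apply: red_cong _ (red_par (pars [:: a; c]) (red_rule (or_intror F1))) (c_refl _).
      apply: c_trans _ (pars_cat [:: b; d; e] [:: a; c]); apply: lcong_pars.
      apply: lc_trans (lcong_mid a [:: b] [:: c; d; e]) _ => /=; constructor => //.
      apply: lc_trans (lcong_mid a [:: c; d; e] [::]) _ => /=.
      apply: lc_trans (lcong_mid c [:: d; e] [:: a]) _ => /=.
      by do 2 constructor=> //; apply: lc_swap.
    + apply: red_cong _ (red_par (pars [:: a; bf]) (red_rule (or_intror F2))) (c_refl _).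
      apply: c_trans (c_sym (pars_cat [:: bf; df; e] [:: a; c])) _.
      apply: c_trans _ (pars_cat [:: c; df; e] [:: a; bf]); apply: lcong_pars => /=.
      apply: lc_trans (lcong_mid bf [:: df; e; a; c] [::]) _ => /=.
      apply: lc_trans (lcong_sym (lcong_mid c [:: df; e; a] [:: bf])) _ => /=.
      exact: lcong_refl.
    + apply: red_cong _ (red_par (pars [:: c'; d']) (red_rule (or_intror F3))) _.
        apply: c_trans (c_sym (pars_cat [:: c'; d'; e'] [:: a; bf])) _.
        apply: c_trans _ (pars_cat [:: a; bf; e'] [:: c'; d']); apply: lcong_pars => /=.
        apply: lc_trans (lcong_catC [:: c'; d'] [:: e'; a; bf]) _ => /=.
        exact: (lcong_mid e' [:: a; bf] [:: c'; d']).
      apply: c_trans (c_sym (pars_cat [:: a'; b'; e''] [:: c'; d'])) _; apply: lcong_pars => /=.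
      by do 2 constructor=> //; apply: (lcong_mid e'' [:: c'; d'] [::]).
  case: H => *; apply: step; try reflexivity.
  + exact: BRollVal.
  + exact: BIn.
  (* The single pending message has to be read as [rcons [::] _]. *)
  + by apply: (@BOut _ _ _ _ _ _ _ _ _ _ _ _ _ [::]).
  + by [].
  + by [].
  + exact: BRollLab.
  + exact: BBranch.
  + by apply: (@BSelect _ _ _ _ _ _ _ _ _ _ _ _ _ _ _ _ [::]).
  + by [].
  + by [].
- exists (CPar M1 K), (CPar M2 K); split; try exact: red_par.
  + by rewrite /=; lia. + by rewrite /=; lia.
- by exists (CNew n M1), (CNew n M2); split=> //; apply: red_new.
- exists M1, M2; split=> //; first exact: red_cong MM H3 (c_refl _).
  exact: red_cong (c_refl _) H5 NN.
Qed.

(** Intermediate configurations have to be unstable: two consecutive shared steps also lead from a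
    stable configuration to a stable one, but are in general not a single atomic step. *)
Theorem theorem1 (M N : config) (stableM : stable M) (stableN : stable N) :
  (atomic_fwd M N <->
     (decoupled_fwd M N \/
      exists M1 : config,
        [/\ ~ stable M1, decoupled_fwd M M1 & decoupled_fwd M1 N])) /\
  (atomic_bwd M N <->
     (decoupled_bwd M N \/
      exists M1 M2 : config,
        [/\ ~ stable M1, ~ stable M2, decoupled_bwd M M1,
            decoupled_bwd M1 M2 & decoupled_bwd M2 N])).
Proof.
have [pM fM] := proj1 (stableP M) stableM.
have [pN fN] := proj1 (stableP N) stableN.
split; split.
- case/reduces_or => [H|/fwd_sync_split [M1 [p1 H1 H2]]].
    by left; apply: reduces_mono H => *; left.
  by right; exists M1; split=> // /stableP []; lia.
- case=> [/decoupled_fwd_cases [][H p f]|[M1 [uM1 /decoupled_fwd_cases H1 /decoupled_fwd_cases H2]]].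
  + by apply: reduces_mono H => *; left.
  + by lia.
  + by lia.
  have {}uM1 : ~ (pend M1 = 0 /\ full M1 = 0) by move/stableP.
  (* A shared step on either side would make [M1] stable. Since nothing is pending in [M] and [N],
     the first step is an output and the second an input. *)
  case: H1 => -[H1 p1 f1]; try lia.
  case: H2 => -[H2 p2 f2]; try lia.
  have pM1 : pend M1 = 1 by lia.
  have [ns [x [y [R [xy EM EN]]]]] := exchange_of_moves pM1 H1 H2.
  apply: red_cong EM _ (c_sym EN); apply: reduces_news; apply: red_par; apply: red_rule; right.
  exact: exchange_fwd.
- case/reduces_or => [H|/bwd_sync_split [M1 [M2 [f1 p2 H1 H2 H3]]]].
    by left; apply: reduces_mono H => *; left.
  by right; exists M1, M2; split=> // /stableP []; lia.
- case=> [/decoupled_bwd_cases [][H p f]|[M1 [M2 [uM1 uM2 /decoupled_bwd_cases H1 /decoupled_bwd_cases H2 /decoupled_bwd_cases H3]]]].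
  + by apply: reduces_mono H => *; left.
  + by lia.
  + by lia.
  + by lia.
  have {}uM1 : ~ (pend M1 = 0 /\ full M1 = 0) by move/stableP.
  have {}uM2 : ~ (pend M2 = 0 /\ full M2 = 0) by move/stableP.
  (* Counting pending messages and full tags as pairs, the only way from (0, 0) to (0, 0) in three
     steps through unstable configurations is via (0, 2) and (1, 1). *)
  case: H1 => -[H1 p1 f1]; try lia.
  case: H3 => -[H3 p3 f3]; try lia.
  case: H2 => -[H2 p2 f2]; try lia.
  have pM2 : pend M2 = 1 by lia.
  have [ns [x [y [R [xy EN EM]]]]] := exchange_of_moves pM2 H3 H2.
  (* [R] is part of the stable [N], so clearing the tags only affects the synchronizing components
     [y]. *)
  have clearR : clear (pars R) = pars R.
    apply/clear_stable/stableP; move: pN fN.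
    by rewrite (pend_cong EN) (full_cong EN) pend_news full_news /=; lia.
  have {}EM : cong M (news ns (CPar (clear y) (pars R))).
    rewrite -(clear_stable stableM); apply: c_trans H1 _.
    by have := clear_cong EM; rewrite clear_news /= clearR.
  apply: red_cong EM _ (c_sym EN); apply: reduces_news; apply: red_par; apply: red_rule; right.
  exact: exchange_bwd.
Qed.
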